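(* Let $M$ be a smooth manifold. There is a canonical one-to-one correspondence between contact structures $C\subset TM$ on $M$ and symplectic $\mathbb{R}^\times$-principal bundles $P$ over $M$ (the latter being identified when they are isomorphic, i.e. related by an isomorphism of $\mathbb{R}^\times$-principal bundles over $\mathrm{id}_M$ which is a symplectomorphism). In this correspondence the symplectic $\mathbb{R}^\times$-principal bundle associated with a contact structure $C$ can be identified with $(C^o)^\times\subset T^*M$, where $C^o\subset T^*M$ is the annihilator of $C$.
   Context: All objects are smooth. $\mathbb{R}^\times=\mathbb{R}\setminus\{0\}=GL(1,\mathbb{R})$. For a vector bundle $E$, $E^\times$ denotes the open submanifold of non-zero vectors of $E$. A contact form on a manifold $N$ of dimension $2n+1$ is a 1-form $\eta$ such that $\eta\wedge(d\eta)^n$ is nowhere vanishing. A contact structure on a manifold $M$ of odd dimension is a distribution of hyperplanes $C\subset TM$ such that locally $C=\ker(\eta)$ for a (local) contact form $\eta$. A symplectic $\mathbb{R}^\times$-principal bundle over $M$ is an $\mathbb{R}^\times$-principal bundle $\tau:P\to M$ with action $h:\mathbb{R}^\times\times P\to P$, $h_s=h(s,\cdot)$, together with a symplectic form $\omega$ on $P$ which is 1-homogeneous: $h_s^*\omega=s\cdot\omega$ for all $s\in\mathbb{R}^\times$. For a line subbundle $L\subset T^*M$ (such as $C^o$), $L^\times$ is an $\mathbb{R}^\times$-principal bundle over $M$ with the action of multiplication by non-zero reals. $(C^o)^\times$ carries this action and the restriction of the canonical symplectic form $\omega_M$ of $T^*M$ (which is 1-homogeneous; its overall sign is a matter of convention).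 *)

(* Defs.v *)
From HB Require Import structures.
From mathcomp Require Import all_boot all_order all_algebra all_fingroup.
From mathcomp Require Import all_classical all_reals all_analysis.
Set Implicit Arguments.
Unset Strict Implicit.
Unset Printing Implicit Defensive.
Import Order.TTheory GRing.Theory Num.Theory.
Import numFieldNormedType.Exports.
Local Open Scope classical_set_scope.
Local Open Scope ring_scope.

Section Calculus.
Context {R : realType}.
(* f is of class C^(k+1) on the open set U iff it is differentiable on U and
   (x, v) |-> Df(x) v is of class C^k on U * E. On finite-dimensional spaces
   this is the usual notion; on open sets of R^n it amounts to the existence
   and continuity of all partial derivatives of order at most k + 1. *)
Fixpoint Ck (k : nat) (E F : normedModType R) (U : set E) (f : E -> F) : Prop :=
  if k is k'.+1 then
    (forall x, U x -> differentiable f x) /\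
    Ck k' (U `*` setT) (fun p : E * E => 'd f (p.1) (p.2))
  else forall x, U x -> {for x, continuous f}.

Definition smooth_on (E F : normedModType R) (U : set E) (f : E -> F) :=
  forall k, Ck k U f.

Lemma near_is_diff (E F : normedModType R) (f g : E -> F) x :
  {near x, f =1 g} -> differentiable f x -> is_diff x g ('d f x).
Proof.
move=> fg df; have [c0 key] := (diff_locallyP x f).1 df.
have fgx := nbhs_singleton fg.
have key' : g \o shift x = cst (g x) + 'd f x +o_ (0 : E) id.
  apply/eqaddoE/eqaddoP => e e0; move/eqaddoP : key => /(_ e e0).
  move: fg; rewrite !near_simpl (near_shift 0) => fg.
  apply: filterS2 fg => y /=; rewrite subr0 => fgy.
  by rewrite !fctE /= fgy fgx.
have e0 := diff_unique c0 key'.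
split; last exact: e0.
by apply/diff_locallyP; rewrite e0.
Qed.

Lemma eq_open_is_diff (E F : normedModType R) (U : set E) (f g : E -> F) x :
  open U -> U x -> {in U, f =1 g} -> differentiable f x ->
  is_diff x g ('d f x).
Proof.
move=> oU Ux fg; apply: near_is_diff.
apply: filterS (open_nbhs_nbhs (conj oU Ux)) => y Uy.
by apply: fg; rewrite inE.
Qed.

Lemma open_setX (S T : topologicalType) (U : set S) (V : set T) :
  open U -> open V -> open (U `*` V).
Proof.
move=> oU oV; rewrite (_ : U `*` V = fst @^-1` U `&` snd @^-1` V)//.
by apply: openI; apply: open_comp => // x _; [exact: cvg_fst|exact: cvg_snd].
Qed.

Lemma open_setXT (S T : topologicalType) (U : set S) :
  open U -> open (U `*` @setT T).
Proof. by move=> oU; apply: open_setX => //; exact: openT. Qed.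

Lemma Ck_eq k (E F : normedModType R) (U : set E) (f g : E -> F) :
  open U -> {in U, f =1 g} -> Ck k U f -> Ck k U g.
Proof.
elim: k E F U f g => [|k IH] E F U f g oU fg /=.
  move=> cf x Ux; have := cf x Ux; rewrite /continuous_at /prop_for.
  rewrite -fg ?inE// => h; apply: cvg_trans h; apply: near_eq_cvg.
  by apply: filterS (open_nbhs_nbhs (conj oU Ux)) => y Uy; apply: fg; rewrite inE.
move=> [df Cf]; split.
  by move=> x Ux; have [] := eq_open_is_diff oU Ux fg (df x Ux).
apply: IH Cf; first exact: open_setXT.
move=> [x v]; rewrite inE/= => -[Ux _].
by have [_ ->] := eq_open_is_diff oU Ux fg (df x Ux).
Qed.

Lemma CkW k (E F : normedModType R) (U V : set E) (f : E -> F) :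
  V `<=` U -> Ck k U f -> Ck k V f.
Proof.
elim: k E F U V f => [|k IH] E F U V f VU /=; first by move=> cf x /VU/cf.
move=> [df Cf]; split; first by move=> x /VU/df.
by apply: IH Cf => -[x v] [/VU ? ?].
Qed.

Lemma CkP k (E F : normedModType R) (U : set E) (f : E -> F) :
  Ck k.+1 U f -> Ck k U f.
Proof.
elim: k E F U f => [|k IH] E F U f /=.
  by move=> [df _] x /df/differentiable_continuous.
by move=> [df Cf]; split => //; exact: IH.
Qed.

Lemma Ck_pair k (E F G : normedModType R) (U : set E) (f : E -> F) (g : E -> G) :
  open U -> Ck k U f -> Ck k U g -> Ck k U (fun x => (f x, g x)).
Proof.
elim: k E F G U f g => [|k IH] E F G U f g oU /=.
  by move=> cf cg x Ux; apply: cvg_pair; [exact: cf | exact: cg].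
move=> [df Cf] [dg Cg]; split.
  by move=> x Ux; apply: differentiable_pair; [exact: df|exact: dg].
have := IH _ _ _ _ _ _ (open_setXT oU) Cf Cg.
apply: Ck_eq; first exact: open_setXT.
by move=> [x v]; rewrite inE/= => -[Ux _]; rewrite diff_pair//; [exact: df|exact: dg].
Qed.

Lemma Ck_linear k (E F : normedModType R) (U : set E) (f : {linear E -> F}) :
  open U -> continuous f -> Ck k U f.
Proof.
elim: k E F U f => [|k IH] E F U f oU cf /=; first by move=> x _; exact: cf.
split; first by move=> x _; exact: linear_differentiable.
have := IH _ _ (U `*` setT) (f \o (snd : (E * E)%type -> E) : {linear _ -> _}).
move=> /(_ (open_setXT oU)) H.
have /H : continuous (f \o (snd : (E * E)%type -> E)).
  by move=> p; apply: continuous_comp; [exact: cvg_snd | exact: cf].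
apply: Ck_eq; first exact: open_setXT.
by move=> [x v] _ /=; rewrite diff_lin.
Qed.

Lemma Ck_comp k (E F G : normedModType R) (U : set E) (V : set F)
    (f : E -> F) (g : F -> G) : open U -> open V -> U `<=` f @^-1` V ->
  Ck k U f -> Ck k V g -> Ck k U (g \o f).
Proof.
elim: k E F G U V f g => [|k IH] E F G U V f g oU oV UV.
  by move=> /= cf cg x Ux; apply: continuous_comp; [exact: cf|exact/cg/UV].
move=> Cf; have Cfk := CkP Cf; move: Cf => /= [df Cf] [dg Cg]; split.
  by move=> x Ux; apply: differentiable_comp; [exact: df|exact/dg/UV].
pose h (p : E * E) := (f p.1, 'd f (p.1) (p.2)).
have Ch : Ck k (U `*` setT) h.
  apply: Ck_pair => //; first exact: open_setXT.
  apply: (IH _ _ _ _ U) => //; first exact: open_setXT.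
    by move=> [? ?] [].
  apply: (Ck_linear k (f := (fst : E * E -> E))); first exact: open_setXT.
  by move=> ?; exact: cvg_fst.
have := IH _ _ _ (U `*` setT) (V `*` setT) h _ (open_setXT oU) (open_setXT oV) _ Ch Cg.
have UVh : (U `*` setT) `<=` h @^-1` (V `*` setT).
  by move=> [x v] [/= Ux _]; split => //=; exact: UV.
move=> /(_ UVh); apply: Ck_eq; first exact: open_setXT.
by move=> [x v]; rewrite inE/= => -[Ux _]; rewrite (diff_comp (df _ Ux) (dg _ (UV _ Ux))).
Qed.

Lemma Ck_add k (E F : normedModType R) (U : set E) (f g : E -> F) :
  open U -> Ck k U f -> Ck k U g -> Ck k U (f \+ g).
Proof.
elim: k E F U f g => [|k IH] E F U f g oU /=.
  by move=> cf cg x Ux; apply: continuousD; [exact: cf|exact: cg].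
move=> [df Cf] [dg Cg]; split.
  by move=> x Ux; apply: differentiableD; [exact: df|exact: dg].
have := IH _ _ _ _ _ (open_setXT oU) Cf Cg.
apply: Ck_eq; first exact: open_setXT.
by move=> [x v]; rewrite inE/= => -[Ux _]; rewrite diffD//; [exact: df|exact: dg].
Qed.

Lemma Ck_cst k (E F : normedModType R) (U : set E) (a : F) :
  open U -> Ck k U (cst a : E -> F).
Proof.
elim: k E F U a => [|k IH] E F U a oU /=.
  by move=> x _; exact: cst_continuous.
split; first by move=> x _; exact: differentiable_cst.
have := IH _ F (U `*` @setT E) 0 (open_setXT oU).
apply: Ck_eq; first exact: open_setXT.
by move=> [x v] _; rewrite diff_cst.
Qed.

Lemma Ck_sum k (E F : normedModType R) (U : set E) (I : Type) (r : seq I)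
    (f : I -> E -> F) : open U -> (forall i, Ck k U (f i)) ->
  Ck k U (fun x => \sum_(i <- r) f i x).
Proof.
move=> oU Cf; elim: r => [|i r IH].
  by apply: Ck_eq (Ck_cst k 0 oU) => // x _; rewrite big_nil.
by apply: Ck_eq (Ck_add oU (Cf i) IH) => // x _; rewrite big_cons.
Qed.

Lemma Ck_mul k (E : normedModType R) (U : set E) (f g : E -> R) :
  open U -> Ck k U f -> Ck k U g -> Ck k U (f \* g).
Proof.
elim: k E U f g => [|k IH] E U f g oU.
  by move=> cf cg x Ux; apply: continuousM; [exact: cf|exact: cg].
move=> Cf Cg; have [Cfk Cgk] := (CkP Cf, CkP Cg).
move: Cf Cg => [df Cf] [dg Cg]; split.
  by move=> x Ux; apply: differentiableM; [exact: df|exact: dg].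
have oUT := @open_setXT _ E _ oU.
have fst_Ck (h : E -> R) : Ck k U h -> Ck k (U `*` @setT E) (h \o fst).
  move=> Ch; apply: Ck_comp Ch => //; first by move=> [? ?] [].
  by apply: (Ck_linear k (f := (fst : E * E -> E))) => // ?; exact: cvg_fst.
have := Ck_add oUT (IH _ _ _ _ oUT (fst_Ck _ Cfk) Cg)
                   (IH _ _ _ _ oUT (fst_Ck _ Cgk) Cf).
apply: Ck_eq => // -[x v]; rewrite inE/= => -[Ux _].
by rewrite diffM//; [exact: df|exact: dg].
Qed.

End Calculus.

Section Topology.

Lemma open_setI_preimage (S T : topologicalType) (U : set S) (f : S -> T)
    (W : set T) : open U -> (forall x, U x -> {for x, continuous f}) ->
  open W -> open (U `&` f @^-1` W).
Proof.
move=> oU cf oW; rewrite openE => x [Ux Wfx]; apply: filterI.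
  exact: open_nbhs_nbhs.
by apply: (cf x Ux); exact: open_nbhs_nbhs.
Qed.

Lemma second_countable_setX (S T : topologicalType) :
  @second_countable S -> @second_countable T -> @second_countable (S * T)%type.
Proof.
move=> [A cA [oA bA]] [B cB [oB bB]].
exists [set ab.1 `*` ab.2 | ab in A `*` B].
  by apply: sub_countable (card_image_le _ _) _; exact: countableX.
split=> [_ [[a b] [/= /oA ? /oB ?] <-]|[x y] W]; first exact: open_setX.
move=> [[U V] /= [/bA [a [Aa ax] aU] /bB [b [Bb bY] bV]] UVW].
exists (a `*` b); first by split => //=; exists (a, b).
by move=> [x' y'] [/= /aU ? /bV ?]; exact: UVW.
Qed.

Lemma second_countable_dense (R : realType) (T : pseudoMetricType R)
    (I : countType) (f : I -> T) :
  (forall x (e : R), 0 < e -> exists i, ball x e (f i)) -> @second_countable T.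
Proof.
move=> dense; pose b (p : I * nat) : set T := interior (ball (f p.1) (p.2.+1%:R^-1 : R)).
exists (range b); first exact: sub_countable (card_image_le _ _) (countableP _).
split; first by move=> _ [p _ <-]; exact: open_interior.
move=> x W /nbhs_ballP [e /= e0 xW].
have [n ne] : exists n, (n.+1%:R^-1 : R) < e / 2.
  have [n _ h] := near_infty_natSinv_lt (PosNum (divr_gt0 e0 (ltr0n R 2))).
  by exists n; by have := h n (leqnn n).
have [i xi] : exists i, ball x (n.+1%:R^-1 / 2 : R) (f i) by apply: dense; rewrite divr_gt0.
exists (b (i, n)).
  split; first by exists (i, n).
  rewrite /b /=/interior; apply/nbhs_ballP; exists (n.+1%:R^-1 / 2 : R) => /=.
    by rewrite divr_gt0.
  by move=> y xy; rewrite [_^-1]splitr; apply: ball_triangle xy; exact: ball_sym.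
move=> y /interior_subset /= iy; apply: xW.
rewrite [e]splitr; apply: (@ball_triangle _ _ (f i)).
  apply: le_ball xi; apply: ltW; apply: le_lt_trans ne.
  by rewrite ler_pdivrMr// ler_peMr// ler1n.
by apply: le_ball iy; exact: ltW.
Qed.

Lemma second_countableR (R : realType) : @second_countable R.
Proof.
apply: (@second_countable_dense R R rat (@ratr R)) => x e e0.
have /rat_in_itvoo [q] : x - e < x + e by rewrite ltrD2l gtrN.
rewrite in_itv/= => /andP[h1 h2]; exists q.
by rewrite /ball/= ltr_distlC h1 h2.
Qed.

Lemma second_countable_mx (R : realType) m n : @second_countable 'M[R]_(m, n).
Proof.
apply: (@second_countable_dense R _ 'M[rat]_(m, n) (map_mx (@ratr R))).
move=> x e e0.
have h (i : 'I_m) (j : 'I_n) : exists q : rat, ball (x i j) e (ratr q : R).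
  have /rat_in_itvoo [q] : x i j - e < x i j + e by rewrite ltrD2l gtrN.
  rewrite in_itv/= => /andP[h1 h2]; exists q.
  by rewrite /ball/= ltr_distlC h1 h2.
exists (\matrix_(i, j) sval (cid (h i j))); split => // i j; rewrite !mxE.
exact: (svalP (cid (h i j))).
Qed.

End Topology.

Section Manifold.
Context {R : realType}.
Implicit Types (E F : normedModType R).

Record chart E (T : topologicalType) := Chart {
  cdom : set T;
  cfun : T -> E;
  cinv : E -> T;
  cdom_open : open cdom;
  cimg_open : open (cfun @` cdom);
  cfunK : {in cdom, cancel cfun cinv};
  cfun_continuous : {in cdom, continuous cfun};
  cinv_continuous : {in cfun @` cdom, continuous cinv} }.

(* Charts take values in a normed space E, so that products and cotangent
   bundles need no reindexing of coordinates; E is always finite-dimensional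
   below. Atlases need not be maximal: the notions below depend only on the smooth
   structure an atlas generates. *)
Record manifold E := Manifold {
  mcarrier :> topologicalType;
  atlas : set (chart E mcarrier);
  atlas_cover : forall x, exists2 c, atlas c & cdom c x;
  atlas_compat : forall c c', atlas c -> atlas c' ->
    smooth_on (cfun c @` (cdom c `&` cdom c')) (cfun c' \o cinv c);
  manifold_hausdorff : hausdorff_space mcarrier;
  manifold_second_countable : @second_countable mcarrier }.

(* An arbitrary chart around x, used to give tangent vectors coordinates. *)
Definition chart_at E (M : manifold E) (x : M) : chart E M :=
  projT1 (cid2 (atlas_cover x)).

End Manifold.

Arguments atlas {R E} m.

(* A manifold obtained from a set by declaring compatible bijections
   onto open subsets of E to be charts. *)
Section Gluing.
Context {R : realType} (E : normedModType R).

Record gluing := Gluing {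
  gset : Type;
  gidx : Type;
  gdom : gidx -> set gset;
  gfun : gidx -> gset -> E;
  ginv : gidx -> E -> gset;
  gfunK : forall i, {in gdom i, cancel (gfun i) (ginv i)};
  gimg_open : forall i j, open (gfun i @` (gdom i `&` gdom j));
  gcompat : forall i j,
    smooth_on (gfun i @` (gdom i `&` gdom j)) (gfun j \o ginv i);
  gcountable : exists2 J : set gidx,
    countable J & forall x, exists2 i, J i & gdom i x;
  gopen := fun A : set gset => forall i, open (gfun i @` (gdom i `&` A));
  gseparated : forall x y, x <> y -> (exists i, gdom i x /\ gdom i y) \/
    (exists A B, [/\ gopen A, gopen B, A x, B y & A `&` B = set0]) }.

Definition glued (G : gluing) : Type := gset G.

Context (G : gluing).
HB.instance Definition _ := gen_eqMixin (glued G).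
HB.instance Definition _ := gen_choiceMixin (glued G).

Let opT : @gopen G setT.
Proof. by move=> i; rewrite setIT -[gdom i]setIid; exact: gimg_open. Qed.

Let opI : setI_closed (@gopen G).
Proof.
move=> A B oA oB i.
suff -> : gfun i @` (gdom i `&` (A `&` B)) =
    (gfun i @` (gdom i `&` A)) `&` (gfun i @` (gdom i `&` B)) by exact: openI.
apply/seteqP; split=> [_ [x [ix [Ax Bx]] <-]|y [[a [ia Aa] ay] [b [ib Bb] bY]]].
  by split; exists x.
exists a => //; split => //; split => //; suff -> : a = b by [].
by rewrite -(gfunK (mem_set ia)) -(gfunK (mem_set ib)) ay bY.
Qed.

Let op_bigU (I : Type) (f : I -> set (glued G)) :
  (forall i, gopen (f i)) -> @gopen G (\bigcup_i f i).
Proof.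
move=> of_ i; rewrite setI_bigcupr image_bigcup; apply: bigcup_open => j _.
exact: of_.
Qed.

HB.instance Definition _ := isOpenTopological.Build (glued G) opT opI op_bigU.

Lemma glued_openE (A : set (glued G)) : open A = gopen A.
Proof.
rewrite openE; apply/propext; split.
  move=> oA.
  have -> : A = \bigcup_(B : {B : set (gset G) | gopen B /\ B `<=` A}) (sval B).
    apply/seteqP; split => [x /oA [B [oB Bx] BA]|x [[B /= [_ BA]] _ /BA]]//.
    by exists (exist _ B (conj oB BA)).
  by apply: op_bigU => -[B []].
by move=> oA x Ax; exists A; split.
Qed.

Lemma glued_transition_open i j (W : set E) : open W ->
  open (gfun j @` (gdom j `&` (gdom i `&` (@gfun G i) @^-1` W))).
Proof.
move=> oW; pose U := gfun j @` (gdom j `&` gdom i).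
have := open_setI_preimage (@gimg_open G j i) (@gcompat G j i 0) oW.
congr open; apply/seteqP; split => [_ [[x [jx ix] <-] /=]|_ [x [jx [ix Wx] <-]]].
  by rewrite gfunK ?inE// => ?; exists x.
by split; [exists x | rewrite /= gfunK ?inE].
Qed.

Let gdom_open i : open (@gdom G i : set (glued G)).
Proof. by rewrite glued_openE => j; exact: gimg_open. Qed.

Let gimg1_open i : open (@gfun G i @` gdom i).
Proof. by rewrite -[gdom i]setIid; exact: gimg_open. Qed.

Let gfun_continuous i :
  {in (@gdom G i : set (glued G)), continuous (@gfun G i : glued G -> E)}.
Proof.
move=> x; rewrite inE => ix W /= /nbhs_interior ixW.
pose V := gdom i `&` (@gfun G i) @^-1` (interior W).
have oV : open (V : set (glued G)).
  rewrite glued_openE => j; apply: glued_transition_open; exact: open_interior.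
have : nbhs (x : glued G) V.
  by apply: open_nbhs_nbhs; split => //; split => //; exact: (nbhs_singleton ixW).
by apply: filterS => y [_ /interior_subset].
Qed.

Let ginv_continuous i :
  {in @gfun G i @` gdom i, continuous (@ginv G i : E -> glued G)}.
Proof.
move=> y; rewrite inE => -[x ix <-] W.
rewrite gfunK ?inE//= => /nbhs_interior.
have := open_interior (W : set (glued G)); rewrite glued_openE => /(_ i) oW xW.
have := open_nbhs_nbhs (conj oW (ex_intro2 _ _ x (conj ix (nbhs_singleton xW)) erefl)).
apply: filterS => _ [z [iz /interior_subset Wz] <-] /=.
by rewrite gfunK ?inE.
Qed.

Definition gchart (i : gidx G) : chart E (glued G) :=
  Chart (gdom_open i) (gimg1_open i) (@gfunK G i) (@gfun_continuous i)
    (@ginv_continuous i).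

Let hausdorff_glued : hausdorff_space (glued G).
Proof.
rewrite open_hausdorff => x y /eqP xy.
have [[i [ix iy]]|[A [B [oA oB Ax By AB]]]] := gseparated xy; last first.
  exists (A, B); first by rewrite !inE.
  by split; rewrite ?glued_openE//; apply/eqP.
have : gfun i x != gfun i y.
  by apply: contra_not_neq xy => e; rewrite -(gfunK (mem_set ix)) e gfunK// inE.
have := @norm_hausdorff _ E; rewrite open_hausdorff => /[apply].
move=> [[A B] /= [xA yB] [oA oB /eqP AB]]; rewrite !inE in xA yB.
exists (gdom i `&` gfun i @^-1` A, gdom i `&` gfun i @^-1` B).
  by rewrite !inE.
split; [by rewrite glued_openE => j; exact: glued_transition_open|
  by rewrite glued_openE => j; exact: glued_transition_open|].
apply/eqP/seteqP; split => // z [/= [_ Az] [_ Bz]].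
by have : (A `&` B) (gfun i z) by []; rewrite AB.
Qed.

Let second_countable_glued :
  @second_countable E -> @second_countable (glued G).
Proof.
move=> [B cB [oB bB]]; have [J cJ Jcov] := gcountable G.
exists [set (gdom ib.1 `&` gfun ib.1 @^-1` ib.2 : set (glued G))
       | ib in J `*` B].
  by apply: sub_countable (card_image_le _ _) _; exact: countableX.
split=> [_ [[i b] [/= Ji Bb] <-]|x W].
  by rewrite glued_openE => j; apply: glued_transition_open; exact: oB.
have [i Ji ix] := Jcov x.
move=> xW; have xi : (@gfun G i @` gdom i) (gfun i x) by exists x.
have /(_ W) := @ginv_continuous i _ (mem_set xi).
rewrite gfunK ?inE// => /(_ xW) /bB [b [Bb bx] bW].
exists (gdom i `&` gfun i @^-1` b).
  by split => //; exists (i, b).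
by move=> z [iz /bW] /=; rewrite gfunK ?inE.
Qed.

Definition glued_manifold (sE : @second_countable E) : manifold E.
Proof.
refine (@Manifold _ _ (glued G) (range gchart) _ _ hausdorff_glued
  (second_countable_glued sE)).
- by move=> x; have [i _ ix] := (gcountable G); have [j _ jx] := ix x; exists (gchart j).
- by move=> _ _ [i _ <-] [j _ <-]; exact: gcompat.
Defined.

End Gluing.

Section MatrixCalculus.
Context {R : realType}.
Implicit Types E F G : normedModType R.

Lemma Ck_post k E F G (U : set E) (f : E -> F) (l : {linear F -> G}) :
  open U -> continuous l -> Ck k U f -> Ck k U (l \o f).
Proof.
move=> oU cl Cf; apply: (Ck_comp (V := setT)) => //; first exact: openT.
by apply: Ck_linear => //; exact: openT.
Qed.

Lemma Ck_scalel k E F (U : set E) (f : E -> R) (a : F) :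
  open U -> Ck k U f -> Ck k U (fun x => f x *: a).
Proof.
move=> oU Cf.
have lin : linear ( *:%R ^~ a : R -> _).
  by move=> u y z; rewrite scalerDl scalerA.
pose M := GRing.isLinear.Build _ _ _ _ _ lin.
pose L : {linear R -> F} := HB.pack ( *:%R ^~ a) M.
by apply: (Ck_post (l := L)) => // x; exact: scalel_continuous.
Qed.

Lemma Ck_coord k E (U : set E) m n (f : E -> 'M[R]_(m, n)) i j :
  open U -> Ck k U f -> Ck k U (fun x => f x i j).
Proof.
move=> oU Cf.
have lin : linear (fun A : 'M[R]_(m, n) => A i j : R).
  by move=> u y z; rewrite !mxE.
pose M := GRing.isLinear.Build _ _ _ _ _ lin.
pose L : {linear 'M[R]_(m, n) -> R} := HB.pack (fun A : 'M[R]_(m, n) => A i j : R) M.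
by apply: (Ck_post (l := L)) => // x; exact: coord_continuous.
Qed.

Lemma Ck_mx k E (U : set E) m n (f : E -> 'M[R]_(m, n)) :
  open U -> (forall i j, Ck k U (fun x => f x i j)) -> Ck k U f.
Proof.
move=> oU Cf.
have : Ck k U (fun x => \sum_i \sum_j f x i j *: (delta_mx i j : 'M[R]_(m, n))).
  by apply: Ck_sum => // i; apply: Ck_sum => // j; exact: Ck_scalel.
by apply: Ck_eq => // x _; rewrite -matrix_sum_delta.
Qed.

Lemma Ck_mulmx k E (U : set E) m n p (f : E -> 'M[R]_(m, n))
    (g : E -> 'M[R]_(n, p)) :
  open U -> Ck k U f -> Ck k U g -> Ck k U (fun x => f x *m g x).
Proof.
move=> oU Cf Cg; apply: Ck_mx => // i j.
have : Ck k U (fun x => \sum_l f x i l * g x l j).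
  by apply: Ck_sum => // l; apply: Ck_mul => //; exact: Ck_coord.
by apply: Ck_eq => // x _; rewrite mxE.
Qed.

Lemma Ck_jacobian k E (U : set E) m n (V : set 'rV[R]_m)
    (g : 'rV[R]_m -> 'rV[R]_n) (h : E -> 'rV[R]_m) :
  open U -> open V -> U `<=` h @^-1` V -> Ck k.+1 V g -> Ck k U h ->
  Ck k U (fun x => jacobian g (h x)).
Proof.
move=> oU oV UV [dg Cg] Ch; apply: Ck_mx => // i j.
have Cp : Ck k U (fun x => (h x, delta_mx 0 i : 'rV[R]_m)).
  by apply: Ck_pair => //; exact: (Ck_cst k (delta_mx 0 i : 'rV[R]_m) oU).
have := Ck_coord 0 j oU (Ck_comp oU (open_setXT oV) _ Cp Cg).
have UVp : U `<=` (fun x => (h x, delta_mx 0 i : 'rV[R]_m)) @^-1` (V `*` setT).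
  by move=> x Ux; split => //=; exact: UV.
by move=> /(_ UVp); apply: Ck_eq => // x _; rewrite /jacobian !mxE.
Qed.

Lemma Ck_fst k E F (U : set (E * F)) : open U -> Ck k U (fst : E * F -> E).
Proof.
by move=> oU; apply: (Ck_linear k (f := (fst : E * F -> E))) => // ?; exact: cvg_fst.
Qed.

Lemma Ck_snd k E F (U : set (E * F)) : open U -> Ck k U (snd : E * F -> F).
Proof.
by move=> oU; apply: (Ck_linear k (f := (snd : E * F -> F))) => // ?; exact: cvg_snd.
Qed.

End MatrixCalculus.

Section Charts.
Context {R : realType}.
Implicit Types (E F : normedModType R).

Lemma chart_imgI_open E (T : topologicalType) (c : chart E T) (A : set T) :
  open A -> open (cfun c @` (cdom c `&` A)).
Proof.
move=> oA.
have := open_setI_preimage (cimg_open c) (fun y iy => cinv_continuous (mem_set iy)) oA.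
congr open; apply/seteqP; split => [_ [[x cx <-] /=]|_ [x [cx Ax] <-]].
  by rewrite cfunK ?inE// => ?; exists x.
by split; [exists x | rewrite /= cfunK ?inE].
Qed.

Section Product.
Context E F (S T : topologicalType) (c : chart E S) (d : chart F T).
Let dom := cdom c `*` cdom d.
Let f (p : S * T) : E * F := (cfun c p.1, cfun d p.2).
Let g (q : E * F) : S * T := (cinv c q.1, cinv d q.2).

Lemma prod_chart_img (A : set S) (B : set T) :
  f @` (A `*` B) = cfun c @` A `*` cfun d @` B.
Proof.
apply/seteqP; split => [_ [[x y] [/= Ax By] <-]|[_ _] [/= [x Ax <-] [y By <-]]].
  by split; [exists x|exists y].
by exists (x, y).
Qed.

Let fK : {in dom, cancel f g}.
Proof. by move=> [x y]; rewrite inE => -[/= cx dy]; rewrite /g /= !cfunK ?inE. Qed.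

Let dom_open : open dom.
Proof. by apply: open_setX; exact: cdom_open. Qed.

Let img_open : open (f @` dom).
Proof. by rewrite prod_chart_img; apply: open_setX; exact: cimg_open. Qed.

Let f_continuous : {in dom, continuous f}.
Proof.
move=> [x y]; rewrite inE => -[/= cx dy]; apply: cvg_pair.
  by apply: (@continuous_comp _ _ _ fst (cfun c) (x, y));
     [exact: cvg_fst|apply: cfun_continuous; rewrite inE].
by apply: (@continuous_comp _ _ _ snd (cfun d) (x, y));
   [exact: cvg_snd|apply: cfun_continuous; rewrite inE].
Qed.

Let g_continuous : {in f @` dom, continuous g}.
Proof.
rewrite prod_chart_img => -[x y]; rewrite inE => -[/= cx dy]; apply: cvg_pair.
  by apply: (@continuous_comp _ _ _ fst (cinv c) (x, y));
     [exact: cvg_fst|apply: cinv_continuous; rewrite inE].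
by apply: (@continuous_comp _ _ _ snd (cinv d) (x, y));
   [exact: cvg_snd|apply: cinv_continuous; rewrite inE].
Qed.

Definition prod_chart : chart (E * F)%type (S * T)%type :=
  Chart dom_open img_open fK f_continuous g_continuous.

End Product.

Section ProductManifold.
Context E F (M : manifold E) (N : manifold F).

Let at_ := [set prod_chart c.1 c.2 | c in atlas M `*` atlas N].

Let cover (x : M * N) : exists2 c, at_ c & cdom c x.
Proof.
have [c ac cx] := atlas_cover x.1; have [d ad dx] := atlas_cover x.2.
by exists (prod_chart c d) => //; exists (c, d).
Qed.

Let compat c c' : at_ c -> at_ c' ->
  smooth_on (cfun c @` (cdom c `&` cdom c')) (cfun c' \o cinv c).
Proof.
move=> [[c1 d1] /= [ac1 ad1] <-] [[c2 d2] /= [ac2 ad2] <-] k.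
have -> : cdom (prod_chart c1 d1) `&` cdom (prod_chart c2 d2) =
    (cdom c1 `&` cdom c2) `*` (cdom d1 `&` cdom d2).
  by apply/seteqP; split => [[x y] [[/= ? ?] [/= ? ?]]|[x y] [[/= ? ?] [/= ? ?]]].
rewrite prod_chart_img /=.
set U := cfun c1 @` _; set V := cfun d1 @` _.
have oU : open U by apply: chart_imgI_open; exact: cdom_open.
have oV : open V by apply: chart_imgI_open; exact: cdom_open.
have oUV := open_setX oU oV.
apply: (Ck_pair (f := (cfun c2 \o cinv c1) \o fst) (g := (cfun d2 \o cinv d1) \o snd)) => //.
  apply: (Ck_comp (V := U)) => //; first by move=> [? ?] [].
    exact: Ck_fst.
  exact: atlas_compat.
apply: (Ck_comp (V := V)) => //; first by move=> [? ?] [].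
  exact: Ck_snd.
exact: atlas_compat.
Qed.

Let hausdorff : hausdorff_space (M * N)%type.
Proof.
have := @manifold_hausdorff _ _ N; have := @manifold_hausdorff _ _ M.
rewrite !open_hausdorff => hM hN [x y] [x' y'] xy.
have [xx'|xx'] := eqVneq x x'.
  have /hN [[A B] /= [yA yB] [oA oB AB]] : y != y'.
    by apply: contraNneq xy => ->; rewrite xx'.
  rewrite !inE in yA yB.
  exists (setT `*` A, setT `*` B); first by rewrite !inE.
  split; [apply: open_setX => //; exact: openT|
          apply: open_setX => //; exact: openT|].
  apply/eqP/seteqP; split => // -[a b] [/= [_ Ab] [_ Bb]].
  by have : (A `&` B) b by []; rewrite (eqP AB).
have [[A B] /= [yA yB] [oA oB AB]] := hM _ _ xx'.
rewrite !inE in yA yB.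
exists (A `*` setT, B `*` setT); first by rewrite !inE.
split; [exact: open_setXT|exact: open_setXT|].
apply/eqP/seteqP; split => // -[a b] [/= [Ab _] [Bb _]].
by have : (A `&` B) a by []; rewrite (eqP AB).
Qed.

Definition prod_manifold : manifold (E * F)%type :=
  Manifold cover compat hausdorff
    (second_countable_setX (manifold_second_countable M)
                           (manifold_second_countable N)).

End ProductManifold.

Section Line.

Let img_open : open (@idfun R @` setT).
Proof. by rewrite image_id; exact: openT. Qed.

Let id_chart : chart R R := Chart openT img_open (in1W (fun=> erefl))
  (in1W (fun x => cvg_id)) (in1W (fun x => cvg_id)).

Let cover (x : R) : exists2 c, [set id_chart] c & cdom c x.
Proof. by exists id_chart. Qed.

Let compat c c' : [set id_chart] c -> [set id_chart] c' ->
  smooth_on (cfun c @` (cdom c `&` cdom c')) (cfun c' \o cinv c).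
Proof.
move=> -> -> k; rewrite /= setIT image_id.
by apply: (Ck_linear k (f := (idfun : {linear R -> R}))); [exact: openT|move=> ?; exact: cvg_id].
Qed.

Definition real_line : manifold R :=
  Manifold cover compat (@Rhausdorff R) (@second_countableR R).

End Line.
End Charts.

(* Change of coordinates of tangent vectors, acting on row vectors:
   v in the chart c becomes v *m transition_jacobian c c' x in the chart c'. *)
HB.lock Definition transition_jacobian (R : realType) (m : nat)
    (T : topologicalType) (c c' : chart 'rV[R]_m T) (x : T) : 'M[R]_m :=
  jacobian (cfun c' \o cinv c) (cfun c x).

Section Cotangent.
Context {R : realType} {m : nat} (M : manifold 'rV[R]_m).
Local Notation chartM := (chart 'rV[R]_m M).
Local Notation TJ := transition_jacobian.

Lemma mul_transition_jacobian (c c' : chartM) x v :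
  v *m TJ c c' x = 'd (cfun c' \o cinv c) (cfun c x) v.
Proof. by rewrite unlock; exact: mul_rV_lin1. Qed.

Lemma transition_jacobian_id (c : chartM) x : cdom c x -> TJ c c x = 1%:M.
Proof.
move=> cx; apply/row_matrixP => i; rewrite !rowE mulmx1 mul_transition_jacobian.
have cc : {in cfun c @` cdom c, id =1 cfun c \o cinv c}.
  by move=> y; rewrite inE => -[z cz <-] /=; rewrite cfunK ?inE.
have [_ ->] := eq_open_is_diff (x := cfun c x) (cimg_open c)
    (ex_intro2 _ _ x cx erefl) cc (@ex_diff _ _ _ _ _ _ _ (is_diff_id _)).
by rewrite diff_val.
Qed.

Lemma transition_jacobianM (c c' c'' : chartM) x :
  atlas M c -> atlas M c' -> atlas M c'' -> cdom c x -> cdom c' x ->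
  cdom c'' x -> TJ c c' x *m TJ c' c'' x = TJ c c'' x.
Proof.
move=> ac ac' ac'' cx cx' cx''.
suff H (v : 'rV[R]_m) : v *m TJ c c' x *m TJ c' c'' x = v *m TJ c c'' x.
  by apply/row_matrixP => i; rewrite 2!rowE mulmxA H.
have key (A B C : 'M[R]_m) w : v *m A = w -> w *m B = v *m C ->
  v *m A *m B = v *m C by move=> ->.
apply: (key _ _ _ _ (mul_transition_jacobian c c' x v)).
apply: etrans (mul_transition_jacobian c' c'' x _) _.
apply: etrans _ (esym (mul_transition_jacobian c c'' x v)).
set U := cfun c @` (cdom c `&` (cdom c' `&` cdom c'')).
have oU : open U by apply: chart_imgI_open; apply: openI; exact: cdom_open.
have Ux : U (cfun c x) by exists x.
have e : {in U, (cfun c'' \o cinv c') \o (cfun c' \o cinv c) =1 cfun c'' \o cinv c}.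
  move=> _ /set_mem [z [cz [cz' _]] <-] /=.
  by rewrite !cfunK ?inE.
have d1 : differentiable (cfun c' \o cinv c) (cfun c x).
  by have [+ _] := atlas_compat ac ac' 1; apply; exists x.
have E : (cfun c' \o cinv c) (cfun c x) = cfun c' x by rewrite /= cfunK ?inE.
have d2 : differentiable (cfun c'' \o cinv c') ((cfun c' \o cinv c) (cfun c x)).
  by rewrite E; have [+ _] := atlas_compat ac' ac'' 1; apply; exists x.
have [_ H] := eq_open_is_diff oU Ux e (differentiable_comp d1 d2).
apply: etrans _ (esym (congr1 (@^~ v) H)).
apply: etrans _ (esym (congr1 (@^~ v) (diff_comp d1 d2))).
exact: (congr1 (fun z => 'd (cfun c'' \o cinv c') z
  ('d (cfun c' \o cinv c) (cfun c x) v)) (esym E)).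
Qed.

Lemma chart_atP (x : M) : atlas M (chart_at x) /\ cdom (chart_at x) x.
Proof. by rewrite /chart_at; case: cid2. Qed.

Lemma chart_at_atlas (x : M) : atlas M (chart_at x).
Proof. by case: (chart_atP x). Qed.

Lemma chart_at_dom (x : M) : cdom (chart_at x) x.
Proof. by case: (chart_atP x). Qed.

Lemma atlas_lindelof :
  exists2 J : set chartM, countable J /\ J `<=` atlas M &
    forall x, exists2 c, J c & cdom c x.
Proof.
have [B cB [oB bB]] := manifold_second_countable M.
pose P (b : set M) (c : chartM) := atlas M c /\ b `<=` cdom c.
pose f b : set chartM :=
  if pselect (exists c, P b c) is left h then [set sval (cid h)] else set0.
exists (\bigcup_(b in B) f b).
  split; last by move=> c [b _]; rewrite /f; case: pselect => // h ->; case: (svalP (cid h)).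
  apply: bigcup_countable => // b _; rewrite /f; case: pselect => h.
    exact: countable1.
  exact: countable0.
move=> x; have [c ac cx] := atlas_cover x.
have /bB [b [Bb bx] bc] := open_nbhs_nbhs (conj (cdom_open c) cx).
have h : exists c, P b c by exists c.
have : f b (sval (cid h)).
  rewrite /f; case: pselect => // h'; by rewrite (Prop_irrelevance h h').
exists (sval (cid h)); first by exists b.
by case: (svalP (cid h)) => _; apply.
Qed.

(* Covectors are column vectors, the value of p at v being v *m p. A point
   (x, p) of T*M is a covector at x with coordinates p in the chart chart_at x;
   its coordinates in another chart c are obtained by composition with the
   change of coordinates of tangent vectors from c to chart_at x. *)
Let gset := (M * 'cV[R]_m)%type.
Let gidx := {c : chartM | atlas M c}.
Let gdom (c : gidx) : set gset := [set xi | cdom (sval c) xi.1].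
Let gfun (c : gidx) (xi : gset) : 'rV[R]_m * 'cV[R]_m :=
  (cfun (sval c) xi.1, TJ (sval c) (chart_at xi.1) xi.1 *m xi.2).
Let ginv (c : gidx) (y : 'rV[R]_m * 'cV[R]_m) : gset :=
  let x := cinv (sval c) y.1 in (x, TJ (chart_at x) (sval c) x *m y.2).

Let gfunK c : {in gdom c, cancel (gfun c) (ginv c)}.
Proof.
move: c => [c ac] [x p]; rewrite inE /gdom/= => cx.
rewrite /ginv/= cfunK ?inE// mulmxA transition_jacobianM ?transition_jacobian_id//;
  try exact: chart_at_dom; try exact: chart_at_atlas.
by rewrite mul1mx.
Qed.

Let gimg (c : gidx) (A : set M) :
  gfun c @` (gdom c `&` [set xi | A xi.1]) =
  cfun (sval c) @` (cdom (sval c) `&` A) `*` setT.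
Proof.
move: c => [c ac]; apply/seteqP.
split=> [_ [[x p] [/= cx Ax] <-]|[_ q] [/= [x [cx Ax] <-] _]].
  by split => //=; exists x.
exists (x, TJ (chart_at x) c x *m q) => //.
rewrite /gfun/= mulmxA transition_jacobianM ?transition_jacobian_id//;
  try exact: chart_at_dom; try exact: chart_at_atlas.
by rewrite mul1mx.
Qed.

Let gimg_open i j : open (gfun i @` (gdom i `&` gdom j)).
Proof.
rewrite (gimg i (cdom (sval j))); apply: open_setXT.
by apply: chart_imgI_open; exact: cdom_open.
Qed.

Let gcompat i j :
  smooth_on (gfun i @` (gdom i `&` gdom j)) (gfun j \o ginv i).
Proof.
move=> k; have oU := @gimg_open i j; move: oU; rewrite (gimg i (cdom (sval j))).
move: i j => [c ac] [d ad] /=.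
set V := cfun c @` (cdom c `&` cdom d) => oU.
have oV : open V by apply: chart_imgI_open; exact: cdom_open.
set V' := cfun d @` (cdom d `&` cdom c).
have oV' : open V' by apply: chart_imgI_open; exact: cdom_open.
have Cdc : Ck k (V `*` [set: 'cV[R]_m])
    (fun y : 'rV[R]_m * 'cV[R]_m => (cfun d \o cinv c) y.1).
  apply: (Ck_comp (V := V)) => //; first by move=> [? ?] [].
    exact: Ck_fst.
  exact: atlas_compat.
have : Ck k (V `*` [set: 'cV[R]_m]) (fun y : 'rV[R]_m * 'cV[R]_m =>
    ((cfun d \o cinv c) y.1,
     jacobian (cfun c \o cinv d) ((cfun d \o cinv c) y.1) *m y.2)).
  apply: Ck_pair => //; apply: Ck_mulmx => //; last exact: Ck_snd.
  apply: (Ck_jacobian (V := V')) => //; last exact: atlas_compat.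
  move=> [_ q] [/= [x [cx dx] <-] _] /=; rewrite cfunK ?inE//.
  by exists x.
apply: Ck_eq => // -[y q]; rewrite inE => -[/= [x [cx dx] <-] _].
rewrite /gfun/ginv/= cfunK ?inE// mulmxA transition_jacobianM//;
  try exact: chart_at_dom; try exact: chart_at_atlas.
by congr (_, _ *m _); rewrite unlock.
Qed.

Let gcountable : exists2 J : set gidx,
  countable J & forall x, exists2 i, J i & gdom i x.
Proof.
have [J [cJ Ja] Jcov] := atlas_lindelof.
exists [set c | J (sval c)].
  apply/countable_injP; have /countable_injP [f fi] := cJ.
  exists (f \o sval) => -[a pa] [b pb]; rewrite !inE/= => Ja' Jb' e.
  by apply: eq_exist; apply: fi; rewrite ?inE.
move=> [x p]; have [c Jc cx] := Jcov x.
by exists (exist _ c (Ja _ Jc)).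
Qed.

Let gopen := fun A : set gset => forall i, open (gfun i @` (gdom i `&` A)).

Let gopen_base (A : set M) : open A -> gopen [set xi | A xi.1].
Proof.
by move=> oA i; rewrite gimg; apply: open_setXT; exact: chart_imgI_open.
Qed.

Let gseparated x y : x <> y -> (exists i, gdom i x /\ gdom i y) \/
  (exists A B, [/\ gopen A, gopen B, A x, B y & A `&` B = set0]).
Proof.
move: x y => [x p] [y q] _; have [<-|xy] := pselect (x = y).
  by left; exists (exist _ _ (chart_at_atlas x)); split; exact: chart_at_dom.
right; have := @manifold_hausdorff _ _ M; rewrite open_hausdorff.
move/eqP : xy => xy /(_ _ _ xy) [[A B] /= [xA yB] [oA oB /eqP AB]].
rewrite !inE in xA yB.
exists [set xi | A xi.1], [set xi | B xi.1].
split=> //; [exact: gopen_base|exact: gopen_base|].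
by apply/seteqP; split => // -[z r] zAB; have : (A `&` B) z by []; rewrite AB.
Qed.

Definition cotangent_gluing : gluing ('rV[R]_m * 'cV[R]_m)%type :=
  Gluing gfunK gimg_open gcompat gcountable gseparated.

Definition cotangent : manifold ('rV[R]_m * 'cV[R]_m)%type :=
  glued_manifold cotangent_gluing
    (second_countable_setX (@second_countable_mx R 1 m)
                           (@second_countable_mx R m 1)).

End Cotangent.

Section SmoothMaps.
Context {R : realType} {E F : normedModType R} (M : manifold E) (N : manifold F).

(* Smoothness of the restriction of f to the open set A. *)
Definition smooth_map_on (A : set M) (f : M -> N) :=
  (forall x, A x -> {for x, continuous f}) /\
  forall c d, atlas M c -> atlas N d ->
    smooth_on (cfun c @` (cdom c `&` A `&` f @^-1` cdom d))
              (cfun d \o f \o cinv c).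

Definition smooth_map := smooth_map_on setT.

(* The tangent space at x is represented by the model space, a vector v standing
   for the tangent vector with coordinates v in the chart chart_at x. *)
Definition tangent_map (f : M -> N) (x : M) : {linear E -> F} :=
  'd (cfun (chart_at (f x)) \o f \o cinv (chart_at x)) (cfun (chart_at x) x).

Definition smooth_embedding (f : M -> N) :=
  [/\ smooth_map f, injective f, forall x, injective (tangent_map f x) &
      forall A, open A -> exists2 B, open B & f @` A = range f `&` B].

End SmoothMaps.

Definition diffeo_on (R : realType) (E F : normedModType R)
    (M : manifold E) (N : manifold F) (A : set M) (B : set N) (f : M -> N) :=
  exists g : N -> M, [/\ smooth_map_on A f, smooth_map_on B g,
    A `<=` f @^-1` B, B `<=` g @^-1` A &
    {in A, cancel f g} /\ {in B, cancel g f}].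

Section ExteriorAlgebra.
Context {R : realType} {E : lmodType R}.

Definition alternating k (a : ('I_k -> E) -> R) :=
  (forall v i (t : R) u w, a [eta v with i |-> t *: u + w] =
     t * a [eta v with i |-> u] + a [eta v with i |-> w]) /\
  (forall v i j, i != j -> v i = v j -> a v = 0).

Definition ext_prod k l (a : ('I_k -> E) -> R) (b : ('I_l -> E) -> R)
    (v : 'I_(k + l) -> E) : R :=
  (k`! * l`!)%:R^-1 * \sum_(s : 'S_(k + l)) (-1) ^+ s *
    (a (fun i => v (s (lshift l i))) * b (fun j => v (s (rshift k j)))).

Fixpoint ext_pow k (a : ('I_k -> E) -> R) n : ('I_(n * k) -> E) -> R :=
  if n is n'.+1 then ext_prod a (@ext_pow k a n') else fun=> 1.

Arguments ext_pow {k} a n.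

End ExteriorAlgebra.

Arguments ext_pow {R E k} a n.

Section Forms.
Context {R : realType} {E : normedModType R} (M : manifold E).

Definition dform k := M -> ('I_k -> E) -> R.

(* The expression of w in the chart c: tangent vectors with coordinates v i in c
   are converted to the coordinates given by chart_at x. *)
Definition form_in k (w : dform k) (c : chart E M) (y : E) (v : 'I_k -> E) : R :=
  let x := cinv c y in w x (fun i => 'd (cfun (chart_at x) \o cinv c) y (v i)).

Definition smooth_form_on k (U : set M) (w : dform k) :=
  (forall x, U x -> alternating (w x)) /\
  forall c, atlas M c -> forall v,
    smooth_on (cfun c @` (cdom c `&` U)) (fun y => form_in w c y v).

(* dw(v_0,...,v_k) = sum_i (-1)^i v_i (w(v_0,..,^v_i,..,v_k)) for vector fields
   that are constant in a chart. *)
Definition ext_derivative k (w : dform k) : dform k.+1 := fun x v =>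
  \sum_(i < k.+1) (-1) ^+ i *
    'D_(v i) (fun y => form_in w (chart_at x) y (fun j => v (lift i j)))
      (cfun (chart_at x) x).

End Forms.

Definition pullback (R : realType) (E F : normedModType R) (M : manifold E)
    (N : manifold F) k (f : M -> N) (w : dform N k) : dform M k :=
  fun x v => w (f x) (fun i => tangent_map f x (v i)).

Section Contact.
Context {R : realType} {m : nat} (M : manifold 'rV[R]_m).

(* On a manifold of dimension m = 2n + 1, n is m./2. *)
Definition contact_form_on (U : set M) (eta : dform M 1) :=
  [/\ odd m, smooth_form_on U eta & forall x, U x -> exists v,
    ext_prod (eta x) (ext_pow (ext_derivative eta x) m./2) v != 0].

Record contact_structure := ContactStructure {
  hyperplane :> M -> {vspace 'rV[R]_m};
  contact_odd : odd m;
  hyperplane_dim : forall x, (\dim (hyperplane x)).+1 = m;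
  contact_local : forall x, exists U eta,
    [/\ open U, U x, contact_form_on U eta & forall y, U y ->
        forall v, (v \in hyperplane y) = (eta y (fun=> v) == 0)] }.

(* The parity condition only matters for the empty manifold, where it does not
   follow from nondegeneracy. *)
Definition symplectic_form (w : dform M 2) :=
  [/\ ~~ odd m, smooth_form_on setT w, forall x v, ext_derivative w x v = 0 &
      forall x u, (forall v, v ord0 = u -> w x v = 0) -> u = 0].

Definition cbase (xi : cotangent M) : M := xi.1.
Definition cvec (xi : cotangent M) : 'cV[R]_m := xi.2.
Definition cscale (s : R) (xi : cotangent M) : cotangent M :=
  (cbase xi, s *: cvec xi).

Definition ceval (xi : cotangent M) (v : 'rV[R]_m) : R := (v *m cvec xi) 0 0.

Definition liouville_form : dform (cotangent M) 1 :=
  fun xi v => ceval xi (tangent_map cbase xi (v ord0)).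

(* With the sign convention omega_M = d theta_M. *)
Definition canonical_symplectic_form : dform (cotangent M) 2 :=
  ext_derivative liouville_form.

(* The nonzero covectors of the annihilator of C. *)
Definition annihilator_units (C : contact_structure) : set (cotangent M) :=
  [set xi | cvec xi != 0 /\ forall v, v \in C (cbase xi) -> ceval xi v = 0].

End Contact.

Arguments canonical_symplectic_form {R m} M.

Section Bundles.
Context {R : realType} {m : nat} (M : manifold 'rV[R]_m).

(* The group of nonzero reals is the open subset s != 0 of the real line; the
   value of bact at 0 is irrelevant. *)
Record principal_bundle := PrincipalBundle {
  btotal :> manifold 'rV[R]_m.+1;
  bproj : btotal -> M;
  bact : R -> btotal -> btotal;
  bproj_smooth : smooth_map bproj;
  bact_smooth : smooth_map_on (M := prod_manifold real_line btotal)
    [set sp | sp.1 != 0] (fun sp => bact sp.1 sp.2);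
  bact1 : forall p, bact 1 p = p;
  bactM : forall (s t : R) p, s != 0 -> t != 0 ->
    bact s (bact t p) = bact (s * t) p;
  bact_proj : forall (s : R) p, s != 0 -> bproj (bact s p) = bproj p;
  btrivial : forall x, exists U (Phi : btotal -> prod_manifold M real_line),
    [/\ open U, U x,
        diffeo_on (bproj @^-1` U)
          [set z : prod_manifold M real_line | U z.1 /\ z.2 != 0] Phi,
        forall p, U (bproj p) -> (Phi p).1 = bproj p &
        forall (s : R) p, s != 0 -> U (bproj p) ->
          (Phi (bact s p)).2 = s * (Phi p).2] }.

Record symplectic_bundle := SymplecticBundle {
  sbundle :> principal_bundle;
  sform : dform sbundle 2;
  sform_symplectic : symplectic_form sform;
  sform_homogeneous : forall (s : R) p v, s != 0 ->
    pullback (bact s) sform p v = s * sform p v }.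

Arguments sform : clear implicits.

Definition bundle_iso (P Q : symplectic_bundle) := exists phi : P -> Q,
  [/\ diffeo_on setT setT phi, forall p, bproj (phi p) = bproj p,
      forall (s : R) p, s != 0 -> phi (bact s p) = bact s (phi p) &
      pullback phi (sform Q) = sform P].

Definition identified_with_annihilator (P : symplectic_bundle)
    (C : contact_structure M) := exists iota : P -> cotangent M,
  [/\ smooth_embedding iota, range iota = annihilator_units C,
      forall p, cbase (iota p) = bproj p,
      forall (s : R) p, s != 0 -> iota (bact s p) = cscale s (iota p) &
      pullback iota (canonical_symplectic_form M) = sform P].

End Bundles.

Arguments sform {R m M} _.

(* Main.v *)
(** A symplectic bundle P carries the 1-form i_D w, where D generates the action
    and w is the symplectic form. It is horizontal, hence is the tautological
    1-form pulled back along a unique equivariant map P -> T*M over M; since w is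
    closed and 1-homogeneous, Cartan's formula gives d(i_D w) = w, so that this map
    pulls the canonical symplectic form back to w. Its image consists of nonzero
    covectors, one line over each point, whose annihilator is a hyperplane field C.
    Along a local section of P the form becomes a 1-form with kernel C, and it is a
    contact form because w is nondegenerate; conversely the annihilator of a contact
    structure is a symplectic bundle for the same reason. Uniqueness of the map makes
    the correspondence one-to-one. *)

(* Tangent vectors at x carry coordinates in an arbitrary chart [chart_at x], chosen point by point
   with no continuity, and [ext_derivative] is computed in that chart. Hence statements on forms are
   proved on open sets of the model space and then carried to any pair of charts. This works because
   the exterior derivative is natural under coordinate changes, which rests on the symmetry of
   second derivatives. The contact condition is stated through a top exterior power, a sum over
   permutations, whereas the symplectic condition is nondegeneracy. One implication between them is
   the vanishing of every term on a suitable basis; the converse requires that the terms do not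
   cancel, which holds on a symplectic basis of the kernel because all terms are then nonnegative.
   The annihilator is not obtained as a submanifold but glued from charts made of base coordinates
   and one nonvanishing coordinate of the covector; its changes of charts factor through those of
   the cotangent bundle. *)
Require Import Defs.
From HB Require Import structures.
From mathcomp Require Import all_boot all_order all_algebra all_fingroup.
From mathcomp Require Import all_classical all_reals all_analysis.
From mathcomp Require Import ring lra zify.
Set Implicit Arguments.
Unset Strict Implicit.
Unset Printing Implicit Defensive.
Import Order.TTheory GRing.Theory Num.Theory.
Import numFieldNormedType.Exports.
Local Open Scope classical_set_scope.
Local Open Scope ring_scope.

(* Both names are shadowed by the libraries imported above. *)
Local Notation alternating := Defs.alternating.
Local Notation cscale := Defs.cscale.

(** * Differential calculus *)

Section DifferentialCalculus.
Context {R : realType}.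
Implicit Types E F G : normedModType R.

Lemma diff_compE E F G (f : E -> F) (g : F -> G) x v :
  differentiable f x -> differentiable g (f x) ->
  'd (fun z => g (f z)) x v = 'd g (f x) ('d f x v).
Proof. by move=> df dg; rewrite (diff_comp df dg). Qed.

Lemma diff_pairE E F G (f : E -> F) (g : E -> G) x v :
  differentiable f x -> differentiable g x ->
  'd (fun z => (f z, g z)) x v = ('d f x v, 'd g x v).
Proof. by move=> df dg; rewrite diff_pair. Qed.

Lemma diff_cstE E F (c : F) (x v : E) : 'd (fun=> c) x v = 0.
Proof. exact: (congr1 (@^~ v) (diff_cst c x)). Qed.

Lemma diff_idE E (x v : E) : 'd (fun z => z) x v = v.
Proof. exact: (congr1 (@^~ v) (@diff_val _ _ _ _ _ _ _ (is_diff_id x))). Qed.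

Lemma differentiable_idE E (x : E) : differentiable (fun z => z) x.
Proof. exact: (@ex_diff _ _ _ _ _ _ _ (is_diff_id x)). Qed.

Lemma diff_openE E F (U : set E) (f g : E -> F) x v : open U -> U x ->
  (forall y, U y -> f y = g y) -> differentiable f x ->
  'd g x v = 'd f x v.
Proof.
move=> oU Ux fg df.
have fg' : {in U, f =1 g} by move=> y /set_mem; exact: fg.
by have [_ ->] := eq_open_is_diff oU Ux fg' df.
Qed.

Lemma differentiable_open E F (U : set E) (f g : E -> F) x : open U -> U x ->
  (forall y, U y -> f y = g y) -> differentiable f x -> differentiable g x.
Proof.
move=> oU Ux fg df.
have fg' : {in U, f =1 g} by move=> y /set_mem; exact: fg.
by have [] := eq_open_is_diff oU Ux fg' df.
Qed.

Lemma derive_openE E F (U : set E) (f g : E -> F) x v : open U -> U x ->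
  (forall y, U y -> f y = g y) -> differentiable f x -> 'D_v g x = 'D_v f x.
Proof.
move=> oU Ux fg df; have dg := differentiable_open oU Ux fg df.
apply: etrans (deriveE v dg) _; apply: etrans _ (esym (deriveE v df)).
exact: diff_openE oU Ux fg df.
Qed.

Lemma diff_linE E F (f : {linear E -> F}) x v : continuous f -> 'd f x v = f v.
Proof. by move=> cf; rewrite diff_lin. Qed.

Lemma Ck_differentiable k E F (U : set E) (f : E -> F) x :
  Ck k.+1 U f -> U x -> differentiable f x.
Proof. by move=> [df _] /df. Qed.

Lemma Ck_le k l E F (U : set E) (f : E -> F) : (l <= k)%N -> Ck k U f -> Ck l U f.
Proof.
move=> /subnK <-; elim: (k - l)%N => //= n IH Cf.
by apply: IH; exact: CkP.
Qed.

(** Serves to prove smoothness on a whole overlap of charts from neighbourhoods that depend on the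
    point. *)
Lemma Ck_local k E F (U : set E) (f : E -> F) :
  (forall x, U x -> exists V, [/\ open V, V x & Ck k V f]) -> Ck k U f.
Proof.
elim: k E F U f => [|k IH] E F U f loc.
  by move=> x /loc [V [_ Vx]]; apply.
split; first by move=> x /loc [V [_ Vx [+ _]]]; apply.
apply: IH => -[x v] [/= /loc [V [oV Vx [_ CV]]] _].
by exists (V `*` setT); split => //; exact: open_setXT.
Qed.

Lemma Ck_id k E (U : set E) : open U -> Ck k U (fun x : E => x).
Proof.
move=> oU; apply: (Ck_linear k (f := (idfun : {linear E -> E}))) => // x.
exact: cvg_id.
Qed.

Lemma Ck_diff k E F G (U : set E) (V : set F) (f : F -> G) (a b : E -> F) :
  open U -> open V -> (forall x, U x -> V (a x)) -> Ck k.+1 V f ->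
  Ck k U a -> Ck k U b -> Ck k U (fun x => 'd f (a x) (b x)).
Proof.
move=> oU oV UV [_ Cf] Ca Cb.
have UVab : U `<=` (fun x => (a x, b x)) @^-1` (V `*` setT).
  by move=> x Ux; split => //=; exact: UV.
exact: (Ck_comp oU (open_setXT oV) UVab (Ck_pair oU Ca Cb) Cf).
Qed.

Lemma Ck_opp k E F (U : set E) (f : E -> F) :
  open U -> Ck k U f -> Ck k U (fun x => - f x).
Proof.
move=> oU Cf; apply: (Ck_post (l := (-%R : {linear F -> F}))) => //.
exact: opp_continuous.
Qed.

Lemma Ck_sub k E F (U : set E) (f g : E -> F) :
  open U -> Ck k U f -> Ck k U g -> Ck k U (fun x => f x - g x).
Proof. by move=> oU Cf Cg; apply: Ck_add => //; exact: Ck_opp. Qed.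

(** The derivative - f^-2 df contains f^-1 itself, which is what the induction on k feeds on. *)
Lemma Ck_inv k E (U : set E) (f : E -> R) : open U ->
  (forall x, U x -> f x != 0) -> Ck k U f -> Ck k U (fun x => (f x)^-1).
Proof.
elim: k E U f => [|k IH] E U f oU f0.
  by move=> cf x Ux; apply: cvgV; [exact: f0|exact: cf].
move=> Cf; have Cfk := CkP Cf; move: Cf => [df Cf]; split.
  by move=> x Ux; apply: differentiableV; [exact: df|exact: f0].
have oUT := @open_setXT _ E _ oU.
have Cfst : Ck k (U `*` @setT E) (fun p => (f p.1)^-1).
  apply: (Ck_comp (V := U) (g := fun x => (f x)^-1)) => //.
  - by move=> p [].
  - exact: Ck_fst.
  - exact: IH.
have := Ck_mul oUT (Ck_opp oUT (Ck_mul oUT Cfst Cfst)) Cf.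
apply: Ck_eq => // -[x v]; rewrite inE/= => -[Ux _].
rewrite diffV; [|exact: df|exact: f0].
by rewrite /= /GRing.scale_fun/= -expr2 exprVn.
Qed.

Lemma diff_shiftE E F (f : E -> F) (w x v : E) : differentiable f (x + w) ->
  differentiable (fun y => f (y + w)) x /\
  'd (fun y => f (y + w)) x v = 'd f (x + w) v.
Proof.
move=> df.
have dw : differentiable (fun y : E => y + w) x by apply: differentiableD.
split; first exact: differentiable_comp.
apply: etrans (diff_compE v dw df) _; congr ('d f _ _).
by rewrite diffD// diff_cst/= addr0 diff_val.
Qed.

Lemma line_is_derive E F (f : E -> F) (y u : E) (s : R) :
  differentiable f (y + s *: u) ->
  is_derive s 1 (fun t => f (y + t *: u)) ('d f (y + s *: u) u).
Proof.
move=> df.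
have dl : differentiable (fun t : R => y + t *: u) s.
  by apply: differentiableD.
have el : 'd (fun t : R => y + t *: u) s 1 = u.
  by rewrite diffD// diff_cst/= add0r diff_val scale1r.
have dc : differentiable (fun t : R => f (y + t *: u)) s.
  exact: differentiable_comp.
apply: DeriveDef; first exact: diff_derivable.
by rewrite deriveE// diff_compE// el.
Qed.

Lemma line_MVT E (f : E -> R) (y u : E) (h : R) : 0 < h ->
  (forall s, 0 <= s <= h -> differentiable f (y + s *: u)) ->
  exists2 s, 0 <= s <= h & f (y + h *: u) - f y = h * 'd f (y + s *: u) u.
Proof.
move=> h0 df; pose g s := f (y + s *: u).
have dg s : 0 <= s <= h -> is_derive s 1 g ('d f (y + s *: u) u).
  by move=> /df; exact: line_is_derive.
have cg : {within `[0, h], continuous g}.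
  apply: derivable_within_continuous => s; rewrite in_itv/= => sh.
  by have [] := dg s sh.
have [|s sh e] := @MVT _ g (fun s => 'd f (y + s *: u) u) _ _ h0 _ cg.
  move=> s; rewrite in_itv/= => /andP[s0 sh]; apply: dg.
  by rewrite !ltW.
move: sh; rewrite in_itv/= => /andP[s0 sh].
exists s; first by rewrite !ltW.
by move: e; rewrite /g scale0r addr0 subr0 mulrC.
Qed.

(** Two applications of the mean value theorem: along u to the increment of f by h v, then along v
    to the u-derivative of f. *)
Lemma second_difference E (U : set E) (f : E -> R) (x u v : E) (h : R) :
  open U -> Ck 2 U f -> 0 < h ->
  (forall s t, 0 <= s <= h -> 0 <= t <= h -> U (x + s *: u + t *: v)) ->
  exists s t, [/\ 0 <= s <= h, 0 <= t <= h &
    f (x + h *: u + h *: v) - f (x + h *: v) - (f (x + h *: u) - f x) =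
    h * (h * 'd (fun y => 'd f y u) (x + s *: u + t *: v) v)].
Proof.
move=> oU C2 h0 Uh.
have hh : 0 <= h <= h by rewrite ltW/=.
have h00 : 0 <= (0 : R) <= h by rewrite lexx ltW.
have Uxs s : 0 <= s <= h -> U (x + s *: u).
  by move=> sh; have := Uh s 0 sh h00; rewrite scale0r addr0.
have df := Ck_differentiable C2.
pose F y := f (y + h *: v) - f y.
have dF s : 0 <= s <= h -> differentiable F (x + s *: u).
  move=> sh; apply: differentiableB; last exact/df/Uxs.
  by have [] := diff_shiftE u (df _ (Uh _ _ sh hh)).
have [s sh es] := line_MVT h0 dF.
have C1 : Ck 1 U (fun y => 'd f y u).
  by apply: (Ck_diff (V := U)) => //; [exact: Ck_id|exact: Ck_cst].
have dG t : 0 <= t <= h ->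
    differentiable (fun y => 'd f y u) (x + s *: u + t *: v).
  by move=> th; apply: (Ck_differentiable C1); exact: Uh.
have [t th et] := line_MVT h0 dG.
exists s, t; split => //; rewrite -et.
transitivity (F (x + h *: u) - F x); first by rewrite /F; ring.
rewrite es; congr (_ * _).
have [d1 e1] := diff_shiftE u (df _ (Uh _ _ sh hh)).
rewrite -e1; exact: (congr1 (@^~ u) (diffB d1 (df _ (Uxs _ sh)))).
Qed.

(* Schwarz's theorem: the second difference of f along u and v is close to both
   mixed derivatives. *)
Lemma diff_diffC E (U : set E) (f : E -> R) (x u v : E) :
  open U -> Ck 2 U f -> U x ->
  'd (fun y => 'd f y u) x v = 'd (fun y => 'd f y v) x u.
Proof.
move=> oU C2 Ux.
(* By the symmetry in u and v an inequality is enough; its failure leaves room for a number c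
   strictly between the two mixed derivatives. *)
suff H (a b : E) : 'd (fun y => 'd f y a) x b <= 'd (fun y => 'd f y b) x a.
  by apply/le_anti; rewrite !H.
have C0 (p q : E) : Ck 0 U (fun y => 'd (fun y => 'd f y p) y q).
  apply: (Ck_diff (V := U)) => //; [|exact: Ck_id|exact: Ck_cst].
  by apply: (Ck_diff (V := U)) => //; [exact: Ck_id|exact: Ck_cst].
rewrite leNgt; apply/negP => lt; have [c1 c2] := midf_lt lt.
set c := _ / _ in c1 c2.
(* On W the mixed derivatives stay on opposite sides of c, yet the second difference makes a value
   of one equal to a value of the other. *)
pose W := U `&` [set y | 'd (fun y => 'd f y b) y a < c] `&`
  [set y | c < 'd (fun y => 'd f y a) y b].
have : nbhs x W.
  apply: filterI; first apply: filterI.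
  - exact: open_nbhs_nbhs.
  - by have := C0 b a x Ux; move=> /cvgr_lt /(_ _ c1).
  - by have := C0 a b x Ux; move=> /cvgr_gt /(_ _ c2).
move=> xW.
have cl (p q : E) : (fun st : R * R => x + st.1 *: p + st.2 *: q) @ (0, 0) --> x.
  have oT : open [set: R * R] by exact: openT.
  have C : Ck 0 [set: R * R] (fun st => x + st.1 *: p + st.2 *: q).
    have C1 := Ck_scalel p oT (@Ck_fst _ 0 R R _ oT).
    have C2' := Ck_scalel q oT (@Ck_snd _ 0 R R _ oT).
    exact: (Ck_add oT (Ck_add oT (Ck_cst 0 x oT) C1) C2').
  have := C (0, 0) I; rewrite /continuous_at /prop_for /=.
  by rewrite !scale0r !addr0.
have small (p q : E) : exists2 h : R, 0 < h & forall r s t, 0 < r <= h ->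
   0 <= s <= r -> 0 <= t <= r -> W (x + s *: p + t *: q).
  have /nbhs_ballP [e /= e0 He] := cl p q _ xW.
  exists (e / 2); first by rewrite divr_gt0.
  move=> r s t /andP[r0 re] /andP[s0 sr] /andP[t0 tr]; apply: (He (s, t)).
  have re' : r < e by apply: le_lt_trans re _; rewrite ltr_pdivrMr// ltr_pMr// ltr1n.
  by split; rewrite /ball/= sub0r normrN ger0_norm//; [move: sr|move: tr] => /le_lt_trans; apply.
have [h1 h10 H1] := small a b; have [h2 h20 H2] := small b a.
pose h := Num.min h1 h2.
have h0 : 0 < h by rewrite lt_min h10.
have hh1 : 0 < h <= h1 by rewrite h0 ge_min lexx.
have hh2 : 0 < h <= h2 by rewrite h0 ge_min lexx orbT.
have [|s [t [sh th e1]]] := second_difference oU C2 h0 (x := x) (u := a) (v := b).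
  by move=> s t sh th; have [[]] := H1 _ _ _ hh1 sh th.
have [|s' [t' [sh' th' e2]]] := second_difference oU C2 h0 (x := x) (u := b) (v := a).
  by move=> s' t' sh' th'; have [[]] := H2 _ _ _ hh2 sh' th'.
have [_ l1] := H1 _ _ _ hh1 sh th.
have [[_ l2] _] := H2 _ _ _ hh2 sh' th'.
have : h * (h * 'd (fun y => 'd f y a) (x + s *: a + t *: b) b) =
       h * (h * 'd (fun y => 'd f y b) (x + s' *: b + t' *: a) a).
  by rewrite -e1 -e2 (addrAC x (h *: b)); ring.
move=> /(mulfI (lt0r_neq0 h0)) /(mulfI (lt0r_neq0 h0)) e.
by move: l1; rewrite /= e => /(lt_trans l2); rewrite ltxx.
Qed.

End DifferentialCalculus.

(** * 1-forms on open sets of the model space *)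

Section CoordinateForms.
Context {R : realType}.
Implicit Types E F G : normedModType R.

Lemma diff_linearE E F (l : E -> F) (x v : E) : linear l -> continuous l ->
  'd l x v = l v.
Proof.
move=> ll cl; pose m := GRing.isLinear.Build _ _ _ _ _ ll.
pose L : {linear E -> F} := HB.pack l m.
exact: (@diff_linE _ _ _ L).
Qed.

Lemma differentiable_linear E F (l : E -> F) (x : E) : linear l ->
  continuous l -> differentiable l x.
Proof.
move=> ll cl; pose m := GRing.isLinear.Build _ _ _ _ _ ll.
pose L : {linear E -> F} := HB.pack l m.
exact: (@linear_differentiable _ _ _ L).
Qed.

Section LinearFunctional.
Context (E : lmodType R) (l : E -> R).
Hypothesis ll : linear (l : E -> R^o).

Lemma functionalD u v : l (u + v) = l u + l v.
Proof. by have := ll 1 u v; rewrite !scale1r. Qed.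

Lemma functional0 : l 0 = 0.
Proof. by apply: (addrI (l 0)); rewrite -functionalD !addr0. Qed.

Lemma functionalZ t u : l (t *: u) = t * l u.
Proof. by have := ll t u 0; rewrite functional0 !addr0. Qed.

Lemma functionalN u : l (- u) = - l u.
Proof. by rewrite -scaleN1r functionalZ mulN1r. Qed.

Lemma functional_sum (I : Type) (r : seq I) (f : I -> E) :
  l (\sum_(i <- r) f i) = \sum_(i <- r) l (f i).
Proof.
elim: r => [|i r IH]; first by rewrite !big_nil functional0.
by rewrite !big_cons functionalD IH.
Qed.

End LinearFunctional.

Lemma Ck_partial1 k E F G (U : set E) (f : E -> F -> G) (v : F) : open U ->
  Ck k (U `*` setT) (fun p : E * F => f p.1 p.2) -> Ck k U (f ^~ v).
Proof.
move=> oU Cf.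
have sub : U `<=` (fun x => (x, v)) @^-1` (U `*` setT) by [].
exact: (Ck_comp oU (open_setXT oU) sub (Ck_pair oU (Ck_id k oU) (Ck_cst k v oU)) Cf).
Qed.

Lemma Ck_partial2 k E F G (U : set E) (f : E -> F -> G) (x : E) : open U ->
  U x -> Ck k (U `*` setT) (fun p : E * F => f p.1 p.2) -> Ck k setT (f x).
Proof.
move=> oU Ux Cf; have oT := @openT F.
have sub : setT `<=` (fun v : F => (x, v)) @^-1` (U `*` setT) by [].
exact: (Ck_comp oT (open_setXT oU) sub (Ck_pair oT (Ck_cst k x oT) (Ck_id k oT)) Cf).
Qed.

(* A 1-form on an open subset U of E, given by its values [a y v] at [y] on [v];
   smoothness is joint in y and v. *)
Definition form1_on k E (U : set E) (a : E -> E -> R) :=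
  Ck k (U `*` setT) (fun p : E * E => a p.1 p.2) /\
  forall y, U y -> linear (a y : E -> R^o).

(** The increment splits as (u, 0) + (0, w); in the second direction the form is linear, hence its
    own derivative. *)
Lemma diff_form1 E (U : set E) (a : E -> E -> R) (y v u w : E) : open U ->
  U y -> form1_on 1 U a ->
  'd (fun p : E * E => a p.1 p.2) (y, v) (u, w) = 'd (a ^~ v) y u + a y w.
Proof.
move=> oU Uy [Ca lin]; have da := Ck_differentiable Ca.
have dyv := da (y, v) (conj Uy I).
have -> : (u, w) = (u, 0) + (0, w) :> E * E.
  by congr pair; rewrite /= ?addr0 ?add0r.
rewrite linearD; congr (_ + _).
  apply: etrans _ (esym (diff_compE (f := fun z => (z, v)) u _ dyv)).
    have -> : 'd (fun z : E => (z, v)) y u = (u, 0) :> E * E; last by [].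
    rewrite diff_pairE ?diff_idE ?diff_cstE//; exact: differentiable_idE.
  apply: differentiable_pair => //; exact: differentiable_idE.
have Cy := Ck_partial2 oU Uy Ca.
have cy : continuous (a y) by move=> z; exact: (CkP Cy).
apply: etrans _ (diff_linearE v w (lin y Uy) cy).
apply: etrans _ (esym (diff_compE (f := fun z => (y, z)) w _ dyv)).
  have -> : 'd (fun z : E => (y, z)) v w = (0, w) :> E * E; last by [].
  rewrite diff_pairE ?diff_idE ?diff_cstE//; exact: differentiable_idE.
apply: differentiable_pair => //; exact: differentiable_idE.
Qed.

(** The exterior derivative of the 1-form a at y, evaluated on the constant vector fields u and
    v. *)
Definition curl E (a : E -> E -> R) (y u v : E) : R :=
  'D_u (a ^~ v) y - 'D_v (a ^~ u) y.

Lemma curlE E (U : set E) (a : E -> E -> R) (y u v : E) : open U -> U y ->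
  form1_on 1 U a -> curl a y u v = 'd (a ^~ v) y u - 'd (a ^~ u) y v.
Proof.
move=> oU Uy [Ca _]; rewrite /curl.
have du := Ck_differentiable (Ck_partial1 u oU Ca) Uy.
have dv := Ck_differentiable (Ck_partial1 v oU Ca) Uy.
by rewrite (deriveE _ du) (deriveE _ dv).
Qed.

Lemma curl_eq E (U : set E) (a b : E -> E -> R) (y u v : E) : open U -> U y ->
  form1_on 1 U a -> (forall z w, U z -> a z w = b z w) ->
  curl a y u v = curl b y u v.
Proof.
move=> oU Uy [Ca la] ab.
have d w : differentiable (a ^~ w) y.
  exact: (Ck_differentiable (Ck_partial1 w oU Ca)).
rewrite /curl; congr (_ - _); apply: esym.
  by apply: (derive_openE u oU Uy _ (d v)) => z Uz; exact: ab.
by apply: (derive_openE v oU Uy _ (d u)) => z Uz; exact: ab.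
Qed.

Definition form1_pull E F (g : E -> F) (a : F -> F -> R) (y u : E) : R :=
  a (g y) ('d g y u).

Lemma form1_pull_on k E F (U : set E) (V : set F) (g : E -> F) a : open U ->
  open V -> (forall x, U x -> V (g x)) -> Ck k.+1 U g -> form1_on k V a ->
  form1_on k U (form1_pull g a).
Proof.
move=> oU oV UV Cg [Ca la]; split; last first.
  by move=> y Uy t u v; rewrite /form1_pull linearP; exact: la (UV _ Uy) _ _ _.
have oUT := @open_setXT _ E _ oU.
have C1 : Ck k (U `*` @setT E) (fun p : E * E => (g p.1, 'd g (p.1) (p.2))).
  apply: Ck_pair => //; last by have [_] := Cg.
  have sub : U `*` @setT E `<=` (fst : E * E -> E) @^-1` U by move=> p [].
  exact: (Ck_comp oUT oU sub (Ck_fst k oUT) (CkP Cg)).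
have sub : U `*` @setT E `<=`
  (fun p : E * E => (g p.1, 'd g (p.1) (p.2))) @^-1` (V `*` setT).
  by move=> p [/UV].
exact: (Ck_comp oUT (open_setXT oV) sub C1 Ca).
Qed.

(* The second-order terms cancel by the symmetry of the second derivative. *)
Lemma curl_pull E F (U : set E) (V : set F) (g : E -> F) a (y u v : E) :
  open U -> open V -> (forall x, U x -> V (g x)) -> Ck 2 U g ->
  form1_on 1 V a -> U y ->
  curl (form1_pull g a) y u v = curl a (g y) ('d g y u) ('d g y v).
Proof.
move=> oU oV UV Cg fa Uy; have [Ca la] := fa.
have fp := form1_pull_on oU oV UV Cg fa.
rewrite (curlE _ _ oU Uy fp) (curlE _ _ oV (UV _ Uy) fa).
have dg := Ck_differentiable Cg Uy.
have C1 w : Ck 1 U (fun z => 'd g z w).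
  by apply: (Ck_diff (V := U)) => //; [exact: Ck_id|exact: Ck_cst].
have Dp w t : 'd (form1_pull g a ^~ w) y t =
  'd (a ^~ ('d g y w)) (g y) ('d g y t) + a (g y) ('d (fun z => 'd g z w) y t).
  have dw := Ck_differentiable (C1 w) Uy.
  have da := Ck_differentiable Ca (conj (UV _ Uy) I : (V `*` setT) (g y, 'd g y w)).
  rewrite -(diff_form1 _ _ _ oV (UV _ Uy) fa) -diff_pairE//.
  apply: (@diff_compE _ _ _ _ (fun z => (g z, 'd g z w))
    (fun p => a p.1 p.2) _ _ _ da).
  exact: differentiable_pair.
rewrite !Dp.
suff -> : a (g y) ('d (fun z => 'd g z v) y u) =
  a (g y) ('d (fun z => 'd g z u) y v) by ring.
have Cl := Ck_partial2 oV (UV _ Uy) Ca.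
have ll := la _ (UV _ Uy).
have cl : continuous (a (g y)) by move=> z; exact: (CkP Cl).
(* Schwarz's theorem is available for scalar functions, so it is applied to g followed by the fixed
   functional [a (g y)]. *)
have Clk : Ck 2 setT (a (g y)).
  pose m := GRing.isLinear.Build _ _ _ _ _ ll.
  pose L : {linear F -> R^o} := HB.pack (a (g y)) m.
  by apply: (@Ck_linear _ 2 _ _ _ L) => //; exact: openT.
have subT : U `<=` g @^-1` setT by [].
have C2 := Ck_comp oU (@openT F) subT Cg Clk.
have S := diff_diffC u v oU C2 Uy.
have e w z : U z -> a (g y) ('d g z w) = 'd (a (g y) \o g) z w.
  move=> Uz; have dgz := Ck_differentiable Cg Uz.
  have dl := differentiable_linear (g z) ll cl.
  by rewrite (diff_compE w dgz dl) (diff_linearE _ _ ll cl).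
have e2 w t : 'd (fun z => 'd (a (g y) \o g) z w) y t =
   a (g y) ('d (fun z => 'd g z w) y t).
  have dw := Ck_differentiable (C1 w) Uy.
  have dl := differentiable_linear ('d g y w) ll cl.
  have dc : differentiable (fun z => a (g y) ('d g z w)) y.
    exact: differentiable_comp dw dl.
  rewrite (diff_openE _ oU Uy (e w) dc).
  by rewrite (diff_compE t dw dl) (diff_linearE _ _ ll cl).
by rewrite -!e2 S.
Qed.

Lemma form1_onW k l E (U V : set E) a : (l <= k)%N -> V `<=` U ->
  form1_on k U a -> form1_on l V a.
Proof.
move=> lk VU [Ca la]; split; last by move=> y /VU/la.
by apply: CkW (Ck_le lk Ca) => p [/VU].
Qed.

Lemma Ck_curl k E (U : set E) a (u v : E) : open U -> form1_on k.+1 U a ->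
  Ck k U (fun y => curl a y u v).
Proof.
move=> oU fa.
have Cp w t : Ck k U (fun y => 'd (a ^~ w) y t).
  have C := Ck_partial1 w oU fa.1.
  by apply: (Ck_diff (V := U)) => //; [exact: Ck_id|exact: Ck_cst].
have := Ck_sub oU (Cp v u) (Cp u v); apply: Ck_eq => // y /set_mem Uy.
by rewrite (curlE _ _ oU Uy)//; exact: form1_onW fa.
Qed.

(** This is d(da) = 0: the six second derivatives cancel in pairs by Schwarz's theorem. *)
Lemma curl_closed E (U : set E) a (y u v w : E) : open U -> U y ->
  form1_on 2 U a ->
  'D_u (fun z => curl a z v w) y - 'D_v (fun z => curl a z u w) y +
  'D_w (fun z => curl a z u v) y = 0.
Proof.
move=> oU Uy fa.
have f1 : form1_on 1 U a by exact: form1_onW fa.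
have C2 t := Ck_partial1 t oU fa.1.
have C1 t s : Ck 1 U (fun z => 'd (a ^~ t) z s).
  by apply: (Ck_diff (V := U)) => //; [exact: Ck_id|exact: Ck_cst].
have d t s := Ck_differentiable (C1 t s) Uy.
(* [D t p q] is the second derivative, along p and then q, of the component of the form on t; once
   it is abstracted an algebraic identity remains. *)
have [D [S e]] : exists D : E -> E -> E -> R, (forall t p q, D t p q = D t q p) /\
    forall p q r, 'D_p (fun z => curl a z q r) y = D r q p - D q r p.
  exists (fun t p q => 'd (fun z => 'd (a ^~ t) z p) y q); split.
    by move=> t p q; exact: diff_diffC oU (C2 t) Uy.
  move=> p q r.
  have E1 z : U z -> 'd (a ^~ r) z q - 'd (a ^~ q) z r = curl a z q r.
    by move=> Uz; rewrite (curlE _ _ oU Uz).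
  have dB := differentiableB (d r q) (d q r).
  apply: etrans (derive_openE p oU Uy E1 dB) _.
  apply: etrans (deriveE p dB) _.
  exact: (congr1 (@^~ p) (diffB (d r q) (d q r))).
by rewrite !e (S w v u) (S v w u) (S u w v); ring.
Qed.

(** Expansion of v in the standard basis. Forms are defined to be smooth for each fixed vector,
    while the chain rule needs smoothness jointly in the point and the vector; finite dimension
    bridges the two. *)
Lemma Ck_row_linear k (E : normedModType R) m
    (U : set E) (f : E -> 'rV[R]_m -> R) : open U ->
  (forall y, U y -> linear (f y : _ -> R^o)) -> (forall v, Ck k U (f ^~ v)) ->
  Ck k (U `*` setT) (fun p : E * 'rV[R]_m => f p.1 p.2).
Proof.
move=> oU lf Cf; have oUT := @open_setXT _ 'rV[R]_m _ oU.
have C : Ck k (U `*` setT) (fun p : E * 'rV[R]_m =>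
    \sum_(i < m) p.2 0 i * f p.1 (delta_mx 0 i)).
  apply: Ck_sum => // i.
  have Cc := Ck_coord 0 i oUT (@Ck_snd _ k _ 'rV[R]_m _ oUT).
  have sub : U `*` setT `<=` (fst : E * 'rV[R]_m -> E) @^-1` U by move=> p [].
  exact: (Ck_mul oUT Cc (Ck_comp oUT oU sub (Ck_fst k oUT) (Cf (delta_mx 0 i)))).
apply: Ck_eq C => // -[y v]; rewrite inE => -[/= Uy _].
rewrite [in RHS](row_sum_delta v) (functional_sum (lf y Uy)).
by apply: eq_bigr => i _; rewrite (functionalZ (lf y Uy)).
Qed.

End CoordinateForms.

(** * Maps and forms in charts *)

Section ChartExpressions.
Context {R : realType}.
Implicit Types E F G : normedModType R.

Lemma chart_at_atlasP E (M : manifold E) (x : M) : atlas M (chart_at x).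
Proof. by rewrite /chart_at; case: cid2. Qed.

Lemma chart_at_domP E (M : manifold E) (x : M) : cdom (chart_at x) x.
Proof. by rewrite /chart_at; case: cid2. Qed.

Lemma cfunKE E (T : topologicalType) (c : chart E T) x :
  cdom c x -> cinv c (cfun c x) = x.
Proof. by move=> cx; rewrite cfunK ?inE. Qed.

(** Smoothness at one point in one pair of charts. The set V records that f stays in the domain of d
    near x, so that composition and change of charts need no separate continuity hypothesis. *)
Definition chart_smooth E F (M : manifold E) (N : manifold F) (c : chart E M)
    (d : chart F N) (f : M -> N) (x : M) :=
  exists V, [/\ open V, V (cfun c x), V `<=` cfun c @` cdom c,
    forall y, V y -> cdom d (f (cinv c y)) &
    smooth_on V (cfun d \o f \o cinv c)].

(** For f the identity this is the change of coordinates of tangent vectors from c to d; for the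
    charts [chart_at] it is [tangent_map]. *)
Definition dchart E F (M : manifold E) (N : manifold F) (c : chart E M)
    (d : chart F N) (f : M -> N) (x : M) (v : E) : F :=
  'd (cfun d \o f \o cinv c) (cfun c x) v.

Lemma tangent_mapE E F (M : manifold E) (N : manifold F) (f : M -> N) x v :
  tangent_map f x v = dchart (chart_at x) (chart_at (f x)) f x v.
Proof. by []. Qed.

Lemma dchart_linear E F (M : manifold E) (N : manifold F) (c : chart E M)
    (d : chart F N) (f : M -> N) (x : M) : linear (dchart c d f x).
Proof. by move=> t u v; rewrite /dchart linearP. Qed.

Lemma chart_nbhs E (T : topologicalType) (c : chart E T) (A : set T) x :
  open A -> A x -> cdom c x ->
  [/\ open (cfun c @` (cdom c `&` A)), (cfun c @` (cdom c `&` A)) (cfun c x),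
    cfun c @` (cdom c `&` A) `<=` cfun c @` cdom c &
    forall y, (cfun c @` (cdom c `&` A)) y -> A (cinv c y)].
Proof.
move=> oA Ax cx; split.
- exact: chart_imgI_open.
- by exists x.
- by move=> _ [z [cz _] <-]; exists z.
- by move=> _ [z [cz Az] <-]; rewrite cfunKE.
Qed.

Section TwoManifolds.
Context E F (M : manifold E) (N : manifold F).
Implicit Types (c : chart E M) (d : chart F N) (f : M -> N).

Lemma chart_smooth_differentiable c d f x : chart_smooth c d f x ->
  differentiable (cfun d \o f \o cinv c) (cfun c x).
Proof. by move=> [V [_ Vx _ _ /(_ 1%N)]] /Ck_differentiable; apply. Qed.

Lemma chart_smooth_shrink c d f x (A : set M) : open A -> A x -> cdom c x ->
  chart_smooth c d f x -> exists V, [/\ open V, V (cfun c x),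
    V `<=` cfun c @` (cdom c `&` A), forall y, V y -> cdom d (f (cinv c y)) &
    smooth_on V (cfun d \o f \o cinv c)].
Proof.
move=> oA Ax cx [V [oV Vx Vc Vd sV]].
exists (V `&` cfun c @` (cdom c `&` A)); split.
- by apply: openI => //; exact: chart_imgI_open.
- by split => //; exists x.
- by move=> y [].
- by move=> y [/Vd].
- by move=> k; apply: CkW (sV k) => y [].
Qed.

Lemma chart_smooth_cont c d f x : cdom c x -> chart_smooth c d f x ->
  {for x, continuous f}.
Proof.
move=> cx [V [oV Vx Vc Vd sV]] W fxW.
have e z : cdom c z -> V (cfun c z) -> f z = cinv d ((cfun d \o f \o cinv c) (cfun c z)).
  by move=> cz Vz /=; have := Vd _ Vz; rewrite cfunKE// => dz; rewrite cfunKE.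
have dfx : cdom d (f x) by have := Vd _ Vx; rewrite cfunKE.
have cd : {for cfun d (f x), continuous (cinv d)}.
  by apply: cinv_continuous; rewrite inE; exists (f x).
have ce : {for cfun c x, continuous (cfun d \o f \o cinv c)} by exact: (sV 0%N).
have cc : {for x, continuous (cfun c)} by apply: cfun_continuous; rewrite inE.
have nV : \forall z \near x, cdom c z /\ V (cfun c z).
  apply: filterI; first by apply: open_nbhs_nbhs; split => //; exact: cdom_open.
  exact: (cc _ (open_nbhs_nbhs (conj oV Vx))).
have H : {for x, continuous (cinv d \o (cfun d \o f \o cinv c) \o cfun c)}.
  apply: continuous_comp => //; apply: continuous_comp => //.
  by rewrite /= cfunKE.
have : \forall z \near x, W (cinv d ((cfun d \o f \o cinv c) (cfun c z))).
  by apply: (H W); rewrite /= cfunKE// cfunKE.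
by apply: filterS2 nV => z [cz Vz] /=; rewrite -e.
Qed.

Lemma smooth_map_on_chart (A : set M) c d f x : open A -> smooth_map_on A f ->
  A x -> atlas M c -> atlas N d -> cdom c x -> cdom d (f x) ->
  chart_smooth c d f x.
Proof.
move=> oA [cf sf] Ax ac ad cx dfx.
have oB : open (A `&` f @^-1` cdom d).
  by apply: open_setI_preimage => //; exact: cdom_open.
exists (cfun c @` (cdom c `&` A `&` f @^-1` cdom d)); split.
- by rewrite -setIA; exact: chart_imgI_open.
- by exists x.
- by move=> _ [z [[cz _] _] <-]; exists z.
- by move=> _ [z [[cz _] dz] <-]; rewrite cfunKE.
- exact: sf.
Qed.

Lemma chart_smooth_eq c d f g x : cdom c x -> chart_smooth c d f x ->
  (exists A, [/\ open A, A x & forall z, A z -> f z = g z]) ->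
  chart_smooth c d g x /\ forall v, dchart c d g x v = dchart c d f x v.
Proof.
move=> cx fs [A [oA Ax e]].
have [V [oV Vx VA Vd sV]] := chart_smooth_shrink oA Ax cx fs.
have e' y : V y -> (cfun d \o f \o cinv c) y = (cfun d \o g \o cinv c) y.
  by move=> /VA [z [cz Az] <-] /=; rewrite cfunKE// e.
split.
  exists V; split => //.
  - by move=> y /VA [z [cz _] <-]; exists z.
  - by move=> y Vy; have := Vd _ Vy; have [z [cz Az] <-] := VA _ Vy; rewrite cfunKE// e.
  - by move=> k; apply: Ck_eq (sV k) => // y /set_mem /e'.
move=> v; apply: (diff_openE v oV Vx e').
exact: chart_smooth_differentiable.
Qed.

End TwoManifolds.

Section Composition.
Context E F G (M : manifold E) (N : manifold F) (P : manifold G).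
Context (c : chart E M) (d : chart F N) (e : chart G P) (f : M -> N) (g : N -> P).
Context (x : M) (cx : cdom c x) (fs : chart_smooth c d f x)
  (gs : chart_smooth d e g (f x)).

Let comp_expr V : (forall y, V y -> cdom d (f (cinv c y))) -> forall y, V y ->
  (cfun e \o g \o cinv d) ((cfun d \o f \o cinv c) y) = (cfun e \o (g \o f) \o cinv c) y.
Proof. by move=> Vd y Vy; rewrite /= cfunKE//; exact: Vd. Qed.

Lemma chart_smooth_comp : chart_smooth c e (g \o f) x.
Proof.
have [V [oV Vx Vc Vd sV]] := fs; have [W [oW Wx Wd We sW]] := gs.
have oVW : open (V `&` (cfun d \o f \o cinv c) @^-1` W).
  by apply: open_setI_preimage => //; exact: (sV 0%N).
exists (V `&` (cfun d \o f \o cinv c) @^-1` W); split => //.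
- by split => //=; rewrite cfunKE.
- by move=> y [/Vc].
- by move=> y [Vy /= Wy]; have := We _ Wy; rewrite cfunKE//; exact: Vd.
- move=> k; have C : Ck k (V `&` (cfun d \o f \o cinv c) @^-1` W)
      ((cfun e \o g \o cinv d) \o (cfun d \o f \o cinv c)).
    have Cf : Ck k (V `&` (cfun d \o f \o cinv c) @^-1` W) (cfun d \o f \o cinv c).
      by apply: (CkW _ (sV k)) => y [].
    by apply: (Ck_comp oVW oW _ Cf (sW k)) => y [].
  apply: Ck_eq C => // y /set_mem [Vy _]; exact: (comp_expr Vd Vy).
Qed.

Lemma dchart_comp v :
  dchart c e (g \o f) x v = dchart d e g (f x) (dchart c d f x v).
Proof.
have [V [oV Vx Vc Vd sV]] := fs.
have df := chart_smooth_differentiable fs.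
have dg := chart_smooth_differentiable gs.
have q : cfun d (f x) = (cfun d \o f \o cinv c) (cfun c x) by rewrite /= cfunKE.
rewrite q in dg.
apply: etrans (diff_openE v oV Vx (comp_expr Vd) (differentiable_comp df dg)) _.
apply: etrans (diff_compE v df dg) _.
by rewrite /dchart q.
Qed.

End Composition.

Section Transitions.
Context E (M : manifold E).
Implicit Types (c : chart E M).

Lemma chart_smooth_id c c' x : atlas M c -> atlas M c' -> cdom c x ->
  cdom c' x -> chart_smooth c c' id x.
Proof.
move=> ac ac' cx cx'.
have [oV Vx Vc Vc'] := chart_nbhs (cdom_open c') cx' cx.
by exists (cfun c @` (cdom c `&` cdom c')); split => //; exact: atlas_compat.
Qed.

Lemma dchart_id c x v : cdom c x -> dchart c c id x v = v.
Proof.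
move=> cx.
have oU := cimg_open c.
have Ux : (cfun c @` cdom c) (cfun c x) by exists x.
have e y : (cfun c @` cdom c) y -> y = (cfun c \o id \o cinv c) y.
  by move=> [z cz <-] /=; rewrite cfunKE.
apply: etrans (diff_openE v oU Ux e (differentiable_idE _)) _.
exact: diff_idE.
Qed.

Lemma dchart_idM c c' c'' x v : atlas M c -> atlas M c' -> atlas M c'' ->
  cdom c x -> cdom c' x -> cdom c'' x ->
  dchart c' c'' id x (dchart c c' id x v) = dchart c c'' id x v.
Proof.
move=> ac ac' ac'' cx cx' cx''; symmetry.
exact: (dchart_comp cx (chart_smooth_id ac ac' cx cx')
  (chart_smooth_id ac' ac'' cx' cx'') v).
Qed.

Lemma dchart_idK c c' x v : atlas M c -> atlas M c' -> cdom c x ->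
  cdom c' x -> dchart c' c id x (dchart c c' id x v) = v.
Proof. by move=> *; rewrite dchart_idM// dchart_id. Qed.

End Transitions.

Section SmoothMapTheory.
Context E F (M : manifold E) (N : manifold F).
Implicit Types (c : chart E M) (d : chart F N) (f : M -> N).

Lemma chart_smooth_change c d c' d' f x : atlas M c -> atlas M c' ->
  atlas N d -> atlas N d' -> cdom c x -> cdom c' x -> cdom d (f x) ->
  cdom d' (f x) -> chart_smooth c d f x -> chart_smooth c' d' f x.
Proof.
move=> ac ac' ad ad' cx cx' dx dx' fs.
have s1 := chart_smooth_id ac' ac cx' cx.
have s2 := chart_smooth_id ad ad' dx dx'.
exact: (chart_smooth_comp cx' s1 (chart_smooth_comp cx fs s2)).
Qed.

Lemma dchart_change c d c' d' f x v : atlas M c -> atlas M c' ->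
  atlas N d -> atlas N d' -> cdom c x -> cdom c' x -> cdom d (f x) ->
  cdom d' (f x) -> chart_smooth c d f x ->
  dchart c' d' f x v = dchart d d' id (f x) (dchart c d f x (dchart c' c id x v)).
Proof.
move=> ac ac' ad ad' cx cx' dx dx' fs.
have s1 := chart_smooth_id ac' ac cx' cx.
have s2 := chart_smooth_id ad ad' dx dx'.
rewrite (dchart_comp cx' s1 (chart_smooth_comp cx fs s2)).
by rewrite (dchart_comp cx fs s2).
Qed.

(** By [chart_smooth_change] a single pair of charts around each point controls all the pairs that
    the definition quantifies over. *)
Lemma chart_smooth_map_on (A : set M) f : open A ->
  (forall x, A x -> exists c d, [/\ atlas M c, atlas N d, cdom c x,
     cdom d (f x) & chart_smooth c d f x]) -> smooth_map_on A f.
Proof.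
move=> oA H; split.
  by move=> x /H [c [d [_ _ cx _]]]; exact: chart_smooth_cont.
move=> c' d' ac' ad' k; apply: Ck_local => _ [x [[cx' Ax] dx'] <-].
have [c [d [ac ad cx dx fs]]] := H x Ax.
have [V [oV Vx _ _ sV]] := chart_smooth_change ac ac' ad ad' cx cx' dx dx' fs.
by exists V.
Qed.

Lemma smooth_map_on_at (A : set M) f x : open A -> smooth_map_on A f -> A x ->
  chart_smooth (chart_at x) (chart_at (f x)) f x.
Proof.
move=> oA sf Ax; apply: (smooth_map_on_chart oA) => //;
  by [exact: chart_at_atlasP|exact: chart_at_domP].
Qed.

Lemma smooth_map_chart c d f x : smooth_map f -> atlas M c -> atlas N d ->
  cdom c x -> cdom d (f x) -> chart_smooth c d f x.
Proof. by move=> sf; apply: smooth_map_on_chart sf _ => //; exact: openT. Qed.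

Lemma smooth_map_onW (A B : set M) f : open A -> open B -> A `<=` B ->
  smooth_map_on B f -> smooth_map_on A f.
Proof.
move=> oA oB AB sf; apply: chart_smooth_map_on => // x Ax.
exists (chart_at x), (chart_at (f x)); split;
  try exact: chart_at_atlasP; try exact: chart_at_domP.
by apply: (smooth_map_on_at oB sf); exact: AB.
Qed.

Lemma smooth_map_on_eq (A : set M) f g : open A -> smooth_map_on A f ->
  (forall x, A x -> f x = g x) -> smooth_map_on A g.
Proof.
move=> oA sf fg; apply: chart_smooth_map_on => // x Ax.
exists (chart_at x), (chart_at (f x)); split; rewrite -?fg//;
  try exact: chart_at_atlasP; try exact: chart_at_domP.
have [] // := chart_smooth_eq (chart_at_domP x) (smooth_map_on_at oA sf Ax) (g := g).
by exists A.
Qed.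

(** Translates a computation in convenient charts into the coordinates of [chart_at], in which
    tangent vectors are represented. *)
Lemma dchart_tangent c d f x v : atlas M c -> atlas N d -> cdom c x ->
  cdom d (f x) -> chart_smooth c d f x -> dchart c d f x v =
  dchart (chart_at (f x)) d id (f x) (tangent_map f x (dchart c (chart_at x) id x v)).
Proof.
move=> ac ad cx dx fs; have xx := chart_at_domP x; have ax := chart_at_atlasP x.
have yy := chart_at_domP (f x); have ay := chart_at_atlasP (f x).
rewrite tangent_mapE (dchart_change _ ax ac ay ad)//.
exact: chart_smooth_change fs.
Qed.

End SmoothMapTheory.

Section SmoothComposition.
Context E F G (M : manifold E) (N : manifold F) (P : manifold G).

Lemma smooth_map_on_comp (A : set M) (B : set N) (f : M -> N) (g : N -> P) :
  open A -> open B -> A `<=` f @^-1` B -> smooth_map_on A f ->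
  smooth_map_on B g -> smooth_map_on A (g \o f).
Proof.
move=> oA oB AB sf sg; apply: chart_smooth_map_on => // x Ax.
exists (chart_at x), (chart_at (g (f x))); split;
  try exact: chart_at_atlasP; try exact: chart_at_domP.
apply: chart_smooth_comp (smooth_map_on_at oA sf Ax) _; first exact: chart_at_domP.
by apply: (smooth_map_on_at oB sg); exact: AB.
Qed.

Lemma tangent_map_comp (A : set M) (B : set N) (f : M -> N) (g : N -> P) x v :
  open A -> open B -> smooth_map_on A f -> smooth_map_on B g -> A x ->
  B (f x) -> tangent_map (g \o f) x v = tangent_map g (f x) (tangent_map f x v).
Proof.
move=> oA oB sf sg Ax Bx.
exact: (dchart_comp (chart_at_domP x) (smooth_map_on_at oA sf Ax)
  (smooth_map_on_at oB sg Bx)).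
Qed.

End SmoothComposition.

Lemma tangent_map_eq E F (M : manifold E) (N : manifold F) (A : set M)
    (f g : M -> N) x v : open A -> A x -> (forall z, A z -> f z = g z) ->
  chart_smooth (chart_at x) (chart_at (f x)) f x ->
  tangent_map g x v = tangent_map f x v.
Proof.
move=> oA Ax fg fs; have [] := chart_smooth_eq (chart_at_domP x) fs (g := g).
  by exists A.
by move=> _; rewrite !tangent_mapE -fg//; apply.
Qed.

Lemma tangent_map_id E (M : manifold E) (x : M) v : tangent_map id x v = v.
Proof. by apply: (@dchart_id _ M); exact: chart_at_domP. Qed.

Lemma smooth_map_id E (M : manifold E) : smooth_map (@id M).
Proof.
apply: chart_smooth_map_on; first exact: openT.
move=> x _; exists (chart_at x), (chart_at x).
have cx := chart_at_domP x; have ac := chart_at_atlasP x.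
by split => //; exact: chart_smooth_id.
Qed.

End ChartExpressions.

(** * Differential forms in charts and the exterior derivative *)

Section ChartForms.
Context {R : realType}.
Implicit Types E F G : normedModType R.

Lemma ord2P (i : 'I_2) : i = ord0 \/ i = ord_max.
Proof. by case: i => -[|[|//]] p; [left|right]; apply: val_inj. Qed.

Definition pair2 E (u v : E) (i : 'I_2) : E := if i == ord0 then u else v.

Lemma pair2E E (v : 'I_2 -> E) : v = pair2 (v ord0) (v ord_max).
Proof. by apply/funext => i; have [->|->] := ord2P i. Qed.

Lemma cst1E E (v : 'I_1 -> E) : v = fun=> v ord0.
Proof. by apply/funext => i; rewrite ord1. Qed.

Lemma pair2_map E F (f : E -> F) (u v : E) :
  (fun i => f (pair2 u v i)) = pair2 (f u) (f v).
Proof. by apply/funext => i; rewrite /pair2; case: ifP. Qed.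

Lemma alternating1 E (a : E -> R) : linear (a : E -> R^o) ->
  alternating (fun v : 'I_1 -> E => a (v ord0)).
Proof.
move=> la; split; last by move=> v i j; rewrite !ord1 eqxx.
by move=> v i t u w /=; rewrite [i]ord1 /= la.
Qed.

Lemma alternating1P E (a : ('I_1 -> E) -> R) : alternating a ->
  linear ((fun u => a (fun=> u)) : E -> R^o).
Proof.
move=> [la _] t u w; have := la (fun=> 0) ord0 t u w.
have e z : [eta (fun=> 0) with ord0 |-> z] = (fun=> z) :> ('I_1 -> E).
  by apply/funext => i /=; rewrite [i]ord1 eqxx.
by rewrite !e.
Qed.

Lemma alternating2 E (b : E -> E -> R) : (forall v, linear (b^~ v : E -> R^o)) ->
  (forall u, linear (b u : E -> R^o)) -> (forall u, b u u = 0) ->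
  alternating (fun v : 'I_2 -> E => b (v ord0) (v ord_max)).
Proof.
move=> ll lr b0; split; last first.
  by move=> v i j; have [->|->] := ord2P i; have [->|->] := ord2P j => // _ ->.
by move=> v i t u w; have [->|->] := ord2P i; rewrite /= ?ll ?lr.
Qed.

Lemma alternating2P E (a : ('I_2 -> E) -> R) : alternating a ->
  [/\ forall v, linear ((fun u => a (pair2 u v)) : E -> R^o),
      forall u, linear ((fun v => a (pair2 u v)) : E -> R^o) &
      forall u, a (pair2 u u) = 0].
Proof.
move=> [la a0].
have e0 v z : [eta pair2 0 v with ord0 |-> z] = pair2 z v :> ('I_2 -> E).
  by apply/funext => i; have [->|->] := ord2P i.
have e1 v z : [eta pair2 v 0 with ord_max |-> z] = pair2 v z :> ('I_2 -> E).
  by apply/funext => i; have [->|->] := ord2P i.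
split.
- by move=> v t u w; have := la (pair2 0 v) ord0 t u w; rewrite !e0.
- by move=> v t u w; have := la (pair2 v 0) ord_max t u w; rewrite !e1.
- by move=> u; apply: (a0 _ ord0 ord_max).
Qed.

Lemma alternating2N E (a : ('I_2 -> E) -> R) u v : alternating a ->
  a (pair2 u v) = - a (pair2 v u).
Proof.
move=> /alternating2P [ll lr a0]; apply/eqP; rewrite -addr_eq0; apply/eqP.
have := a0 (u + v); rewrite (functionalD (ll _)) !(functionalD (lr _)) !a0.
by rewrite add0r addr0.
Qed.

Section OneManifold.
Context E (M : manifold E).
Implicit Types (c : chart E M).

Lemma form_inE k (w : dform M k) c x v : cdom c x ->
  form_in w c (cfun c x) v = w x (fun i => dchart c (chart_at x) id x (v i)).
Proof. by move=> cx; rewrite /form_in cfunKE. Qed.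

Lemma form_chart_at k (w : dform M k) x v :
  w x v = form_in w (chart_at x) (cfun (chart_at x) x) v.
Proof.
have xx := chart_at_domP x; rewrite form_inE//; congr (w x _).
by apply/funext => i; rewrite dchart_id.
Qed.

Definition form1_in (w : dform M 1) c (y v : E) : R := form_in w c y (fun=> v).

(** One neighbourhood serves all orders k, and smoothness is joint in the point and the vector, as
    [curl_pull] requires. *)
Definition smooth1_in (w : dform M 1) c (x : M) :=
  exists V, [/\ open V, V (cfun c x), V `<=` cfun c @` cdom c &
    forall k, form1_on k V (form1_in w c)].

Definition smooth1_at (w : dform M 1) x :=
  exists c, [/\ atlas M c, cdom c x & smooth1_in w c x].

End OneManifold.

Section Pullback.
Context E F (M : manifold E) (N : manifold F).

Lemma chart_smooth_pull (c : chart E M) (d : chart F N) (f : M -> N) x :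
  cdom c x -> chart_smooth c d f x ->
  exists V, [/\ open V, V (cfun c x), V `<=` cfun c @` cdom c,
    smooth_on V (cfun d \o f \o cinv c) & forall z, cdom c z -> V (cfun c z) ->
    cdom d (f z) /\ chart_smooth c d f z].
Proof.
move=> cx [V [oV Vx Vc Vd sV]]; exists V; split => // z cz Vz; split.
  by have := Vd _ Vz; rewrite cfunKE.
by exists V.
Qed.

Lemma form_in_pullback k (w : dform N k) (c : chart E M) (d : chart F N)
    (f : M -> N) x v : atlas M c -> atlas N d -> cdom c x -> cdom d (f x) ->
  chart_smooth c d f x -> form_in (pullback f w) c (cfun c x) v =
  form_in w d (cfun d (f x)) (fun i => dchart c d f x (v i)).
Proof.
move=> ac ad cx dx fs; rewrite form_inE// /pullback form_inE//.
congr (w (f x) _); apply/funext => i.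
rewrite (dchart_tangent _ ac ad cx dx fs).
by rewrite dchart_idK//; [exact: chart_at_atlasP|exact: chart_at_domP].
Qed.

(** On a neighbourhood of x the chart expression of the pullback is the coordinate pullback
    [form1_pull], so that the results on open sets of the model spaces apply. *)
Lemma form1_in_pullback (w : dform N 1) (c : chart E M) (d : chart F N)
    (f : M -> N) x : atlas M c -> atlas N d -> cdom c x -> cdom d (f x) ->
  chart_smooth c d f x -> smooth1_in w d (f x) ->
  exists V W, [/\ [/\ open V, V (cfun c x), V `<=` cfun c @` cdom c & open W],
    forall y, V y -> W ((cfun d \o f \o cinv c) y),
    smooth_on V (cfun d \o f \o cinv c),
    forall k, form1_on k W (form1_in w d) &
    forall y v, V y -> form1_pull (cfun d \o f \o cinv c) (form1_in w d) y v =
     form1_in (pullback f w) c y v].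
Proof.
move=> ac ad cx dx fs [W [oW Wx Wc Ww]].
have [V [oV Vx Vc sV Vz]] := chart_smooth_pull cx fs.
exists (V `&` (cfun d \o f \o cinv c) @^-1` W), W.
split=> //; first split => //.
- by apply: open_setI_preimage => //; exact: (sV 0%N).
- by split => //=; rewrite cfunKE.
- by move=> y [/Vc].
- by move=> y [].
- by move=> k; apply: (CkW _ (sV k)) => y [].
move=> _ v [/[dup] /Vc [z cz <-] /(Vz _ cz) [dz fsz] Wz].
rewrite /form1_in (form_in_pullback w (fun=> v) ac ad cz dz fsz).
by rewrite /form1_pull /= cfunKE.
Qed.

Lemma smooth1_in_pullback (w : dform N 1) (c : chart E M) (d : chart F N)
    (f : M -> N) x : atlas M c -> atlas N d -> cdom c x -> cdom d (f x) ->
  chart_smooth c d f x -> smooth1_in w d (f x) -> smooth1_in (pullback f w) c x.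
Proof.
move=> ac ad cx dx fs ws.
have [V [W [[oV Vx Vc oW] VW sV Ww e]]] := form1_in_pullback ac ad cx dx fs ws.
exists V; split => // k.
have [C1 C2] := form1_pull_on oV oW VW (sV k.+1) (Ww k).
split.
  apply: Ck_eq C1; first exact: open_setXT.
  by move=> [y v] /set_mem [/= Vy _]; exact: e.
by move=> y Vy t u v; rewrite -!e//; exact: C2.
Qed.

Lemma curl_pullback (w : dform N 1) (c : chart E M) (d : chart F N)
    (f : M -> N) x u v : atlas M c -> atlas N d -> cdom c x -> cdom d (f x) ->
  chart_smooth c d f x -> smooth1_in w d (f x) ->
  curl (form1_in (pullback f w) c) (cfun c x) u v =
  curl (form1_in w d) (cfun d (f x)) (dchart c d f x u) (dchart c d f x v).
Proof.
move=> ac ad cx dx fs ws.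
have [V [W [[oV Vx Vc oW] VW sV Ww e]]] := form1_in_pullback ac ad cx dx fs ws.
rewrite -(curl_eq _ _ oV Vx (form1_pull_on oV oW VW (sV 2%N) (Ww 1%N)) e).
by rewrite (curl_pull _ _ oV oW VW (sV 2%N) (Ww 1%N) Vx) /= cfunKE.
Qed.

End Pullback.

Section Derivative.
Context E (M : manifold E).
Implicit Types (c : chart E M).

Lemma pullback_id k (w : dform M k) : pullback id w = w.
Proof.
apply/funext => x; apply/funext => v; rewrite /pullback; congr (w x _).
by apply/funext => i; rewrite tangent_map_id.
Qed.

(** A change of charts is a pullback along the identity map. *)
Lemma smooth1_in_at (w : dform M 1) c x : atlas M c -> cdom c x ->
  smooth1_at w x -> smooth1_in w c x.
Proof.
move=> ac cx [d [ad dx ws]]; rewrite -(pullback_id w).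
exact: (smooth1_in_pullback ac ad cx dx (chart_smooth_id ac ad cx dx) ws).
Qed.

Lemma ext_derivative1E (w : dform M 1) x v : ext_derivative w x v =
  curl (form1_in w (chart_at x)) (cfun (chart_at x) x) (v ord0) (v ord_max).
Proof.
have e1 : lift ord0 ord0 = ord_max :> 'I_2 by apply: val_inj.
have F0 : (fun y => form_in w (chart_at x) y (fun j : 'I_1 => v (lift ord0 j))) =
    (form1_in w (chart_at x))^~ (v ord_max).
  apply/funext => y; rewrite /form1_in; congr (form_in _ _ _ _).
  by apply/funext => j; congr (v _); apply: val_inj; rewrite [j]ord1.
have F1 : (fun y => form_in w (chart_at x) y
      (fun j : 'I_1 => v (lift (ord_max : 'I_2) j))) =
    (form1_in w (chart_at x))^~ (v ord0).
  apply/funext => y; rewrite /form1_in; congr (form_in _ _ _ _).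
  by apply/funext => j; congr (v _); apply: val_inj; rewrite [j]ord1.
rewrite /ext_derivative 2!big_ord_recl big_ord0 addr0 e1 F0 F1.
by rewrite expr0 mul1r expr1 mulN1r.
Qed.

(** Naturality under the identity, read in two charts: the exterior derivative does not depend on
    the chart used to compute it. *)
Lemma ext_derivative_chart (w : dform M 1) c x v : atlas M c -> cdom c x ->
  smooth1_at w x -> ext_derivative w x v =
  curl (form1_in w c) (cfun c x) (dchart (chart_at x) c id x (v ord0))
    (dchart (chart_at x) c id x (v ord_max)).
Proof.
move=> ac cx ws; rewrite ext_derivative1E -{1}(pullback_id w).
have ax := chart_at_atlasP x; have xx := chart_at_domP x.
apply: (curl_pullback _ _ ax ac xx cx); first exact: chart_smooth_id.
exact: smooth1_in_at.
Qed.

Lemma form_in_ext_derivative (w : dform M 1) c x v : atlas M c -> cdom c x ->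
  smooth1_at w x -> form_in (ext_derivative w) c (cfun c x) v =
  curl (form1_in w c) (cfun c x) (v ord0) (v ord_max).
Proof.
move=> ac cx ws; rewrite form_inE// (ext_derivative_chart _ ac)//.
have ax := chart_at_atlasP x; have xx := chart_at_domP x.
by rewrite !dchart_idK.
Qed.

Lemma smooth1_near (w : dform M 1) c x : atlas M c -> cdom c x ->
  smooth1_in w c x -> exists V, [/\ open V, V (cfun c x), V `<=` cfun c @` cdom c,
    forall k, form1_on k V (form1_in w c) &
    forall z, cdom c z -> V (cfun c z) -> smooth1_at w z].
Proof.
move=> ac cx [V [oV Vx Vc Vw]]; exists V; split => // z cz Vz.
by exists c; split => //; exists V.
Qed.

Lemma curl_linearl (U : set E) (a : E -> E -> R) y v : open U -> U y -> form1_on 1 U a ->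
  linear ((fun u => curl a y u v) : E -> R^o).
Proof.
move=> oU Uy fa t u1 u2.
have C w := Ck_differentiable (Ck_partial1 w oU fa.1) Uy.
have e2 z : U z -> t * a z u1 + a z u2 = a z (t *: u1 + u2).
  by move=> Uz; rewrite (functionalD (fa.2 z Uz)) (functionalZ (fa.2 z Uz)).
have d1 : differentiable (fun z => t *: a z u1 : R) y by exact: differentiableZ.
have el : 'd (a^~ v) y (t *: u1 + u2) = t * 'd (a^~ v) y u1 + 'd (a^~ v) y u2.
  exact: linearP.
have er : 'd (a^~ (t *: u1 + u2)) y v = t * 'd (a^~ u1) y v + 'd (a^~ u2) y v.
  apply: etrans (diff_openE v oU Uy e2 (differentiableD d1 (C u2))) _.
  apply: etrans (congr1 (@^~ v) (diffD d1 (C u2))) _.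
  exact: (congr1 (fun p : R => p + 'd (a^~ u2) y v) (congr1 (@^~ v) (diffZ t (C u1)))).
have lin p q r s : t * p + q - (t * r + s) = t * (p - r) + (q - s) :> R by ring.
apply: etrans (curlE _ _ oU Uy fa) _.
apply: etrans (congr2 (fun p q => p - q) el er) _.
apply: etrans (lin _ _ _ _) _.
apply: esym.
exact: (congr2 (fun p q => t * p + q) (curlE _ _ oU Uy fa) (curlE _ _ oU Uy fa)).
Qed.

Lemma curlN (a : E -> E -> R) y u v : curl a y u v = - curl a y v u.
Proof. by rewrite /curl opprB. Qed.

Lemma alternating_curl (U : set E) (a : E -> E -> R) y : open U -> U y ->
  form1_on 1 U a -> alternating (fun v : 'I_2 -> E => curl a y (v ord0) (v ord_max)).
Proof.
move=> oU Uy fa; apply: alternating2.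
- by move=> v; exact: curl_linearl fa.
- move=> u t v1 v2; rewrite curlN (curl_linearl _ oU Uy fa).
  by rewrite (curlN _ _ u v1) (curlN _ _ u v2) scalerN opprD.
- by move=> u; rewrite /curl subrr.
Qed.

Lemma alternating_ext_derivative (w : dform M 1) x : smooth1_at w x ->
  alternating (ext_derivative w x).
Proof.
move=> ws; have ax := chart_at_atlasP x; have xx := chart_at_domP x.
have [V [oV Vx _ Vw]] := smooth1_in_at ax xx ws.
have -> : ext_derivative w x = fun v => curl (form1_in w (chart_at x))
  (cfun (chart_at x) x) (v ord0) (v ord_max).
  by apply/funext => v; rewrite ext_derivative1E.
exact: (alternating_curl oV Vx (Vw 1%N)).
Qed.

Lemma smooth_form_ext_derivative (U : set M) (w : dform M 1) :
  (forall x, U x -> smooth1_at w x) -> smooth_form_on U (ext_derivative w).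
Proof.
move=> ws; split; first by move=> x /ws; exact: alternating_ext_derivative.
move=> c ac v k; apply: Ck_local => _ [x [cx Ux] <-].
have [V [oV Vx Vc Vw Vz]] := smooth1_near ac cx (smooth1_in_at ac cx (ws _ Ux)).
exists V; split => //.
apply: (Ck_eq oV _ (Ck_curl (v ord0) (v ord_max) oV (Vw k.+1))).
move=> y /set_mem /[dup] /Vc [z cz <-] Vzz.
by rewrite form_in_ext_derivative//; exact: Vz.
Qed.

Lemma smooth_form_smooth1 (U : set M) (w : dform M 1) :
  (forall x, U x -> smooth1_at w x) -> smooth_form_on U w.
Proof.
move=> ws; split.
  move=> x /ws ws'.
  have ax := chart_at_atlasP x; have xx := chart_at_domP x.
  have [V [oV Vx _ Vw]] := smooth1_in_at ax xx ws'.
  have -> : w x = fun v => form1_in w (chart_at x) (cfun (chart_at x) x) (v ord0).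
    apply/funext => v; rewrite form_chart_at /form1_in; congr form_in.
    exact: cst1E.
  by apply: alternating1; exact: (Vw 0%N).2.
move=> c ac v k; apply: Ck_local => _ [x [cx Ux] <-].
have [V [oV Vx Vc Vw Vz]] := smooth1_near ac cx (smooth1_in_at ac cx (ws _ Ux)).
exists V; split => //.
apply: (Ck_eq oV _ (Ck_partial1 (v ord0) oV (Vw k).1)).
by move=> y _; rewrite (cst1E v).
Qed.

Lemma ext_derivative2E (w : dform M 2) x v : ext_derivative w x v =
  'D_(v ord0) (fun y => form_in w (chart_at x) y
     (pair2 (v (lift ord0 ord0)) (v ord_max))) (cfun (chart_at x) x) -
  'D_(v (lift ord0 ord0)) (fun y => form_in w (chart_at x) y
     (pair2 (v ord0) (v ord_max))) (cfun (chart_at x) x) +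
  'D_(v ord_max) (fun y => form_in w (chart_at x) y
     (pair2 (v ord0) (v (lift ord0 ord0)))) (cfun (chart_at x) x).
Proof.
have e2 : lift ord0 (lift ord0 ord0) = ord_max :> 'I_3 by apply: val_inj.
have e (i j k : 'I_3) : nat_of_ord (lift i (ord0 : 'I_2)) = j ->
    nat_of_ord (lift i (ord_max : 'I_2)) = k ->
    (fun y => form_in w (chart_at x) y (fun l => v (lift i l))) =
    (fun y => form_in w (chart_at x) y (pair2 (v j) (v k))).
  move=> ij ik; apply/funext => y; congr (form_in _ _ _ _).
  by apply/funext => l; have [->|->] := ord2P l; congr (v _); apply: val_inj.
rewrite /ext_derivative 3!big_ord_recl big_ord0 addr0 e2.
rewrite (e ord0 (lift ord0 ord0) ord_max) // (e (lift ord0 ord0) ord0 ord_max) //.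
rewrite (e ord_max ord0 (lift ord0 ord0)) //.
by rewrite expr0 mul1r expr1 mulN1r sqrrN expr1n mul1r addrA.
Qed.

(** The inner derivative must be known near x, and in the fixed chart of x, whereas it is defined at
    each point in the chart of that point; chart independence turns it into a curl in the fixed
    chart. *)
Lemma ext_derivative_closed (w : dform M 1) x v : (forall z, smooth1_at w z) ->
  ext_derivative (ext_derivative w) x v = 0.
Proof.
move=> ws; have ax := chart_at_atlasP x; have xx := chart_at_domP x.
have [V [oV Vx Vc Vw]] := smooth1_in_at ax xx (ws x).
have H u t s : 'D_u (fun y => form_in (ext_derivative w) (chart_at x) y (pair2 t s))
      (cfun (chart_at x) x) =
   'D_u (fun y => curl (form1_in w (chart_at x)) y t s) (cfun (chart_at x) x).
  apply: (derive_openE u oV Vx).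
    by move=> y /Vc [z cz <-]; rewrite form_in_ext_derivative.
  exact: (Ck_differentiable (Ck_curl _ _ oV (Vw 2%N)) Vx).
rewrite ext_derivative2E !H.
exact: (curl_closed _ _ _ oV Vx (Vw 2%N)).
Qed.

End Derivative.

Section Naturality.
Context E F (M : manifold E) (N : manifold F).

Lemma smooth1_at_pullback (w : dform N 1) (f : M -> N) x : smooth_map f ->
  smooth1_at w (f x) -> smooth1_at (pullback f w) x.
Proof.
move=> sf ws; have ax := chart_at_atlasP x; have xx := chart_at_domP x.
have ay := chart_at_atlasP (f x); have yy := chart_at_domP (f x).
exists (chart_at x); split => //.
apply: (smooth1_in_pullback ax ay xx yy); last exact: smooth1_in_at.
exact: smooth_map_chart.
Qed.

Lemma ext_derivative_pullback_on (A : set M) (w : dform N 1) (f : M -> N) x v :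
  open A -> smooth_map_on A f -> A x -> smooth1_at w (f x) ->
  ext_derivative (pullback f w) x v = pullback f (ext_derivative w) x v.
Proof.
move=> oA sf Ax ws; have ax := chart_at_atlasP x; have xx := chart_at_domP x.
have ay := chart_at_atlasP (f x); have yy := chart_at_domP (f x).
rewrite /pullback !ext_derivative1E.
apply: (curl_pullback _ _ ax ay xx yy); last exact: smooth1_in_at.
exact: smooth_map_on_at sf Ax.
Qed.

Lemma smooth1_at_pullback_on (A : set M) (w : dform N 1) (f : M -> N) x :
  open A -> smooth_map_on A f -> A x ->
  smooth1_at w (f x) -> smooth1_at (pullback f w) x.
Proof.
move=> oA sf Ax ws; have ax := chart_at_atlasP x; have xx := chart_at_domP x.
have ay := chart_at_atlasP (f x); have yy := chart_at_domP (f x).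
exists (chart_at x); split => //.
apply: (smooth1_in_pullback ax ay xx yy); last exact: smooth1_in_at.
exact: smooth_map_on_at sf Ax.
Qed.

End Naturality.

(** Smoothness at x and the exterior derivative at x involve only the germ of the form, so an
    equality over a neighbourhood suffices. *)
Lemma smooth1_at_eq E (M : manifold E) (A : set M) (w w' : dform M 1) x :
  open A -> A x -> (forall z v, A z -> w z v = w' z v) -> smooth1_at w x ->
  smooth1_at w' x /\ forall v, ext_derivative w x v = ext_derivative w' x v.
Proof.
move=> oA Ax ww ws; have ax := chart_at_atlasP x; have xx := chart_at_domP x.
have [V [oV Vx Vc Vw]] := smooth1_in_at ax xx ws.
have oVA : open (V `&` cfun (chart_at x) @` (cdom (chart_at x) `&` A)).
  by apply: openI => //; exact: chart_imgI_open.
have VAx : (V `&` cfun (chart_at x) @` (cdom (chart_at x) `&` A)) (cfun (chart_at x) x).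
  by split => //; exists x.
have e y v : (V `&` cfun (chart_at x) @` (cdom (chart_at x) `&` A)) y ->
    form1_in w (chart_at x) y v = form1_in w' (chart_at x) y v.
  by move=> [_ [z [cz Az] <-]]; rewrite /form1_in !form_inE//; exact: ww.
have fw k : form1_on k (V `&` cfun (chart_at x) @` (cdom (chart_at x) `&` A))
  (form1_in w (chart_at x)) by apply: form1_onW (Vw k) => // y [].
split; last first.
  by move=> v; rewrite !ext_derivative1E; apply: (curl_eq _ _ oVA VAx (fw 1%N)).
exists (chart_at x); split => //.
exists (V `&` cfun (chart_at x) @` (cdom (chart_at x) `&` A)); split => //.
  by move=> y [/Vc].
move=> k; have [C1 C2] := fw k; split.
  apply: Ck_eq C1; first exact: open_setXT.
  by move=> [y v] /set_mem [/= Vy _]; exact: e.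
by move=> y Vy t u v; rewrite -!e//; exact: C2.
Qed.

(** Passes from smoothness for each fixed vector, as in [smooth_form_on], to joint smoothness by
    [Ck_row_linear]; hence the finite-dimensional model space. *)
Lemma smooth_form_smooth1_at m (M : manifold 'rV[R]_m) (U : set M)
  (w : dform M 1) x : open U -> U x -> smooth_form_on U w -> smooth1_at w x.
Proof.
move=> oU Ux [aw sw]; have ax := chart_at_atlasP x; have xx := chart_at_domP x.
exists (chart_at x); split => //.
have [oV Vx Vc VU] := chart_nbhs oU Ux xx.
exists (cfun (chart_at x) @` (cdom (chart_at x) `&` U)); split => // k.
have lin y : (cfun (chart_at x) @` (cdom (chart_at x) `&` U)) y ->
  linear (form1_in w (chart_at x) y : _ -> R^o).
  move=> [z [cz Uz] <-] t u v; rewrite /form1_in !form_inE//.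
  by rewrite dchart_linear; exact: (alternating1P (aw _ Uz)).
split => //; apply: Ck_row_linear => // v.
exact: sw.
Qed.

End ChartForms.

(** * Cotangent bundle *)

Section ProductCharts.
Context {R : realType}.
Implicit Types E F G : normedModType R.

Lemma real_lineP (c : chart R (@real_line R)) : atlas real_line c ->
  [/\ cdom c = setT, cfun c = id & cinv c = id].
Proof. by move=> ->. Qed.

Lemma diff_fstE E F (z v : E * F) : 'd (fst : E * F -> E) z v = v.1.
Proof.
apply: etrans (diff_linE (f := (fst : E * F -> E)) _ _ _) _ => //.
by move=> ?; exact: cvg_fst.
Qed.

Section Pairing.
Context E F (M : manifold E) (N : manifold F).

Lemma prod_chart_atlas (c : chart E M) (d : chart F N) : atlas M c -> atlas N d ->
  atlas (prod_manifold M N) (prod_chart c d).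
Proof. by move=> ac ad; exists (c, d). Qed.

Lemma chart_smooth_fst (c : chart E M) (d : chart F N) (z : prod_manifold M N) :
  cdom c z.1 -> cdom d z.2 -> chart_smooth (M := prod_manifold M N)
    (prod_chart c d) c (fun z => z.1) z /\
  forall v : E * F, dchart (M := prod_manifold M N) (prod_chart c d) c
    (fun z => z.1) z v = v.1.
Proof.
move=> cz dz.
have oV := @cimg_open _ _ _ (prod_chart c d).
have Vz : (cfun (prod_chart c d) @` cdom (prod_chart c d)) (cfun (prod_chart c d) z).
  by exists z.
have e y : (cfun (prod_chart c d) @` cdom (prod_chart c d)) y ->
    y.1 = (cfun c \o (fun z : prod_manifold M N => z.1) \o cinv (prod_chart c d)) y.
  by move=> [[a b] [/= ca db] <-] /=; rewrite cfunKE.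
split.
  exists (cfun (prod_chart c d) @` cdom (prod_chart c d)); split => //.
    by move=> _ [[a b] [/= ca db] <-]; rewrite /= cfunKE.
  move=> k; apply: Ck_eq (Ck_fst k oV) => // y /set_mem; exact: e.
move=> v; apply: etrans (diff_openE (f := fst) v oV Vz e _) _.
  exact: (Ck_differentiable (Ck_fst 1 oV) Vz).
exact: diff_fstE.
Qed.

End Pairing.

Lemma chart_smooth_pair E F G (M : manifold E) (N : manifold F) (P : manifold G)
    (e : chart G P) (c : chart E M) (d : chart F N) (f : P -> M) (g : P -> N) x :
  chart_smooth e c f x -> chart_smooth e d g x ->
  chart_smooth (N := prod_manifold M N) e (prod_chart c d)
    (fun z => (f z, g z)) x /\
  forall v, dchart (N := prod_manifold M N) e (prod_chart c d)
    (fun z => (f z, g z)) x v = (dchart e c f x v, dchart e d g x v).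
Proof.
move=> fs gs; split.
  move: fs gs => [V [oV Vx Vc Vd sV]] [W [oW Wx Wc Wd sW]].
  have oVW := openI oV oW.
  exists (V `&` W); split => //; first by move=> y [/Vc].
    by move=> y [/Vd ? /Wd ?].
  move=> k; apply: (Ck_pair oVW); first by apply: (CkW _ (sV k)) => y [].
  by apply: (CkW _ (sW k)) => y [].
move=> v; apply: diff_pairE; exact: chart_smooth_differentiable.
Qed.

Lemma chart_smooth_cst E F (M : manifold E) (N : manifold F) (c : chart E M)
    (d : chart F N) (y : N) x : cdom c x -> cdom d y ->
  chart_smooth c d (fun=> y) x /\ forall v, dchart c d (fun=> y) x v = 0.
Proof.
move=> cx dy; split; last by move=> v; exact: diff_cstE.
exists (cfun c @` cdom c); split => //; first exact: cimg_open.
by move=> k; exact: (Ck_cst k (cfun d y) (cimg_open c)).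
Qed.

End ProductCharts.

Section CotangentCharts.
Context {R : realType} {m : nat} (M : manifold 'rV[R]_m).
Implicit Types (c : chart 'rV[R]_m M) (xi : cotangent M).

Definition cochart c (ac : atlas M c) : chart ('rV[R]_m * 'cV[R]_m)%type (cotangent M) :=
  gchart (G := cotangent_gluing M) (exist _ c ac).

Definition cocoord c xi : 'cV[R]_m :=
  transition_jacobian c (chart_at (cbase xi)) (cbase xi) *m cvec xi.

Lemma cochart_atlas c (ac : atlas M c) : atlas (cotangent M) (cochart ac).
Proof. by exists (exist _ c ac). Qed.

Lemma cochart_dom c (ac : atlas M c) xi : cdom (cochart ac) xi = cdom c (cbase xi).
Proof. by []. Qed.

Lemma cochart_fun c (ac : atlas M c) xi :
  cfun (cochart ac) xi = (cfun c (cbase xi), cocoord c xi).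
Proof. by []. Qed.

Lemma cochart_img c (ac : atlas M c) :
  cfun (cochart ac) @` cdom (cochart ac) = cfun c @` cdom c `*` setT.
Proof.
apply/seteqP; split => [_ [xi cx <-]|[y q] [/= [x cx <-] _]].
  by split => //=; exists (cbase xi).
exists ((x, transition_jacobian (chart_at x) c x *m q) : cotangent M) => //.
apply: etrans (cochart_fun ac _) _.
rewrite /cocoord /= mulmxA transition_jacobianM
  ?transition_jacobian_id ?mul1mx//; by [exact: chart_at_domP|exact: chart_at_atlasP].
Qed.

Lemma ceval_cocoord c xi (v : 'rV[R]_m) :
  (v *m cocoord c xi) 0 0 = ceval xi (dchart c (chart_at (cbase xi)) id (cbase xi) v).
Proof.
rewrite /ceval /cocoord mulmxA; congr ((_ *m _) 0 0).
exact: mul_transition_jacobian.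
Qed.

Lemma ceval_chart c xi (v : 'rV[R]_m) : atlas M c -> cdom c (cbase xi) ->
  ceval xi v = (dchart (chart_at (cbase xi)) c id (cbase xi) v *m cocoord c xi) 0 0.
Proof.
move=> ac cx; rewrite ceval_cocoord dchart_idK//;
  by [exact: chart_at_domP|exact: chart_at_atlasP].
Qed.

Lemma cocoord_scale c s xi : cocoord c (cscale s xi) = s *: cocoord c xi.
Proof. by rewrite /cocoord /cscale /= scalemxAr. Qed.

Lemma cbase_chart_smooth c (ac : atlas M c) xi : cdom c (cbase xi) ->
  chart_smooth (cochart ac) c (@cbase _ _ M) xi /\
  forall v, dchart (cochart ac) c (@cbase _ _ M) xi v = v.1.
Proof.
move=> cx; have oV := cimg_open (cochart ac).
have Vx : (cfun (cochart ac) @` cdom (cochart ac)) (cfun (cochart ac) xi) by exists xi.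
have e y : (cfun (cochart ac) @` cdom (cochart ac)) y ->
    y.1 = (cfun c \o @cbase _ _ M \o cinv (cochart ac)) y.
  by move=> [z cz <-] /=; rewrite cfunKE.
split.
  exists (cfun (cochart ac) @` cdom (cochart ac)); split => //.
    by move=> _ [z cz <-]; rewrite cfunKE.
  by move=> k; apply: Ck_eq (Ck_fst k oV) => // y /set_mem; exact: e.
move=> v; apply: etrans (diff_openE (f := fst) v oV Vx e _) _.
  exact: (Ck_differentiable (Ck_fst 1 oV) Vx).
exact: diff_fstE.
Qed.

Lemma cbase_smooth : smooth_map (@cbase _ _ M).
Proof.
apply: chart_smooth_map_on; first exact: openT.
move=> xi _; have ax := chart_at_atlasP (cbase xi).
have xx := chart_at_domP (cbase xi).
exists (cochart ax), (chart_at (cbase xi)); split => //; first exact: cochart_atlas.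
by have [] := cbase_chart_smooth ax xx.
Qed.

(** The tautological property: by the chain rule the value involves f only through the covector
    [f x] and the differential of the base map. *)
Lemma pullback_liouville E (N : manifold E) (A : set N) (f : N -> cotangent M) x v :
  open A -> smooth_map_on A f -> A x ->
  pullback f (@liouville_form _ _ M) x v =
  ceval (f x) (tangent_map (@cbase _ _ M \o f) x (v ord0)).
Proof.
move=> oA sf Ax; rewrite /pullback /liouville_form.
congr (ceval (f x) _); symmetry.
exact: (tangent_map_comp _ oA (@openT _) sf cbase_smooth).
Qed.

Lemma liouville_chart c (ac : atlas M c) y v : (cfun c @` cdom c) y.1 ->
  form1_in (@liouville_form _ _ M) (cochart ac) y v = (v.1 *m y.2) 0 0.
Proof.
move=> cy; have : (cfun (cochart ac) @` cdom (cochart ac)) y.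
  by rewrite cochart_img.
move=> [xi cx <-]; rewrite /form1_in form_inE// /liouville_form cochart_fun/=.
rewrite ceval_cocoord; congr (ceval xi _).
have [sb db] := cbase_chart_smooth ac cx.
have /= := dchart_tangent v (cochart_atlas ac) ac cx cx sb.
rewrite db => e.
have ax := chart_at_atlasP (cbase xi); have xx := chart_at_domP (cbase xi).
by rewrite e dchart_idK.
Qed.

Lemma Ck_pairing k (U : set ('rV[R]_m * 'cV[R]_m)) (f : 'rV[R]_m * 'cV[R]_m -> 'rV[R]_m)
   (g : 'rV[R]_m * 'cV[R]_m -> 'cV[R]_m) : open U -> Ck k U f -> Ck k U g ->
  Ck k U (fun y => (f y *m g y) 0 0).
Proof. by move=> oU Cf Cg; apply: Ck_coord => //; exact: Ck_mulmx. Qed.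

Lemma liouville_smooth1_in c (ac : atlas M c) xi : cdom c (cbase xi) ->
  smooth1_in (@liouville_form _ _ M) (cochart ac) xi.
Proof.
move=> cx; exists (cfun (cochart ac) @` cdom (cochart ac)).
have oV := cimg_open (cochart ac).
split => //.
move=> k; split; last first.
  move=> y; rewrite cochart_img => -[cy _] t u v.
  by rewrite !liouville_chart// mulmxDl -scalemxAl !mxE.
have oVT := @open_setXT _ ('rV[R]_m * 'cV[R]_m)%type _ oV.
set W := _ `*` _ in oVT *.
have C1 : Ck k W (fun p : ('rV[R]_m * 'cV[R]_m) * ('rV[R]_m * 'cV[R]_m) => p.2.1).
  have sub : W `<=` (fun p => p.2) @^-1` setT by [].
  exact: (Ck_comp oVT (@openT _) sub (Ck_snd k oVT) (Ck_fst k (@openT _))).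
have C2 : Ck k W (fun p : ('rV[R]_m * 'cV[R]_m) * ('rV[R]_m * 'cV[R]_m) => p.1.2).
  have sub : W `<=` (fun p => p.1) @^-1` setT by [].
  exact: (Ck_comp oVT (@openT _) sub (Ck_fst k oVT) (Ck_snd k (@openT _))).
apply: Ck_eq (Ck_coord 0 0 oVT (Ck_mulmx oVT C1 C2)) => //.
move=> [y v] /set_mem [Wy _].
have : (cfun (cochart ac) @` cdom (cochart ac)) y := Wy.
rewrite cochart_img => -[cy _].
by rewrite liouville_chart.
Qed.

Lemma liouville_smooth1 xi : smooth1_at (@liouville_form _ _ M) xi.
Proof.
have ax := chart_at_atlasP (cbase xi); have xx := chart_at_domP (cbase xi).
exists (cochart ax); split => //; first exact: cochart_atlas.
exact: liouville_smooth1_in.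
Qed.

(** In the coordinates (x, q) the tautological form is q dx. On a fixed vector it is linear in the
    coordinates, hence its own derivative, and antisymmetrizing gives dq wedge dx. *)
Lemma curl_liouville c (ac : atlas M c) xi u v : cdom c (cbase xi) ->
  curl (form1_in (@liouville_form _ _ M) (cochart ac)) (cfun (cochart ac) xi) u v =
  (v.1 *m u.2) 0 0 - (u.1 *m v.2) 0 0.
Proof.
move=> cx; rewrite /curl.
have oV := cimg_open (cochart ac).
have Vx : (cfun (cochart ac) @` cdom (cochart ac)) (cfun (cochart ac) xi) by exists xi.
have H w z : 'D_w ((form1_in (@liouville_form _ _ M) (cochart ac)) ^~ z)
    (cfun (cochart ac) xi) = (z.1 *m w.2) 0 0.
  pose l (y : 'rV[R]_m * 'cV[R]_m) : R := (z.1 *m y.2) 0 0.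
  have ll : linear (l : _ -> R^o).
    by move=> t a b; rewrite /l /= mulmxDr -scalemxAr !mxE.
  have cl : continuous l.
    move=> y; have oT := @openT ('rV[R]_m * 'cV[R]_m)%type.
    exact: (Ck_pairing oT (Ck_cst 0 z.1 oT) (Ck_snd 0 oT) y I).
  have dl := differentiable_linear (cfun (cochart ac) xi) ll cl.
  apply: etrans (derive_openE w oV Vx (f := l) _ dl) _.
    by move=> y; rewrite cochart_img => -[cy _]; rewrite liouville_chart.
  apply: etrans (deriveE w dl) _.
  exact: (diff_linearE _ _ ll cl).
by rewrite !H.
Qed.

Lemma canonical_chart c (ac : atlas M c) xi u v : cdom c (cbase xi) ->
  let T := dchart (chart_at xi) (cochart ac) id xi in
  canonical_symplectic_form M xi (pair2 u v) =
  ((T v).1 *m (T u).2) 0 0 - ((T u).1 *m (T v).2) 0 0.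
Proof.
move=> cx T; rewrite /canonical_symplectic_form.
rewrite (ext_derivative_chart _ (cochart_atlas ac))//; last exact: liouville_smooth1.
by rewrite curl_liouville.
Qed.

End CotangentCharts.

(** * Linear algebra of contact forms *)

Section ExteriorPowers.
Context {R : realType} {E : lmodType R}.

Definition multilinear k (a : ('I_k -> E) -> R) :=
  forall v i, linear ((fun u => a [eta v with i |-> u]) : E -> R^o).

Lemma eta_with_comp k l (v : 'I_k -> E) (s : 'I_l -> 'I_k) i u : injective s ->
  (fun j => [eta v with s i |-> u] (s j)) = [eta (v \o s) with i |-> u].
Proof. by move=> si; apply/funext => j /=; rewrite (inj_eq si). Qed.

Lemma eta_with_out k l (v : 'I_k -> E) (s : 'I_l -> 'I_k) i u :
  (forall j, s j != i) -> (fun j => [eta v with i |-> u] (s j)) = v \o s.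
Proof. by move=> si; apply/funext => j /=; rewrite (negbTE (si j)). Qed.

(** In the term of a permutation s the i-th argument occurs in exactly one factor, decided by the
    block that contains the preimage of i under s. *)
Lemma multilinear_ext_prod k l (a : ('I_k -> E) -> R) (b : ('I_l -> E) -> R) :
  multilinear a -> multilinear b -> multilinear (ext_prod a b).
Proof.
move=> la lb v i t u w; rewrite /ext_prod.
have scE (x : R^o) : t *: x = t * (x : R) by [].
rewrite scE [t * _]mulrCA -mulrDr; congr (_ * _).
rewrite mulr_sumr -big_split; apply: eq_bigr => s _ /=.
rewrite [t * _]mulrCA -mulrDr; congr (_ * _).
have il : injective (fun j : 'I_k => s (lshift l j)).
  by move=> x y /perm_inj /lshift_inj.
have ir : injective (fun j : 'I_l => s (rshift k j)).
  by move=> x y /perm_inj /rshift_inj.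
have [j e|j e] := split_ordP ((s^-1)%g i).
  have {}e : i = s (lshift l j) by rewrite -e permKV.
  have no x : s (rshift k x) != i by rewrite e (inj_eq perm_inj) eq_rlshift.
  rewrite !(eta_with_out _ _ no) e !(eta_with_comp _ _ _ il).
  by rewrite la mulrDl scE -mulrA.
have {}e : i = s (rshift k j) by rewrite -e permKV.
have no x : s (lshift l x) != i by rewrite e (inj_eq perm_inj) eq_lrshift.
rewrite !(eta_with_out _ _ no) e !(eta_with_comp _ _ _ ir).
by rewrite lb mulrDr scE mulrCA.
Qed.

Lemma multilinear_ext_pow k (a : ('I_k -> E) -> R) n :
  multilinear a -> multilinear (ext_pow a n).
Proof.
move=> la; elim: n => [|n IH]; last exact: multilinear_ext_prod.
by move=> v [].
Qed.

Lemma ext_prod_perm k l (a : ('I_k -> E) -> R) (b : ('I_l -> E) -> R) v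
  (s : 'S_(k + l)) : ext_prod a b (v \o s) = (-1) ^+ s * ext_prod a b v.
Proof.
rewrite /ext_prod mulrCA; congr (_ * _); rewrite mulr_sumr.
rewrite [RHS](reindex_inj (mulIg s)); apply: eq_bigr => t _.
rewrite odd_permM signr_addb [(-1) ^+ t * (-1) ^+ s]mulrC !mulrA -expr2 sqrr_sign mul1r.
rewrite -!mulrA.
congr (_ * (a _ * b _)); by apply/funext => i; rewrite permM.
Qed.

(** Exchanging the two equal arguments changes the sign and nothing else, and a real number equal to
    its opposite is zero. *)
Lemma ext_prod_eq0 k l (a : ('I_k -> E) -> R) (b : ('I_l -> E) -> R) v i j :
  i != j -> v i = v j -> ext_prod a b v = 0.
Proof.
move=> ij e; have := ext_prod_perm a b v (tperm i j).
have -> : v \o tperm i j = v.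
  by apply/funext => x /=; case: tpermP => [->|->|].
rewrite odd_tperm ij expr1 mulN1r => /eqP; rewrite -addr_eq0 -mulr2n.
by rewrite mulrn_eq0 => /eqP.
Qed.

Lemma ext_pow_perm (a : ('I_2 -> E) -> R) n v (s : 'S_(n * 2)) :
  ext_pow a n (v \o s) = (-1) ^+ s * ext_pow a n v.
Proof.
case: n v s => [|n] v s; last exact: ext_prod_perm.
by rewrite (_ : s = 1%g) ?odd_perm1 ?mul1r//; apply/permP => -[].
Qed.

Lemma multilinear_eq0 k p (a : ('I_k -> E) -> R) (e : 'I_p -> E) :
  multilinear a -> (forall u, exists c, u = \sum_j c j *: e j) ->
  (forall f : 'I_k -> 'I_p, a (e \o f) = 0) -> forall v, a v = 0.
Proof.
move=> la span a0.
(* n counts the leading arguments that have not yet been replaced by members of the family e. *)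
suff H n : (n <= k)%N -> forall v, (forall i : 'I_k, (n <= i)%N -> exists j, v i = e j) ->
    a v = 0.
  by move=> v; apply: (H k) => // i; rewrite leqNgt ltn_ord.
elim: n => [|n IH] nk v ve.
  have /choice [f fe] : forall i, exists j, v i = e j by move=> i; exact: ve.
  by rewrite (_ : v = e \o f) ?a0//; apply/funext.
pose i0 := Ordinal nk; have [c vc] := span (v i0).
have -> : v = [eta v with i0 |-> v i0].
  by apply/funext => i /=; case: eqP => [->|].
rewrite vc (functional_sum (la v i0)) big1// => j _.
rewrite (functionalZ (la v i0)) IH ?mulr0//; first exact: ltnW.
move=> i ni /=; case: eqP => [_|ii0]; first by exists j.
by apply: ve; rewrite ltn_neqAle ni andbT eq_sym; apply/eqP => e'; apply: ii0; apply: val_inj.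
Qed.

(** Provides the smaller permutations along which terms of an exterior product are compared with
    terms of a lower power. *)
Lemma lift_permP n (s : 'S_n.+1) : s ord0 = ord0 ->
  exists t : 'S_n, s = lift_perm ord0 ord0 t.
Proof.
move=> s0; pose g (k : 'I_n) := odflt k (unlift ord0 (s (lift ord0 k))).
have gE k : lift ord0 (g k) = s (lift ord0 k).
  rewrite /g; case: unliftP => [j ->//|e].
  by have := neq_lift ord0 k; rewrite -(inj_eq (@perm_inj _ s)) s0 e eqxx.
have gi : injective g.
  by move=> x y /(congr1 (lift ord0)); rewrite !gE => /perm_inj /lift_inj.
exists (perm gi); apply/permP => i.
have [j ->|->] := unliftP ord0 i; last by rewrite s0 lift_perm_id.
by rewrite lift_perm_lift permE gE.
Qed.

End ExteriorPowers.

(** * The top-degree form and nondegeneracy on the kernel of a covector *)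

Section ContactLinearAlgebra.
Context {R : realType} {m : nat}.
Local Notation V := 'rV[R]_m.

Lemma alternating_multilinear k (a : ('I_k -> V) -> R) :
  alternating a -> multilinear a.
Proof. by move=> [la _] v i t u w; exact: la. Qed.

(** In every term of the sum u is an argument either of the first factor b or of the remaining
    power: the first case is the hypothesis on u, the second the induction. *)
Lemma ext_pow_null (b : ('I_2 -> V) -> R) (K : set V) (u : V) n v :
  alternating b -> K u -> (forall w, K w -> b (pair2 u w) = 0) ->
  (forall i, K (v i)) -> (exists i, v i = u) -> ext_pow b n v = 0.
Proof.
move=> ab Ku u0; have u0' w : K w -> b (pair2 w u) = 0.
  by move=> Kw; rewrite alternating2N// u0// oppr0.
elim: n v => [|n IH] v Kv [p pu]; first by case: p pu.
rewrite /= /ext_prod big1 ?mulr0// => s _.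
have [j e|j e] := split_ordP ((s^-1)%g p).
  have {}e : p = s (lshift (n * 2) j) by rewrite -e permKV.
  rewrite (pair2E (fun i => v (s (lshift (n * 2) i)))).
  have [jj|jj] := ord2P j; rewrite jj in e; rewrite -e pu.
    by rewrite u0// mul0r mulr0.
  by rewrite u0'// mul0r mulr0.
have {}e : p = s (rshift 2 j) by rewrite -e permKV.
rewrite (IH (fun i => v (s (rshift 2 i)))) ?mulr0//.
by exists j; rewrite -e.
Qed.

Definition functional (l : V -> R) (ll : linear (l : V -> R^o)) : 'Hom(V, R^o) :=
  linfun (HB.pack_for {linear V -> R^o} l (GRing.isLinear.Build _ _ _ _ _ ll)).

Lemma functionalE l (ll : linear (l : V -> R^o)) v : functional ll v = l v.
Proof. by rewrite lfunE. Qed.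

Lemma dim_kernel (W : {vspace V}) l (ll : linear (l : V -> R^o)) :
  (\dim W <= (\dim (W :&: lker (functional ll))).+1)%N.
Proof.
rewrite -(limg_ker_dim (functional ll) W) -[X in (_ <= X)%N]addn1 leq_add2l.
by rewrite (leq_trans (dimvS (subvf _)))// dimvf.
Qed.

Lemma mem_kernel (W : {vspace V}) l (ll : linear (l : V -> R^o)) v :
  (v \in (W :&: lker (functional ll))%VS) = (v \in W) && (l v == 0).
Proof. by rewrite memv_cap memv_ker functionalE. Qed.


Lemma dim_kernel_nonzero l (ll : linear (l : V -> R^o)) z : l z != 0 ->
  (\dim (fullv :&: lker (functional ll))).+1 = m.
Proof.
move=> lz; have full : \dim (fullv : {vspace V}) = m.
  by rewrite dimvf; exact: etrans (dim_matrix _ _ _) (mul1n m).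
have := dim_kernel fullv ll; rewrite full => dK.
apply/eqP; rewrite eqn_leq dK andbT -[X in (_ <= X)%N]full ltnNge.
apply/negP => dKm.
have /eqP KT : (fullv :&: lker (functional ll))%VS == fullv by rewrite eqEdim subvf.
by case/negP: lz; have := memvf z; rewrite -KT mem_kernel => /andP[].
Qed.

(* On a basis z, u, .. whose vectors other than z lie in ker a, every term of the
   top-degree form contains a(w) with w in ker a or b(u, w) with w in ker a. *)
Lemma contact_nondegenerate (a : ('I_1 -> V) -> R) (b : ('I_2 -> V) -> R) n u :
  alternating a -> alternating b -> m = (n * 2).+1 ->
  (exists v, ext_prod a (ext_pow b n) v != 0) ->
  a (fun=> u) = 0 ->
  (forall w, a (fun=> w) = 0 -> b (pair2 u w) = 0) -> u = 0.
Proof.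
move=> aa ab mn [v vn0] au bu; apply/eqP; apply: contraNT vn0 => u0; apply/eqP.
have la := alternating1P aa; pose l w := a (fun=> w).
have [az|/existsNP [z az]] := pselect (forall z, l z = 0).
  rewrite /ext_prod big1 ?mulr0// => s _.
  by rewrite (cst1E (fun i => v (s (lshift _ i)))) -/(l _) az mul0r mulr0.
pose K := (fullv :&: lker (functional la))%VS.
have KE w : (w \in K) = (l w == 0) by rewrite mem_kernel memvf.
have uK : u \in K by rewrite KE; apply/eqP.
have dK : \dim K = (n * 2)%N.
  by apply: succn_inj; rewrite (dim_kernel_nonzero la (introN eqP az)).
(* W complements the line of u inside the kernel K of a, so that z, u and a basis of W span the
   whole space and only z lies off K. *)
pose W := (K :\: <[u]>)%VS.
have dW : (\dim W).+2 = m.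
  have := dimv_cap_compl K <[u]>; rewrite (capv_idPr _) -?memvE// dim_vline u0 dK -/W.
  by lia.
pose X := z :: u :: (vbasis W : seq V).
have sX : size X = (1 + n * 2)%N by rewrite /= size_tuple dW mn; lia.
pose e (i : 'I_(1 + n * 2)) := X`_i.
have XK i : (0 < i)%N -> l X`_i = 0.
  case: i => [//|[|i]] _; first exact: au.
  rewrite /=.
  have [iW|iW] := ltnP i (size (vbasis W)); last first.
    by rewrite nth_default// /l (functional0 la).
  apply/eqP; rewrite -KE; have := vbasis_mem (mem_nth 0 iW).
  by apply/subvP; exact: diffvSl.
apply: (multilinear_eq0 (e := e)).
- by apply: multilinear_ext_prod; [|apply: multilinear_ext_pow];
    exact: alternating_multilinear.
- move=> w; have : w \in <<X>>%VS.
    rewrite !span_cons (span_basis (vbasisP W)).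
    have -> : w = (l w / l z) *: z + (w - (l w / l z) *: z) by rewrite addrC subrK.
    apply: memv_add; first by rewrite memvZ// memv_line.
    suff : w - (l w / l z) *: z \in K.
      by apply/subvP; rewrite addvC -(addv_diff_cap K <[u]>) addvS// capvSr.
    rewrite KE /l (functionalD la) (functionalN la) (functionalZ la) -!/(l _).
    by rewrite divfK ?subrr//; apply/eqP.
  have -> : <<X>>%VS = <<in_tuple X>>%VS by [].
  move=> /coord_span ->.
  exists (fun j => coord (in_tuple X) (cast_ord (esym sX) j) w).
  rewrite (reindex (cast_ord (esym sX))) //=.
  by exists (cast_ord sX) => i _; rewrite ?cast_ordK ?cast_ordKV.
move=> f; have [fi|] := boolP (injectiveb f); last first.
  move=> /injectivePn [i [j ij fij]].
  by apply: (ext_prod_eq0 _ _ ij); rewrite /= fij.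
move/injectiveP in fi.
rewrite /ext_prod big1 ?mulr0// => s _.
rewrite (cst1E (fun i => (e \o f) (s (lshift _ i)))) -/(l _) /=.
(* Index 0 carries z; a term whose factor a receives any other member of the family vanishes. *)
have [j0|jn0] := posnP (f (s (lshift (n * 2) ord0))); last by rewrite XK// mul0r mulr0.
have nz i : (0 < f (s (rshift 1 i)))%N.
  rewrite lt0n; apply/eqP => fi0.
  have : f (s (lshift (n * 2) ord0)) = f (s (rshift 1 i)) by apply: val_inj; rewrite /= fi0.
  by move=> /fi /perm_inj /eqP; rewrite eq_lrshift.
rewrite (ext_pow_null (K := [set w | l w = 0]) (u := u)) ?mulr0//.
  by move=> i; exact: XK.
(* Index 1 carries u. As f is bijective, u occurs among the arguments, and not in the slot of a,
   which holds z. *)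
have n0 : (1 < 1 + n * 2)%N by lia.
have [g fg gf] := injF_bij fi.
pose p := g (Ordinal n0).
have fp : f p = Ordinal n0 := gf _.
have [j e'|j e'] := split_ordP ((s^-1)%g p).
  have {}e' : p = s (lshift (n * 2) ord0) by rewrite -[ord0](ord1 j) -e' permKV.
  by move: j0; rewrite -e' fp.
by exists j; rewrite /= -e' permKV fp.
Qed.

(** The matrix of the standard symplectic form in a basis ordered e_0, f_0, e_1, f_1, ..., with e_k
    at place 2k and f_k at place 2k + 1. *)
Definition symplectic_entry (i j : nat) : R :=
  if ~~ odd i && (j == i.+1) then 1 else
  if ~~ odd j && (i == j.+1) then -1 else 0.

Definition symplectic_family (b : ('I_2 -> V) -> R) n (w : 'I_(n * 2) -> V) :=
  forall i j, b (pair2 (w i) (w j)) = symplectic_entry i j.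

(** Symplectic Gram-Schmidt: e and f with b(e, f) = 1 are split off, and the induction continues in
    their orthogonal W2, which loses at most two dimensions and stays nondegenerate. An inequality
    of dimensions is enough and avoids computing them exactly. *)
Lemma symplectic_family_exists (b : ('I_2 -> V) -> R) n (W : {vspace V}) :
  alternating b -> (n * 2 <= \dim W)%N ->
  (forall u, u \in W -> (forall w, w \in W -> b (pair2 u w) = 0) -> u = 0) ->
  exists w, symplectic_family b (n := n) w /\ forall i, w i \in W.
Proof.
move=> ab; have [bl br b0] := alternating2P ab.
elim: n W => [|n IH] W dW nd; first by exists (fun=> 0); split => -[].
pose e := vpick W.
have e0 : e != 0 by rewrite vpick0 -dimv_eq0 -lt0n (leq_trans _ dW).
have eW : e \in W := memv_pick W.
have [f fW ef] : exists2 f, f \in W & b (pair2 e f) = 1.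
  apply: contrapT => H; case/eqP: e0; apply: nd => // w wW.
  apply: contrapT => /eqP ew; apply: H; exists ((b (pair2 e w))^-1 *: w).
    by rewrite memvZ.
  by rewrite (functionalZ (br e)) mulVf.
have fe : b (pair2 f e) = -1 by rewrite (alternating2N _ _ ab) ef.
pose W1 := (W :&: lker (functional (br e)))%VS.
pose W2 := (W1 :&: lker (functional (br f)))%VS.
have W2E v : (v \in W2) = [&& v \in W, b (pair2 e v) == 0 & b (pair2 f v) == 0].
  by rewrite !mem_kernel andbA.
have dW2 : (n * 2 <= \dim W2)%N.
  have := leq_trans dW (dim_kernel W (br e)); rewrite -/W1 ltnS => d1.
  by have := leq_trans d1 (dim_kernel W1 (br f)); rewrite ltnS.
have [|w [ws wW]] := IH W2 dW2.
  move=> u; rewrite W2E => /and3P [uW /eqP eu /eqP fu] u0; apply: nd => // y yW.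
  have ue : b (pair2 u e) = 0 by rewrite (alternating2N _ _ ab) eu oppr0.
  have uf : b (pair2 u f) = 0 by rewrite (alternating2N _ _ ab) fu oppr0.
  (* The argument is the projection of y to W2 along e and f; since u is orthogonal to e and f, it
     pairs with the projection as with y. *)
  have := u0 (y + (b (pair2 f y) *: e - b (pair2 e y) *: f)).
  rewrite (functionalD (br u)) (functionalD (br u)) (functionalN (br u)).
  rewrite !(functionalZ (br u)) ue uf !mulr0 subrr addr0; apply.
  rewrite W2E !(functionalD (br _)) !(functionalN (br _)) !(functionalZ (br _)).
  rewrite !b0 ef fe memvD ?memvB ?memvZ//=; apply/andP; split; apply/eqP; ring.
exists (fun i => match fintype.split i with inl j => pair2 e f j | inr j => w j end).
split; last first.
  move=> i; case: fintype.split => j; first by have [->|->] := ord2P j.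
  by have := wW j; rewrite W2E => /andP[].
have w0 j : b (pair2 e (w j)) = 0 /\ b (pair2 f (w j)) = 0.
  by have := wW j; rewrite W2E => /and3P[_ /eqP ? /eqP].
move=> i j; have [i' ->|i' ->] := split_ordP i; have [j' ->|j' ->] := split_ordP j;
  rewrite ?(unsplitK (inl _)) ?(unsplitK (inr _)) /=.
- by have [->|->] := ord2P i'; have [->|->] := ord2P j'; rewrite /pair2/= ?b0.
- have [we wf] := w0 j'; rewrite /symplectic_entry.
  by have [->|->] := ord2P i'; rewrite /pair2/= ?we ?wf /= ?andbF.
- have [we wf] := w0 i'; rewrite /symplectic_entry.
  have [->|->] := ord2P j'; rewrite /pair2/= (alternating2N _ _ ab) ?we ?wf oppr0 /= ?andbF //.
- by rewrite ws /symplectic_entry /= !eqSS !negbK.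
Qed.

(** For even k, the involution that exchanges the pairs (0, 1) and (k, k + 1) of a symplectic basis;
    it is the identity for k = 0. *)
Definition first_pair_swap (k x : nat) : nat :=
  if x == 0%N then k else if x == 1%N then k.+1 else
  if x == k then 0%N else if x == k.+1 then 1%N else x.

Lemma symplectic_entry_swap k x y : ~~ odd k ->
  symplectic_entry (first_pair_swap k x) (first_pair_swap k y) = symplectic_entry x y.
Proof.
move=> ek; rewrite /symplectic_entry.
have H u v : (~~ odd (first_pair_swap k u) &&
    (first_pair_swap k v == (first_pair_swap k u).+1)) = (~~ odd u && (v == u.+1)).
  rewrite /first_pair_swap; case: (u =P 0%N); case: (u =P 1%N); case: (u =P k); case: (u =P k.+1);
    case: (v =P 0%N); case: (v =P 1%N); case: (v =P k); case: (v =P k.+1); lia.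
by rewrite !H.
Qed.

(** The exchange of two pairs is a product of two transpositions, both trivial or neither, hence an
    even permutation: moving a pair to the front costs no sign. *)
Lemma tperm2_swap n (i j : 'I_(2 + n)) : ~~ odd i -> j = i.+1 :> nat ->
  exists t : 'S_(2 + n), [/\ odd_perm t = false, t i = lshift n ord0,
    t j = lshift n ord_max, forall x, t (t x) = x &
    forall x, t x = first_pair_swap i x :> nat].
Proof.
move=> ei ji; pose i0 : 'I_(2 + n) := lshift n ord0.
pose i1 : 'I_(2 + n) := lshift n ord_max.
have nat_eq (x y : 'I_(2 + n)) : (x == y) = (x == y :> nat) by [].
pose t := (tperm i0 i * tperm i1 j)%g.
have tE x : t x = first_pair_swap i x :> nat.
  rewrite permM /first_pair_swap -/(nat_of_ord i0) -/(nat_of_ord i1).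
  have nat_neq (p q : 'I_(2 + n)) : p <> q -> p <> q :> nat by move=> pq /val_inj.
  case: (tpermP i0 i x) => [ex|ex|/nat_neq x0 /nat_neq xi];
    case: tpermP => [/(congr1 val)/= ey|/(congr1 val)/= ey|/nat_neq/= y0 /nat_neq/= yi];
    try (move: x0 xi); try (move: (congr1 val ex)); rewrite /=;
    case: (x =P 0%N :> nat); case: (x =P 1%N :> nat); case: (x =P i :> nat);
    case: (x =P i.+1 :> nat); lia.
exists t; split => //.
- by rewrite odd_permM !odd_tperm !nat_eq /=; case: eqP => ?; case: eqP; lia.
- by apply: val_inj; rewrite /= tE /first_pair_swap; do 4?[case: eqP => ?]; lia.
- by apply: val_inj; rewrite /= tE /first_pair_swap; do 4?[case: eqP => ?]; lia.
- move=> x; apply: val_inj; rewrite /= !tE /first_pair_swap.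
  case: (x =P 0%N :> nat); case: (x =P 1%N :> nat); case: (x =P i :> nat);
  case: (x =P i.+1 :> nat); case: (i =P 0%N :> nat); case: (i =P 1%N :> nat);
  do 4?[case: eqP => ?]; lia.
Qed.

(** * Positivity of exterior powers on symplectic families *)

Section Positivity.
Variable b : ('I_2 -> V) -> R.
Hypothesis ab : alternating b.

Let term n (w : 'I_(n.+1 * 2) -> V) (s : 'S_(2 + n * 2)) : R :=
  (-1) ^+ s * (b (fun i => w (s (lshift (n * 2) i))) *
    ext_pow b n (fun j => w (s (rshift 2 j)))).

Let termE n (w : 'I_(n.+1 * 2) -> V) s : term w s =
  (-1) ^+ s * (b (pair2 (w (s (lshift (n * 2) ord0))) (w (s (lshift (n * 2) ord_max)))) *
    ext_pow b n (fun j => w (s (rshift 2 j)))).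
Proof. by rewrite /term (pair2E (fun i => w _)). Qed.

(** With the first pair in place the factor b is 1. What remains is the lower power at vectors
    permuted by the restriction of s, and its sign cancels that of s. *)
Let term_fix n (w : 'I_(n.+1 * 2) -> V) (s : 'S_(2 + n * 2)) :
  (forall w' : 'I_(n * 2) -> V, symplectic_family b w' -> 0 < ext_pow b n w') ->
  symplectic_family b w ->
  s (lshift (n * 2) ord0) = lshift (n * 2) ord0 ->
  s (lshift (n * 2) ord_max) = lshift (n * 2) ord_max -> 0 < term w s.
Proof.
move=> IH sw s0 s1; rewrite termE s0 s1 sw /symplectic_entry /= mul1r.
have [t st] : exists t, s = lift_perm ord0 ord0 t.
  by apply: lift_permP; apply: etrans (etrans s0 _); [congr (s _)|]; apply: val_inj.
have [r tr] : exists r, t = lift_perm ord0 ord0 r.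
  apply: lift_permP; apply: (@lift_inj _ ord0); rewrite -(lift_perm_lift ord0 ord0 t) -st.
  by apply: etrans (etrans s1 _); [congr (s _)|]; apply: val_inj.
have -> : odd_perm s = odd_perm r by rewrite st odd_lift_perm tr odd_lift_perm.
have -> : (fun j => w (s (rshift 2 j))) = (fun j => w (rshift 2 j)) \o r.
  apply/funext => j /=; congr (w _).
  have e k : rshift 2 k = lift ord0 (lift ord0 k) :> 'I_(2 + n * 2) by apply: val_inj.
  by rewrite !e st lift_perm_lift tr lift_perm_lift.
rewrite ext_pow_perm mulrA -expr2 sqrr_sign mul1r; apply: IH => i j.
by rewrite sw /symplectic_entry /= !eqSS !negbK.
Qed.

(** The factor b vanishes unless s sends the first two places to a pair (2k, 2k + 1) in one order or
    the other. In the right order an even permutation brings this pair to the front, where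
    [term_fix] applies. *)
Let term_ge0 n (w : 'I_(n.+1 * 2) -> V) (s : 'S_(2 + n * 2)) :
  (forall w' : 'I_(n * 2) -> V, symplectic_family b w' -> 0 < ext_pow b n w') ->
  symplectic_family b w -> 0 <= term w s.
Proof.
move=> IH sw.
have pos (t : 'S_(2 + n * 2)) : ~~ odd (t (lshift (n * 2) ord0)) ->
    t (lshift (n * 2) ord_max) = (t (lshift (n * 2) ord0)).+1 :> nat -> 0 < term w t.
  move=> e1 e2; have [r [or r0 r1 rr rE]] := tperm2_swap e1 e2.
  have -> : term w t = term (w \o r) (t * r)%g.
    rewrite /term odd_permM or addbF; congr (_ * (b _ * ext_pow b n _));
      by apply/funext => i; rewrite /= permM rr.
  apply: term_fix => //; last 2 first.
  - by rewrite permM r0.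
  - by rewrite permM r1.
  by move=> i j; rewrite /= sw !rE symplectic_entry_swap.
rewrite termE sw /symplectic_entry.
case: ifP => [/andP[e1 /eqP e2]|_].
  by have := ltW (pos s e1 e2); rewrite termE sw /symplectic_entry e1 e2 eqxx.
case: ifP => [/andP[e1 /eqP e2]|_]; last by rewrite mul0r mulr0.
(* The pair appears reversed: exchanging the first two places flips both the sign of the permutation
   and the entry of b, so the term is unchanged. *)
pose u : 'S_(2 + n * 2) := tperm (lshift (n * 2) ord0) (lshift (n * 2) ord_max).
have := pos (u * s)%g; rewrite !permM /u tpermL tpermR => /(_ e1 e2) /ltW.
rewrite termE !permM /u tpermL tpermR odd_permM odd_tperm.
have -> : (lshift (n * 2) ord0 != lshift (n * 2) ord_max :> 'I_(2 + n * 2)) by [].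
rewrite sw /symplectic_entry e1 e2 eqxx /= signrN.
have -> : (fun j => w ((u * s)%g (rshift 2 j))) = fun j => w (s (rshift 2 j)).
  by apply/funext => j; rewrite permM /u tpermD.
by rewrite mul1r mulN1r mulrN mulNr.
Qed.

(** All terms are nonnegative and that of the identity is positive, so nothing cancels. *)
Lemma symplectic_family_gt0 n (w : 'I_(n * 2) -> V) :
  symplectic_family b w -> 0 < ext_pow b n w.
Proof.
elim: n w => [|n IH] w sw; first exact: ltr01.
rewrite /= /ext_prod mulr_gt0// ?invr_gt0 ?ltr0n ?muln_gt0 ?fact_gt0//.
rewrite (bigD1 1%g)//= ltr_pwDl//.
  by apply: (term_fix IH sw); rewrite perm1.
by apply: sumr_ge0 => s _; exact: (term_ge0 s IH sw).
Qed.

(** The top-degree form is evaluated on a vector z1 with a(z1) = 1 followed by a symplectic family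
    in the kernel of a. Permutations that move the first place feed a with a kernel vector and give
    0; the others contribute positively. *)
Lemma contact_nonzero (a : ('I_1 -> V) -> R) n :
  alternating a -> m = (n * 2).+1 -> (exists z, a (fun=> z) != 0) ->
  (forall u, a (fun=> u) = 0 ->
    (forall w, a (fun=> w) = 0 -> b (pair2 u w) = 0) -> u = 0) ->
  exists v, ext_prod a (ext_pow b n) v != 0.
Proof.
move=> aa mn [z az] nd; have la := alternating1P aa.
pose K := (fullv :&: lker (functional la))%VS.
have KE w : (w \in K) = (a (fun=> w) == 0) by rewrite mem_kernel memvf.
have dK : (n * 2 <= \dim K)%N.
  have full : \dim (fullv : {vspace V}) = m.
    by rewrite dimvf; exact: etrans (dim_matrix _ _ _) (mul1n m).
  have := dim_kernel fullv la; rewrite full -/K => dK1.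
  have : ((n * 2).+1 <= (\dim K).+1)%N by rewrite -mn.
  by rewrite ltnS.
have [|w [sw wK]] := symplectic_family_exists ab dK.
  move=> u; rewrite KE => /eqP au u0; apply: nd => // w aw; apply: u0.
  by rewrite KE aw.
pose z1 := (a (fun=> z))^-1 *: z.
have az1 : a (fun=> z1) = 1 by rewrite (functionalZ la) mulVf.
pose v (i : 'I_(1 + n * 2)) :=
  match fintype.split i with inl _ => z1 | inr j => w j end.
exists v; apply: lt0r_neq0; rewrite /ext_prod mulr_gt0// ?invr_gt0 ?ltr0n ?muln_gt0 ?fact_gt0//.
have v0 : v (lshift (n * 2) ord0) = z1 by rewrite /v (unsplitK (inl _)).
have vr j : v (rshift 1 j) = w j by rewrite /v (unsplitK (inr _)).
have pos (s : 'S_(1 + n * 2)) : s (lshift (n * 2) ord0) = lshift (n * 2) ord0 ->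
   0 < (-1) ^+ s * (a (fun i => v (s (lshift (n * 2) i))) *
     ext_pow b n (fun j => v (s (rshift 1 j)))).
  move=> s0; rewrite (cst1E (fun i => v (s (lshift (n * 2) i)))) s0 v0 az1 mul1r.
  have [t st] : exists t, s = lift_perm ord0 ord0 t.
    by apply: lift_permP; apply: etrans (etrans s0 _); [congr (s _)|]; apply: val_inj.
  have -> : odd_perm s = odd_perm t by rewrite st odd_lift_perm.
  have -> : (fun j => v (s (rshift 1 j))) = w \o t.
    apply/funext => j /=.
    have e k : rshift 1 k = lift ord0 k :> 'I_(1 + n * 2) by apply: val_inj.
    by rewrite e st lift_perm_lift -e vr.
  by rewrite ext_pow_perm mulrA -expr2 sqrr_sign mul1r symplectic_family_gt0.
rewrite (bigD1 1%g)//= ltr_pwDl//; first by apply: pos; rewrite perm1.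
apply: sumr_ge0 => s _.
have [s0|s0] := eqVneq (s (lshift (n * 2) ord0)) (lshift (n * 2) ord0).
  exact/ltW/pos.
rewrite (cst1E (fun i => v (s (lshift (n * 2) i)))).
have [j e|j e] := split_ordP (s (lshift (n * 2) ord0)).
  by case/eqP: s0; rewrite e [j]ord1.
rewrite e vr (_ : a _ = 0) ?mul0r ?mulr0//.
by apply/eqP; rewrite -KE.
Qed.

End Positivity.

End ContactLinearAlgebra.

(** * Principal bundles *)

Section SmoothConstructions.
Context {R : realType}.
Implicit Types E F G : normedModType R.

Lemma Ck_snd_eq k E F (V : set (E * F)) (f : E * F -> F) : open V ->
  (forall y, V y -> y.2 = f y) -> Ck k V f.
Proof. by move=> oV e; apply: Ck_eq (Ck_snd k oV) => // y /set_mem /e. Qed.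

Lemma chart_smooth_snd E F (M : manifold E) (N : manifold F) (c : chart E M)
    (d : chart F N) (z : prod_manifold M N) :
  cdom c z.1 -> cdom d z.2 -> chart_smooth (M := prod_manifold M N)
    (prod_chart c d) d (fun z => z.2) z.
Proof.
move=> cz dz.
have oV := @cimg_open _ _ _ (prod_chart c d).
have Vz : (cfun (prod_chart c d) @` cdom (prod_chart c d)) (cfun (prod_chart c d) z).
  by exists z.
exists (cfun (prod_chart c d) @` cdom (prod_chart c d)); split => //.
  by move=> _ [[a b] [/= ca db] <-]; rewrite /= cfunKE.
move=> k; apply: Ck_snd_eq => // _ [[a b] [/= ca db] <-] /=.
by rewrite cfunKE.
Qed.

Lemma smooth_map_on_local E F (M : manifold E) (N : manifold F) (A : set M)
    (f : M -> N) : open A ->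
  (forall x, A x -> exists B, [/\ open B, B x & smooth_map_on B f]) ->
  smooth_map_on A f.
Proof.
move=> oA loc; apply: chart_smooth_map_on => // x /loc [B [oB Bx sf]].
exists (chart_at x), (chart_at (f x)); split;
  try exact: chart_at_atlasP; try exact: chart_at_domP.
exact: smooth_map_on_at sf Bx.
Qed.

Lemma smooth_map_on_cst E F (M : manifold E) (N : manifold F) (A : set M) (y : N) :
  open A -> smooth_map_on A (fun=> y).
Proof.
move=> oA; apply: chart_smooth_map_on => // x Ax.
exists (chart_at x), (chart_at y).
have xx := chart_at_domP x; have yy := chart_at_domP y.
split; try exact: chart_at_atlasP; try exact: chart_at_domP.
by have [] := chart_smooth_cst xx yy.
Qed.

Lemma smooth_map_on_pair E F G (M : manifold E) (N : manifold F) (P : manifold G)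
    (A : set P) (f : P -> M) (g : P -> N) : open A ->
  smooth_map_on A f -> smooth_map_on A g ->
  smooth_map_on (N := prod_manifold M N) A (fun z => (f z, g z)).
Proof.
move=> oA sf sg; apply: chart_smooth_map_on => // x Ax.
exists (chart_at x), (prod_chart (chart_at (f x)) (chart_at (g x))); split.
- exact: chart_at_atlasP.
- by apply: prod_chart_atlas; exact: chart_at_atlasP.
- exact: chart_at_domP.
- by split; exact: chart_at_domP.
- by have [] := chart_smooth_pair (smooth_map_on_at oA sf Ax) (smooth_map_on_at oA sg Ax).
Qed.

Lemma smooth_fst E F (M : manifold E) (N : manifold F) :
  smooth_map (M := prod_manifold M N) (fun z => z.1).
Proof.
apply: chart_smooth_map_on; first exact: openT.
move=> z _; exists (prod_chart (chart_at z.1) (chart_at z.2)), (chart_at z.1).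
have [z1 z2] := (chart_at_domP z.1, chart_at_domP z.2).
split => //; try exact: chart_at_atlasP.
  by apply: prod_chart_atlas; exact: chart_at_atlasP.
by have [] := chart_smooth_fst z1 z2.
Qed.

Lemma smooth_snd E F (M : manifold E) (N : manifold F) :
  smooth_map (M := prod_manifold M N) (fun z => z.2).
Proof.
apply: chart_smooth_map_on; first exact: openT.
move=> z _; exists (prod_chart (chart_at z.1) (chart_at z.2)), (chart_at z.2).
have [z1 z2] := (chart_at_domP z.1, chart_at_domP z.2).
split => //; try exact: chart_at_atlasP.
  by apply: prod_chart_atlas; exact: chart_at_atlasP.
exact: chart_smooth_snd.
Qed.

Lemma chart_smooth_real E (M : manifold E) (c : chart E M) (d : chart R (@real_line R))
    (f : M -> @real_line R) x : atlas (@real_line R) d -> cdom c x ->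
  chart_smooth c d f x <-> exists V, [/\ open V, V (cfun c x),
    V `<=` cfun c @` cdom c & forall k, Ck k V ((f : M -> R) \o cinv c)].
Proof.
move=> /real_lineP [dd df di] cx; split.
  by move=> [V [oV Vx Vc Vd sV]]; exists V; split => // k; have := sV k; rewrite df.
move=> [V [oV Vx Vc sV]]; exists V; split => //; first by move=> y _; rewrite dd.
by move=> k; rewrite df; exact: sV.
Qed.

Lemma smooth_map_on_real E (M : manifold E) (A : set M) (f : M -> @real_line R) :
  open A -> smooth_map_on A f <-> forall x, A x -> exists V, [/\ open V,
    V (cfun (chart_at x) x), V `<=` cfun (chart_at x) @` (cdom (chart_at x) `&` A) &
    forall k, Ck k V ((f : M -> R) \o cinv (chart_at x))].
Proof.
move=> oA; split.
  move=> sf x Ax; have xx := chart_at_domP x; have ay := chart_at_atlasP (f x).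
  have /(chart_smooth_real _ ay xx) [V [oV Vx Vc sV]] := smooth_map_on_at oA sf Ax.
  have oW : open (V `&` cfun (chart_at x) @` (cdom (chart_at x) `&` A)).
    by apply: openI => //; exact: chart_imgI_open.
  exists (V `&` cfun (chart_at x) @` (cdom (chart_at x) `&` A)).
  split; [exact: oW|by split => //; exists x|by move=> y []|].
  by move=> k; apply: (CkW _ (sV k)) => y [].
move=> H; apply: chart_smooth_map_on => // x Ax.
have ay := chart_at_atlasP (f x); have xx := chart_at_domP x.
exists (chart_at x), (chart_at (f x)); split => //;
  try exact: chart_at_atlasP; try exact: chart_at_domP.
apply/(chart_smooth_real _ ay xx); have [V [oV Vx Vc sV]] := H x Ax.
by exists V; split => // y /Vc [z [cz _] <-]; exists z.
Qed.

Lemma smooth_real_mul E (M : manifold E) (A : set M) (f g : M -> R) : open A ->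
  smooth_map_on (N := @real_line R) A f -> smooth_map_on (N := @real_line R) A g ->
  smooth_map_on (N := @real_line R) A (fun x => f x * g x).
Proof.
move=> oA /(smooth_map_on_real _ oA) sf /(smooth_map_on_real _ oA) sg.
apply/(smooth_map_on_real _ oA) => x Ax.
have [V [oV Vx Vc sV]] := sf x Ax; have [W [oW Wx Wc sW]] := sg x Ax.
have oVW := openI oV oW.
exists (V `&` W); split => //; first by move=> y [/Vc].
move=> k; apply: (Ck_mul oVW); first by apply: (CkW _ (sV k)) => y [].
by apply: (CkW _ (sW k)) => y [].
Qed.

Lemma smooth_real_inv E (M : manifold E) (A : set M) (f : M -> R) : open A ->
  smooth_map_on (N := @real_line R) A f -> (forall x, A x -> f x != 0) ->
  smooth_map_on (N := @real_line R) A (fun x => (f x)^-1).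
Proof.
move=> oA /(smooth_map_on_real _ oA) sf f0.
apply/(smooth_map_on_real _ oA) => x Ax.
have [V [oV Vx Vc sV]] := sf x Ax; exists V; split => // k.
apply: (Ck_inv oV _ (sV k)) => y /Vc [z [cz Az] <-] /=.
by rewrite cfunKE//; exact: f0.
Qed.

End SmoothConstructions.

Lemma dchartE (R : realType) (E F : normedModType R) (M : manifold E)
    (N : manifold F) (c : chart E M) (d : chart F N) (f : M -> N) x v :
  dchart c d f x v = 'd (cfun d \o f \o cinv c) (cfun c x) v.
Proof. by []. Qed.

Opaque dchart.

Section PrincipalBundles.
Context {R : realType} {m : nat} (M : manifold 'rV[R]_m).
Local Notation RL := (@real_line R).
Implicit Types E F : normedModType R.

Lemma open_nonzero : open [set s : RL | (s : R) != 0].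
Proof. exact: open_neq. Qed.

Lemma smooth_map_continuous E F (N : manifold E) (N' : manifold F) (f : N -> N') :
  smooth_map f -> continuous f.
Proof. by move=> [cf _] x; exact: cf. Qed.

Section OneBundle.
Context (P : principal_bundle M).

Lemma open_preimage_bproj (U : set M) : open U -> open (@bproj _ _ _ P @^-1` U).
Proof.
move=> oU; apply: open_comp => // x _.
exact: smooth_map_continuous (bproj_smooth P) x.
Qed.

Lemma open_act : open [set sp : prod_manifold RL P | sp.1 != 0].
Proof.
have := open_setXT (T := P) open_nonzero; congr open.
by apply/seteqP; split => -[s p] /=; [move=> []|move=> ?; split].
Qed.

Lemma act_smooth_at (s : R) : s != 0 -> smooth_map (@bact _ _ _ P s).
Proof.
move=> s0.
have := smooth_map_on_comp (M := P) (N := prod_manifold RL P) (P := P) (A := setT)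
  (B := [set sp | sp.1 != 0]) (f := fun p => (s, p))
  (g := fun sp : prod_manifold RL P => bact sp.1 sp.2) (@openT _) open_act.
apply => //; last exact: bact_smooth.
apply: (smooth_map_on_pair (@openT _)); last exact: smooth_map_id.
by apply: smooth_map_on_cst; exact: openT.
Qed.

Definition orbit_curve (p : P) : RL -> P := fun s => bact s p.

Lemma orbit_curve_smooth p : smooth_map_on [set s : RL | (s : R) != 0] (orbit_curve p).
Proof.
have := smooth_map_on_comp (M := RL) (N := prod_manifold RL P) (P := P)
  (A := [set s : RL | (s : R) != 0])
  (B := [set sp | sp.1 != 0]) (f := fun s => (s, p))
  (g := fun sp : prod_manifold RL P => bact sp.1 sp.2) open_nonzero open_act.
apply => //; last exact: bact_smooth.
apply: (smooth_map_on_pair open_nonzero); last first.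
  by apply: smooth_map_on_cst; exact: open_nonzero.
by apply: (smooth_map_onW open_nonzero (@openT _) _ (@smooth_map_id _ _ RL)).
Qed.

(* The value at p of the generator of the action. *)
Definition euler (p : P) : 'rV[R]_m.+1 :=
  dchart (chart_at (1 : RL)) (chart_at p) (orbit_curve p) (1 : RL) (1 : R).

Lemma orbit_curve_chart p (c : chart _ P) : atlas P c -> cdom c p ->
  chart_smooth (chart_at (1 : RL)) c (orbit_curve p) (1 : RL).
Proof.
move=> ac cp; apply: (smooth_map_on_chart open_nonzero (orbit_curve_smooth p)) => //.
- exact: oner_neq0.
- exact: chart_at_atlasP.
- exact: chart_at_domP.
- by rewrite /orbit_curve bact1.
Qed.

(** The chain rule along the orbit. It reduces each fact on the image of the generator to a
    comparison of curves in the target, and it allows any chart at p. *)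
Lemma euler_map E (N : manifold E) (f : P -> N) p (c : chart _ P) (d : chart E N) :
  atlas P c -> cdom c p -> chart_smooth c d f p ->
  dchart c d f p (dchart (chart_at p) c id p (euler p)) =
  dchart (chart_at (1 : RL)) d (f \o orbit_curve p) (1 : RL) (1 : R).
Proof.
move=> ac cp fs; have ap := chart_at_atlasP p; have pp := chart_at_domP p.
have r1 := chart_at_domP (1 : RL).
have o1 : orbit_curve p 1 = p by rewrite /orbit_curve bact1.
have s1 := orbit_curve_chart ap pp.
have s2 : chart_smooth (chart_at p) c id (orbit_curve p 1).
  by rewrite o1; exact: chart_smooth_id.
have e1 := dchart_comp r1 s1 s2 (1 : R); rewrite o1 in e1.
apply: etrans (congr1 (dchart c d f p) (esym e1)) _.
have s3 := orbit_curve_chart ac cp.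
have s4 : chart_smooth c d f (orbit_curve p 1) by rewrite o1.
have e2 := dchart_comp r1 s3 s4 (1 : R); rewrite o1 in e2.
exact: esym e2.
Qed.

Lemma tangent_euler E (N : manifold E) (f : P -> N) p : smooth_map f ->
  tangent_map f p (euler p) =
  dchart (chart_at (1 : RL)) (chart_at (f p)) (f \o orbit_curve p) (1 : RL) (1 : R).
Proof.
move=> sf; have ap := chart_at_atlasP p; have pp := chart_at_domP p.
rewrite tangent_mapE -(euler_map ap pp); last exact: (smooth_map_on_at (@openT _) sf).
by rewrite dchart_id.
Qed.

Lemma dchart_curve_eq E (N : manifold E) (d : chart E N) (f g : RL -> N) :
  atlas N d -> cdom d (f 1) ->
  smooth_map_on [set s : RL | (s : R) != 0] f -> (forall s : R, s != 0 -> f s = g s) ->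
  dchart (chart_at (1 : RL)) d g (1 : RL) (1 : R) =
  dchart (chart_at (1 : RL)) d f (1 : RL) (1 : R).
Proof.
move=> ad df sf fg; have r1 := chart_at_domP (1 : RL).
have n1 : [set s : RL | (s : R) != 0] 1 by exact: oner_neq0.
have fs := smooth_map_on_chart open_nonzero sf n1 (chart_at_atlasP _) ad r1 df.
have [] := chart_smooth_eq (g := g) r1 fs.
  by exists [set s : RL | (s : R) != 0]; split => //; exact: open_nonzero.
by move=> _ ->.
Qed.

(** The projection is constant along orbits. *)
Lemma tangent_bproj_euler p : tangent_map (@bproj _ _ _ P) p (euler p) = 0.
Proof.
rewrite (tangent_euler _ (bproj_smooth P)).
have xx := chart_at_domP (bproj p); have r1 := chart_at_domP (1 : RL).
have [_ e0] := chart_smooth_cst r1 xx; apply: etrans _ (e0 (1 : R)).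
apply: (dchart_curve_eq (f := fun=> bproj p)) => //.
- exact: chart_at_atlasP.
- by apply: smooth_map_on_cst; exact: open_nonzero.
- by move=> s s0 /=; rewrite /orbit_curve bact_proj.
Qed.

(** The group is commutative, so the action of s carries the orbit curve of p to that of its
    image. *)
Lemma tangent_act_euler p (s : R) : s != 0 ->
  tangent_map (@bact _ _ _ P s) p (euler p) = euler (bact s p).
Proof.
move=> s0; rewrite (tangent_euler _ (act_smooth_at s0)) /euler.
apply: dchart_curve_eq.
- exact: chart_at_atlasP.
- by rewrite /orbit_curve bact1; exact: chart_at_domP.
- exact: orbit_curve_smooth.
- by move=> t t0; rewrite /= /orbit_curve !bactM// mulrC.
Qed.

Lemma tangent_bproj_act p (s : R) v : s != 0 ->
  tangent_map (@bproj _ _ _ P) (bact s p) (tangent_map (@bact _ _ _ P s) p v) =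
  tangent_map (@bproj _ _ _ P) p v.
Proof.
move=> s0.
apply: etrans (esym (tangent_map_comp v (@openT _) (@openT _)
  (act_smooth_at s0) (bproj_smooth P) I I)) _.
have E : @bproj _ _ _ P \o @bact _ _ _ P s = @bproj _ _ _ P.
  by apply/funext => q /=; rewrite bact_proj.
by rewrite E.
Qed.

End OneBundle.

End PrincipalBundles.

(** * Local trivializations and the vertical direction *)

Section Trivializations.
Context {R : realType} {m : nat} (M : manifold 'rV[R]_m).
Local Notation RL := (@real_line R).
Implicit Types E F : normedModType R.

(** The inverse g is made explicit because the local sections x |-> g(x, 1) are taken from it. *)
Definition trivialization (P : principal_bundle M) (U : set M)
    (Phi : P -> prod_manifold M RL) (g : prod_manifold M RL -> P) :=
  [/\ [/\ open U, smooth_map_on (@bproj _ _ _ P @^-1` U) Phi,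
        smooth_map_on [set z : prod_manifold M RL | U z.1 /\ z.2 != 0] g,
        open (@bproj _ _ _ P @^-1` U) &
        open [set z : prod_manifold M RL | U z.1 /\ z.2 != 0]],
      (forall p, U (bproj p) ->
        [/\ (Phi p).1 = bproj p, (Phi p).2 != 0 & g (Phi p) = p]),
      (forall x (s : R), U x -> s != 0 -> [/\ bproj (g (x, s)) = x,
         (Phi (g (x, s))).1 = x & (Phi (g (x, s))).2 = s]) &
      (forall (s : R) p, s != 0 -> U (bproj p) ->
         (Phi (bact s p)).2 = s * (Phi p).2)].

Lemma open_trivial_image (U : set M) : open U ->
  open [set z : prod_manifold M RL | U z.1 /\ z.2 != 0].
Proof. by move=> oU; exact: (open_setX oU (open_nonzero (R := R))). Qed.

Lemma trivializationP (P : principal_bundle M) x :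
  exists U Phi g, U x /\ trivialization (P := P) U Phi g.
Proof.
have [U [Phi [oU Ux [g [sPhi sg UA UB [gK Kg]]] Phi1 Phi2]]] := btrivial P x.
exists U, Phi, g; split => //; split => //.
- split => //; first exact: open_preimage_bproj.
  exact: open_trivial_image.
- move=> p Up; have [_ /= p0] := UA p Up.
  by split => //; [exact: Phi1|rewrite gK// inE].
- move=> y s Uy s0; have B : [set z : prod_manifold M RL | U z.1 /\ z.2 != 0] (y, s) by [].
  have e := Kg _ (mem_set B); have Ug : U (bproj (g (y, s))) := UB _ B.
  by split; rewrite -?(Phi1 _ Ug) e.
Qed.

Section OneTrivialization.
Context (P : principal_bundle M) U Phi g (tr : trivialization (P := P) U Phi g).

Lemma trivialization_section x (s t : R) : U x -> s != 0 -> t != 0 ->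
  g (x, s * t) = bact s (g (x, t)).
Proof.
move=> Ux s0 t0; have [_ Tp Tg Te] := tr.
have [b1 p1 p2] := Tg x t Ux t0.
have Ub : U (bproj (bact s (g (x, t)))) by rewrite bact_proj// b1.
have [q1 _ q3] := Tp _ Ub.
rewrite -[RHS]q3; congr (g _); rewrite [RHS]surjective_pairing q1 Te ?b1// p2.
by rewrite bact_proj// b1.
Qed.

Lemma trivialization_fibre p : U (bproj p) ->
  p = bact (Phi p).2 (g (bproj p, 1)).
Proof.
move=> Up; have [_ Tp _ _] := tr; have [p1 p2 p3] := Tp p Up.
rewrite -trivialization_section ?oner_neq0// mulr1 -[LHS]p3 -p1.
by rewrite -surjective_pairing.
Qed.

End OneTrivialization.

Section ChartTrivialization.
Context (P : principal_bundle M) U Phi g (tr : trivialization (P := P) U Phi g).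
Context (p : P) (c : chart 'rV[R]_m.+1 P) (d : chart 'rV[R]_m M).
Hypotheses (Up : U (bproj p)) (ac : atlas P c) (ad : atlas M d)
  (cp : cdom c p) (dp : cdom d (bproj p)).

Let rl := chart_at ((Phi p).2 : RL).
Let e : chart ('rV[R]_m * R)%type (prod_manifold M RL) := prod_chart d rl.

Let ae : atlas (prod_manifold M RL) e.
Proof. by apply: prod_chart_atlas => //; exact: chart_at_atlasP. Qed.

Let ep : cdom e (Phi p).
Proof.
have [_ Tp _ _] := tr; have [p1 _ _] := Tp p Up.
split; first by rewrite p1.
exact: (@chart_at_domP _ _ RL).
Qed.

Let Phis : chart_smooth c e Phi p.
Proof. by have [[oU sPhi sg oA oB] _ _ _] := tr; exact: (smooth_map_on_chart oA sPhi). Qed.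

Let gPhi : g (Phi p) = p.
Proof. by have [_ Tp _ _] := tr; have [] := Tp p Up. Qed.

Let gs : chart_smooth e c g (Phi p).
Proof.
have [[oU sPhi sg oA oB] Tp _ _] := tr; have [p1 p2 p3] := Tp p Up.
apply: (smooth_map_on_chart oB sg) => //; last by rewrite gPhi.
by split => //; rewrite p1.
Qed.

Lemma dchart_trivializationK v : dchart e c g (Phi p) (dchart c e Phi p v) = v.
Proof.
apply: etrans (esym (dchart_comp cp Phis gs v)) _.
have [[oU sPhi sg oA oB] Tp _ _] := tr.
have idp := chart_smooth_id ac ac cp cp.
have [] := chart_smooth_eq (g := g \o Phi) cp idp.
  exists (@bproj _ _ _ P @^-1` U); split => // q Uq.
  by have [_ _ /= ->] := Tp q Uq.
by move=> _ ->; exact: dchart_id.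
Qed.

Lemma dchart_trivialization1 v :
  (dchart c e Phi p v).1 = dchart c d (@bproj _ _ _ P) p v.
Proof.
have [e1 e2] := ep; have [s1 d1] := chart_smooth_fst e1 e2.
rewrite -d1; apply: etrans (esym (dchart_comp cp Phis s1 v)) _.
have [[oU sPhi sg oA oB] Tp _ _] := tr.
have sb := smooth_map_chart (bproj_smooth P) ac ad cp dp.
have [] := chart_smooth_eq (g := (fun z : prod_manifold M RL => z.1) \o Phi) cp sb.
  exists (@bproj _ _ _ P @^-1` U); split => // q Uq.
  by have [/= -> _ _] := Tp q Uq.
by move=> _ ->.
Qed.

Lemma dchart_bproj_trivialization v :
  dchart c d (@bproj _ _ _ P) p (dchart e c g (Phi p) v) = v.1.
Proof.
have [e1 e2] := ep; have [s1 d1] := chart_smooth_fst e1 e2.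
have sb := smooth_map_chart (bproj_smooth P) ac ad cp dp.
have sb' : chart_smooth c d (@bproj _ _ _ P) (g (Phi p)) by rewrite gPhi.
have ec := dchart_comp ep gs sb' v; rewrite gPhi in ec.
apply: etrans (esym ec) _; rewrite -d1.
have [[oU sPhi sg oA oB] Tp Tg _] := tr; have [p1 p2 p3] := Tp p Up.
have [] := chart_smooth_eq (g := (@bproj _ _ _ P) \o g) ep s1.
  exists [set z : prod_manifold M RL | U z.1 /\ z.2 != 0]; split => //.
    by split => //; rewrite p1.
  by move=> [y s] [/= Uy s0]; have [-> _ _] := Tg y s Uy s0.
by move=> _ ->.
Qed.

(** In a trivialization the orbit of (x, t) is the curve s |-> (x, s t), whose velocity at s = 1 is
    (0, t). *)
Lemma dchart_trivialization_euler :
  dchart c e Phi p (dchart (chart_at p) c id p (euler p)) = (0, (Phi p).2).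
Proof.
have r1 := chart_at_domP (1 : RL).
have [[oU sPhi sg oA oB] Tp Tg Te] := tr; have [p1 p2 p3] := Tp p Up.
have [rd rf ri] := real_lineP (chart_at_atlasP ((Phi p).2 : RL)).
have [rd1 rf1 ri1] := real_lineP (chart_at_atlasP (1 : RL)).
have ax1 := chart_at_atlasP (1 : RL).
rewrite (euler_map ac cp Phis).
pose sc (s : RL) : RL := (s : R) * (Phi p).2.
have scs : chart_smooth (chart_at (1 : RL)) rl sc (1 : RL).
  apply/(chart_smooth_real _ (chart_at_atlasP _) r1).
  exists setT; split => //; first exact: openT.
    by move=> y _; exists y; rewrite ?rd1 ?rf1.
  move=> k; rewrite ri1; have oT := @openT R.
  exact: (Ck_mul oT (Ck_id k oT) (Ck_cst k _ oT)).
have dx : cdom d (bproj p) := dp.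
have [cs dcs] := chart_smooth_cst r1 dx.
have [ps dps] := chart_smooth_pair cs scs.
have [] := chart_smooth_eq (g := Phi \o orbit_curve p) r1 ps.
  exists [set s : RL | (s : R) != 0].
  split; [exact: (open_nonzero (R := R))|exact: oner_neq0|].
  move=> s s0; rewrite /= /orbit_curve [RHS]surjective_pairing Te//.
  have Us : U (bproj (bact s p)) by rewrite bact_proj.
  by have [-> _ _] := Tp _ Us; rewrite bact_proj.
move=> _ ->; rewrite dps dcs; congr (_, _).
rewrite dchartE rf rf1 ri1 /=.
apply: etrans (diff_linearE (l := fun s : R => s * (Phi p).2) _ (1 : R) _ _) (mul1r _).
  by move=> t u v; rewrite mulrDl /GRing.scale /= mulrA.
move=> z; have oT := @openT R.
exact: (Ck_mul oT (Ck_id 0 oT) (Ck_cst 0 (Phi p).2 oT)).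
Qed.

(** In a trivialization both v and the generator have base component 0; the fibre component of the
    generator is nonzero, and the factor is the ratio of the two. *)
Lemma vertical v : dchart c d (@bproj _ _ _ P) p v = 0 ->
  exists t, v = t *: dchart (chart_at p) c id p (euler p).
Proof.
move=> v0; have [_ Tp _ _] := tr; have [_ p2 _] := Tp p Up.
pose w := dchart c e Phi p v; exists (w.2 / (Phi p).2).
rewrite -[LHS]dchart_trivializationK -[RHS]dchart_trivializationK; congr dchart.
set z := dchart (chart_at p) _ _ _ _.
have -> : dchart c e Phi p ((w.2 / (Phi p).2) *: z) =
    (w.2 / (Phi p).2) *: dchart c e Phi p z.
  have := dchart_linear c e Phi p (w.2 / (Phi p).2) z 0.
  have -> : dchart c e Phi p 0 = 0.
    have := dchart_linear c e Phi p (-1) 0 0.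
    by rewrite scaler0 addr0 scaleN1r addNr.
  by rewrite !addr0.
rewrite dchart_trivialization_euler -/w.
have -> : (w.2 / (Phi p).2) *: (0, (Phi p).2) =
    (((w.2 / (Phi p).2) *: 0 : 'rV[R]_m), (w.2 / (Phi p).2) * (Phi p).2) by [].
rewrite scaler0 divfK// -v0 -dchart_trivialization1.
exact: surjective_pairing.
Qed.

End ChartTrivialization.

(** The atlas of the line has one chart; this lets trivializations at different points be read in
    the same product chart. *)
Lemma chart_at_real (s t : RL) : chart_at s = chart_at t.
Proof.
have H (c c' : chart R RL) : atlas RL c -> atlas RL c' -> c = c' by move=> -> ->.
by apply: H; exact: chart_at_atlasP.
Qed.

Section Tangent.
Context (P : principal_bundle M).

Lemma tangent_bproj_vertical (p : P) v : tangent_map (@bproj _ _ _ P) p v = 0 ->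
  exists t, v = t *: euler p.
Proof.
move=> v0; have [U [Phi [g [Up tr]]]] := trivializationP P (bproj p).
have [ap pp] := (chart_at_atlasP p, chart_at_domP p).
have [ax xx] := (chart_at_atlasP (bproj p), chart_at_domP (bproj p)).
have [t ->] := vertical tr Up ap ax pp xx v0.
by exists t; rewrite dchart_id.
Qed.

Lemma euler_neq0 (p : P) : euler p != 0.
Proof.
have [U [Phi [g [Up tr]]]] := trivializationP P (bproj p).
have [ap pp] := (chart_at_atlasP p, chart_at_domP p).
have [ax xx] := (chart_at_atlasP (bproj p), chart_at_domP (bproj p)).
apply/eqP => e0; have [_ Tp _ _] := tr; have [_ /eqP p2 _] := Tp p Up; apply: p2.
have := dchart_trivialization_euler tr Up ap ax pp xx.
rewrite dchart_id// e0 => /(congr1 snd) /= <-.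
have := dchart_linear (chart_at p) (prod_chart (chart_at (bproj p))
  (chart_at ((Phi p).2 : RL)) : chart _ (prod_manifold M RL)) Phi p (-1) 0 0.
by rewrite scaler0 addr0 scaleN1r addNr => ->.
Qed.

Lemma tangent_bproj_surj (p : P) u : exists v, tangent_map (@bproj _ _ _ P) p v = u.
Proof.
have [U [Phi [g [Up tr]]]] := trivializationP P (bproj p).
have [ap pp] := (chart_at_atlasP p, chart_at_domP p).
have [ax xx] := (chart_at_atlasP (bproj p), chart_at_domP (bproj p)).
eexists; exact: (dchart_bproj_trivialization tr Up ap ax pp xx (u, 0)).
Qed.

(** A trivialization lifts u to the image of (u, 0) under the differential of its inverse. The
    smooth dependence of this lift on the point is what later makes the map to the cotangent bundle
    smooth. *)
Lemma local_lift (p0 : P) (c : chart 'rV[R]_m.+1 P) (d : chart 'rV[R]_m M) :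
  atlas P c -> atlas M d -> cdom c p0 -> cdom d (bproj p0) ->
  exists V L, [/\ [/\ open V, V (cfun c p0) & V `<=` cfun c @` cdom c],
    forall k u, Ck k V (L^~ u) &
    forall p, cdom c p -> V (cfun c p) -> [/\ cdom d (bproj p),
      linear (L (cfun c p) : 'rV[R]_m -> 'rV[R]_m.+1) &
      forall u, dchart c d (@bproj _ _ _ P) p (L (cfun c p) u) = u]].
Proof.
move=> ac ad cp dp; have [U [Phi [g [Up tr]]]] := trivializationP P (bproj p0).
pose rl := chart_at ((Phi p0).2 : RL).
pose e : chart ('rV[R]_m * R)%type (prod_manifold M RL) := prod_chart d rl.
have ae : atlas (prod_manifold M RL) e.
  by apply: prod_chart_atlas => //; exact: chart_at_atlasP.
have [[oU sPhi sg oA oB] Tp _ _] := tr; have [p1 p2 p3] := Tp p0 Up.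
have ep : cdom e (Phi p0) by split; [rewrite p1|exact: (@chart_at_domP _ _ RL)].
have fs : chart_smooth c e Phi p0 by exact: (smooth_map_on_chart oA sPhi).
have gs : chart_smooth e c g (Phi p0).
  by apply: (smooth_map_on_chart oB sg); rewrite ?p3//; split => //; rewrite p1.
have [V0 [oV0 V0x V0c V0d sV0]] := chart_smooth_shrink oA Up cp fs.
have [W [oW Wx Wc Wd sW]] := gs.
pose V := V0 `&` (cfun e \o Phi \o cinv c) @^-1` W.
have oV : open V := open_setI_preimage oV0 (sV0 0%N) oW.
have VU y : V y -> exists2 p, cdom c p /\ U (bproj p) & cfun c p = y.
  by move=> [/V0c [p [cp' Up'] <-] _]; exists p.
exists V, (fun y u => 'd (cfun c \o g \o cinv e) ((cfun e \o Phi \o cinv c) y) (u, 0)).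
split.
- split => //; first by split => //=; rewrite cfunKE.
  by move=> y [/V0c [p [cp' _] <-] _]; exists p.
- move=> k u; apply: (Ck_diff (V := W)) => //.
  + by move=> y [].
  + by apply: (CkW _ (sV0 k)) => y [].
  + exact: Ck_cst.
move=> p cp' Vp; have [q [cq Uq] qp] := VU _ Vp.
have {}Uq : U (bproj p) by rewrite -(cfunKE cp') -qp cfunKE.
have dp' : cdom d (bproj p).
  have [p1' _ _] := Tp p Uq.
  by have [] := V0d _ Vp.1; rewrite cfunKE// p1'.
split => //.
  move=> t u v.
  have -> : (t *: u + v, 0) = t *: (u, 0) + (v, 0) :> 'rV[R]_m * R.
    by congr (_, _); rewrite /= scaler0 addr0.
  exact: linearP.
move=> u; have := dchart_bproj_trivialization tr Uq ac ad cp' dp' (u, 0).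
rewrite (chart_at_real _ (Phi p0).2) -/rl -/e => E.
have y : (cfun e \o Phi \o cinv c) (cfun c p) = cfun e (Phi p) by rewrite /= cfunKE.
by rewrite y -dchartE.
Qed.

End Tangent.

(* In trivializations an equivariant map over the identity is
   (x, s) |-> (x, s * r x), with inverse (x, s) |-> (x, s / r x). *)
Lemma equivariant_diffeo (P Q : principal_bundle M) (phi : P -> Q) :
  smooth_map phi -> (forall p, bproj (phi p) = bproj p) ->
  (forall (s : R) p, s != 0 -> phi (bact s p) = bact s (phi p)) ->
  diffeo_on setT setT phi.
Proof.
move=> sphi phib phie.
pose r x Phi' (g : prod_manifold M RL -> P) : R := (Phi' (phi (g (x, 1 : R))) : prod_manifold M RL).2.
have loc x : exists U Phi g U' Phi' g', [/\ U x, U' x,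
    trivialization (P := P) U Phi g & trivialization (P := Q) U' Phi' g'].
  have [U [Phi [g [Ux tr]]]] := trivializationP P x.
  have [U' [Phi' [g' [Ux' tr']]]] := trivializationP Q x.
  by exists U, Phi, g, U', Phi', g'.
have key U Phi g U' Phi' g' (tr : trivialization (P := P) U Phi g)
    (tr' : trivialization (P := Q) U' Phi' g') x (s : R) : U x -> U' x -> s != 0 ->
    r x Phi' g != 0 /\ phi (g (x, s)) = g' (x, s * r x Phi' g).
  move=> Ux Ux' s0; have [_ Tp Tg Te] := tr; have [_ Tp' Tg' Te'] := tr'.
  have [b1 _ _] := Tg x 1 Ux (oner_neq0 R).
  have b2 : bproj (phi (g (x, 1 : R))) = x by rewrite phib.
  have Ub : U' (bproj (phi (g (x, 1 : R)))) by rewrite b2.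
  have [q1 q2 q3] := Tp' _ Ub; split => //.
  rewrite -[s in LHS]mulr1 (trivialization_section tr)// ?oner_neq0// phie//.
  rewrite (trivialization_section tr')//; congr bact.
  by rewrite -[LHS]q3 [Phi' _]surjective_pairing q1 b2.
have phi_inj : injective phi.
  move=> p p' e; have eb : bproj p = bproj p' by rewrite -!phib e.
  have [U [Phi [g [U' [Phi' [g' [Ux Ux' tr tr']]]]]]] := loc (bproj p).
  have [_ Tp Tg Te] := tr; have [_ Tp' Tg' Te'] := tr'.
  have Ux2 : U (bproj p') by rewrite -eb.
  have [p1 p2 p3] := Tp p Ux; have [p1' p2' p3'] := Tp p' Ux2.
  have e1 : p = g (bproj p, (Phi p).2) by rewrite -[LHS]p3 -p1 -surjective_pairing.
  have e2 : p' = g (bproj p, (Phi p').2) by rewrite eb -[LHS]p3' -p1' -surjective_pairing.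
  have [r0 f1] := key _ _ _ _ _ _ tr tr' _ _ Ux Ux' p2.
  have [_ f2] := key _ _ _ _ _ _ tr tr' _ _ Ux Ux' p2'.
  rewrite -e1 in f1; rewrite -e2 in f2.
  have [_ _ g1] := Tg' _ _ Ux' (mulf_neq0 p2 r0).
  have [_ _ g2] := Tg' _ _ Ux' (mulf_neq0 p2' r0).
  rewrite e1 e2; congr (g (_, _)); apply: (mulIf r0).
  by rewrite -g1 -g2 -f1 -f2 e.
have inv_loc (q : Q) U Phi g U' Phi' g' (tr : trivialization (P := P) U Phi g)
    (tr' : trivialization (P := Q) U' Phi' g') : U (bproj q) -> U' (bproj q) ->
    phi (g (bproj q, (Phi' q).2 / r (bproj q) Phi' g)) = q.
  move=> Ux Ux'; have [_ Tp Tg Te] := tr; have [_ Tp' Tg' Te'] := tr'.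
  have [q1 q2 q3] := Tp' q Ux'.
  have [r0 _] := key _ _ _ _ _ _ tr tr' _ _ Ux Ux' (oner_neq0 R).
  have [|_ ->] := key _ _ _ _ _ _ tr tr' _ ((Phi' q).2 / r (bproj q) Phi' g) Ux Ux'.
    by rewrite mulf_neq0// invr_eq0.
  by rewrite divfK// -q1 -surjective_pairing.
(* The inverse is chosen pointwise; the injectivity of phi identifies it locally with the smooth
   formula of [inv_loc]. *)
have /choice [psi psiK] : forall q, exists p, phi p = q.
  move=> q; have [U [Phi [g [U' [Phi' [g' [Ux Ux' tr tr']]]]]]] := loc (bproj q).
  by eexists; exact: (inv_loc _ _ _ _ _ _ _ tr tr').
exists psi; split => //; last by split => x _ //; apply: phi_inj; rewrite psiK.
apply: smooth_map_on_local; first exact: openT.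
move=> q _; have [U [Phi [g [U' [Phi' [g' [Ux Ux' tr tr']]]]]]] := loc (bproj q).
have [[oU sPhi sg oA oB] Tp Tg Te] := tr.
have [[oU' sPhi' sg' oA' oB'] Tp' Tg' Te'] := tr'.
pose A := @bproj _ _ _ Q @^-1` (U `&` U').
have oAQ : open A by apply: open_preimage_bproj; exact: openI.
exists A; split => //.
have sb : smooth_map_on A (@bproj _ _ _ Q).
  by apply: (smooth_map_onW oAQ (@openT _) _ (bproj_smooth Q)).
have s1 : smooth_map_on (N := prod_manifold M RL) A (fun q => (bproj q, 1 : R)).
  by apply: smooth_map_on_pair => //; exact: smooth_map_on_cst.
have s2 : smooth_map_on A (g \o (fun q => (bproj q, 1 : R))).
  apply: (smooth_map_on_comp oAQ oB _ s1 sg) => x [Ax _].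
  by split => //; exact: oner_neq0.
have s3 : smooth_map_on A (phi \o (g \o (fun q => (bproj q, 1 : R)))).
  exact: (smooth_map_on_comp oAQ (@openT _) _ s2 sphi).
have s4 : smooth_map_on A (Phi' \o (phi \o (g \o (fun q => (bproj q, 1 : R))))).
  apply: (smooth_map_on_comp oAQ oA' _ s3 sPhi') => x [Ax Ax'] /=.
  by rewrite phib; have [-> _ _] := Tg _ _ Ax (oner_neq0 R).
have s5 : smooth_map_on (N := RL) A (fun q => r (bproj q) Phi' g).
  exact: (smooth_map_on_comp oAQ (@openT _) _ s4 (@smooth_snd _ _ _ M RL)).
have s6 : smooth_map_on (N := RL) A (fun q => (r (bproj q) Phi' g)^-1).
  apply: smooth_real_inv => // x [Ax Ax'].
  by have [] := key _ _ _ _ _ _ tr tr' _ _ Ax Ax' (oner_neq0 R).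
have s7 : smooth_map_on A Phi'.
  by apply: (smooth_map_onW oAQ oA' _ sPhi') => x [].
have s8 : smooth_map_on (N := RL) A (fun q => (Phi' q).2).
  exact: (smooth_map_on_comp oAQ (@openT _) _ s7 (@smooth_snd _ _ _ M RL)).
have s9 := smooth_map_on_pair oAQ sb (smooth_real_mul oAQ s8 s6).
have s10 : smooth_map_on A (g \o (fun q => (bproj q, (Phi' q).2 / r (bproj q) Phi' g))).
  apply: (smooth_map_on_comp oAQ oB _ s9 sg) => x [Ax Ax']; split => //=.
  have [r0 _] := key _ _ _ _ _ _ tr tr' _ _ Ax Ax' (oner_neq0 R).
  by have [_ q2 _] := Tp' x Ax'; rewrite mulf_neq0// invr_eq0.
apply: (smooth_map_on_eq oAQ s10) => x [Ax Ax'].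
by apply: phi_inj; rewrite psiK; exact: (inv_loc _ _ _ _ _ _ _ tr tr').
Qed.

End Trivializations.

(** * The lift of a symplectic bundle to the cotangent bundle *)

Section CartanFormula.
Context {R : realType}.
Implicit Types E F : normedModType R.

Lemma diff_pairlE E F (c : F) (y v : E) : 'd (fun y => (y, c)) y v = (v, 0).
Proof.
apply: etrans (diff_pairE v (differentiable_idE _) (differentiable_cst _ _)) _.
by congr (_, _); [exact: diff_idE|exact: diff_cstE].
Qed.

Lemma diff_pairrE E F (c : F) (y v : E) : 'd (fun y => (c, y)) y v = (0, v).
Proof.
apply: etrans (diff_pairE v (differentiable_cst _ _) (differentiable_idE _)) _.
by congr (_, _); [exact: diff_cstE|exact: diff_idE].
Qed.

(** Schwarz's theorem coordinate by coordinate, for the flow of the action, whose values are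
    vectors. *)
Lemma diff_diffC_row E n (U : set E) (f : E -> 'rV[R]_n) (x u v : E) :
  open U -> Ck 2 U f -> U x ->
  'd (fun y => 'd f y u) x v = 'd (fun y => 'd f y v) x u.
Proof.
move=> oU C2 Ux; apply/rowP => i.
pose l (w : 'rV[R]_n) : R := w 0 i.
have ll : linear (l : _ -> R^o) by move=> t a b; rewrite /l !mxE.
have cl : continuous l by move=> w; exact: coord_continuous.
have C1 w : Ck 1 U (fun z => 'd f z w).
  by apply: (Ck_diff (V := U)) => //; [exact: Ck_id|exact: Ck_cst].
have e w z : U z -> l ('d f z w) = 'd (fun z => f z 0 i) z w.
  move=> Uz; have df := Ck_differentiable C2 Uz.
  have dl := differentiable_linear (f z) ll cl.
  apply: esym; apply: etrans (diff_compE w df dl) _.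
  exact: (diff_linearE _ _ ll cl).
have e2 w t : 'd (fun z => 'd (fun z => f z 0 i) z w) x t = l ('d (fun z => 'd f z w) x t).
  have dw := Ck_differentiable (C1 w) Ux.
  have dl := differentiable_linear ('d f x w) ll cl.
  apply: etrans (diff_openE _ oU Ux (e w) (differentiable_comp dw dl)) _.
  apply: etrans (diff_compE t dw dl) _.
  exact: (diff_linearE _ _ ll cl).
have := diff_diffC u v oU (Ck_coord 0 i oU C2) Ux.
by rewrite !e2.
Qed.

Section TwoForms.
Context {n : nat}.
Local Notation V := 'rV[R]_n.

(* A 2-form on an open subset U of V: w y u v is its value at y on (u, v). *)
Definition form2_on (U : set V) (w : V -> V -> V -> R) :=
  [/\ forall k u v, Ck k U (fun y => w y u v),
      forall y v, U y -> linear ((fun u => w y u v) : V -> R^o),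
      forall y u, U y -> linear (w y u : V -> R^o) &
      forall y u, U y -> w y u u = 0].

Lemma form2N (U : set V) w y u v : form2_on U w -> U y -> w y u v = - w y v u.
Proof.
move=> [_ ll lr w0] Uy; apply/eqP; rewrite -addr_eq0; apply/eqP.
have := w0 y (u + v) Uy; rewrite (functionalD (ll _ _ Uy)) !(functionalD (lr _ _ Uy)).
by rewrite !w0// add0r addr0.
Qed.

Lemma form2_Ck k (U : set V) w : open U -> form2_on U w ->
  Ck k ((U `*` setT) `*` setT) (fun p : (V * V) * V => w p.1.1 p.1.2 p.2).
Proof.
move=> oU [Cw ll lr _].
apply: (Ck_row_linear (f := fun (p : V * V) (v : V) => w p.1 p.2 v)).
- exact: open_setXT.
- by move=> [y u] [/= Uy _]; exact: lr.
- move=> v; apply: (Ck_row_linear (f := fun y u => w y u v)) => //.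
  by move=> y Uy; exact: ll.
Qed.

(** Product rule for an expression bilinear in two vectors that vary with the point: the increment
    splits into three, and in each vector the form is its own derivative. *)
Lemma diff_form2 E (U : set V) w (h a b : E -> V) z t : open U -> form2_on U w ->
  U (h z) -> differentiable h z -> differentiable a z -> differentiable b z ->
  'd (fun z => w (h z) (a z) (b z)) z t =
  'd (fun y => w y (a z) (b z)) (h z) ('d h z t) + w (h z) ('d a z t) (b z) +
  w (h z) (a z) ('d b z t).
Proof.
move=> oU fw Uz dh da db; have [Cw ll lr w0] := fw.
pose T (p : (V * V) * V) := w p.1.1 p.1.2 p.2.
have CT k : Ck k ((U `*` setT) `*` setT) T by exact: form2_Ck.
pose q : (V * V) * V := ((h z, a z), b z).
have Uq : ((U `*` setT) `*` setT) q by [].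
have dT := Ck_differentiable (CT 1%N) Uq.
have dha := differentiable_pair dh da.
have dq := differentiable_pair dha db.
have eq : 'd (fun z => ((h z, a z), b z)) z t = (('d h z t, 'd a z t), 'd b z t).
  by rewrite (diff_pairE t dha db) (diff_pairE t dh da).
suff key u a' b' : 'd T q ((u, a'), b') =
    'd (fun y => w y (a z) (b z)) (h z) u + w (h z) a' (b z) + w (h z) (a z) b'.
  apply: etrans (diff_compE (g := T) t dq dT) _.
  exact: etrans (congr1 ('d T q) eq) (key _ _ _).
have -> : ((u, a'), b') = ((u, 0), 0) + ((0, a'), 0) + ((0, 0), b') :> (V * V) * V.
  by congr (_, _, _); rewrite /= ?addr0 ?add0r ?addr0.
have Dadd p r : 'd T q (p + r) = 'd T q p + 'd T q r by exact: linearD.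
rewrite !Dadd; congr (_ + _ + _).
- have d1 : differentiable (fun y : V => ((y, a z), b z)) (h z).
    exact: (differentiable_pair (differentiable_pair (differentiable_idE _) (differentiable_cst _ _)) (differentiable_cst _ _)).
  apply: etrans _ (esym (diff_compE (f := fun y => ((y, a z), b z)) u d1 dT)).
  have d2 : differentiable (fun y : V => (y, a z)) (h z).
    exact: (differentiable_pair (differentiable_idE _) (differentiable_cst _ _)).
  apply: congr1; apply: esym.
  apply: etrans (diff_pairE u d2 (differentiable_cst _ _)) _.
  by congr (_, _); [exact: diff_pairlE|exact: diff_cstE].
- have d2 : differentiable (fun y : V => (h z, y)) (a z).
    exact: (differentiable_pair (differentiable_cst _ _) (differentiable_idE _)).
  have d1 : differentiable (fun y : V => ((h z, y), b z)) (a z).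
    exact: (differentiable_pair d2 (differentiable_cst _ _)).
  have cl : continuous (fun y => w (h z) y (b z)).
    move=> y; have dTy : differentiable T ((h z, y), b z).
      exact: (Ck_differentiable (CT 1%N)).
    have dp : differentiable (fun y : V => ((h z, y), b z)) y.
      exact: (differentiable_pair (differentiable_pair (differentiable_cst _ _) (differentiable_idE _)) (differentiable_cst _ _)).
    exact: differentiable_continuous (differentiable_comp dp dTy).
  apply: etrans _ (diff_linearE (a z) a' (ll _ (b z) Uz) cl).
  apply: etrans _ (esym (diff_compE (f := fun y => ((h z, y), b z)) a' d1 dT)).
  apply: congr1; apply: esym.
  apply: etrans (diff_pairE a' d2 (differentiable_cst _ _)) _.
  by congr (_, _); [exact: diff_pairrE|exact: diff_cstE].
- have d1 : differentiable (fun y : V => ((h z, a z), y)) (b z).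
    exact: (differentiable_pair (differentiable_cst _ _) (differentiable_idE _)).
  have cl : continuous (w (h z) (a z)).
    move=> y; have dTy : differentiable T ((h z, a z), y).
      exact: (Ck_differentiable (CT 1%N)).
    have dp : differentiable (fun y : V => ((h z, a z), y)) y.
      exact: (differentiable_pair (differentiable_cst _ _) (differentiable_idE _)).
    exact: differentiable_continuous (differentiable_comp dp dTy).
  apply: etrans _ (diff_linearE (b z) b' (lr _ (a z) Uz) cl).
  apply: etrans _ (esym (diff_compE (f := fun y => ((h z, a z), y)) b' d1 dT)).
  by apply: congr1; exact: esym (diff_pairrE _ _ _).
Qed.

(* Cartan's formula for a closed form scaled by the flow H: d(i_D w) is the
   derivative at s = 1 of the pullback of w by H(s, .), that is of s w. *)
Lemma cartan_homogeneous (U : set V) w (W : set (R * V)) (H : R * V -> V) y0 u v :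
  open U -> form2_on U w -> U y0 -> open W -> Ck 3 W H -> W (1, y0) ->
  (forall p, W p -> U (H p)) ->
  (forall y, W (1, y) -> H (1, y) = y) ->
  (forall s a b, W (s, y0) ->
     w (H (s, y0)) ('d H ((s, y0) : R * V) (0, a)) ('d H ((s, y0) : R * V) (0, b)) = s * w y0 a b) ->
  (forall a b c, 'D_a (fun y => w y b c) y0 - 'D_b (fun y => w y a c) y0 +
     'D_c (fun y => w y a b) y0 = 0) ->
  curl (fun y => w y ('d H ((1, y) : R * V) (1, 0))) y0 u v = w y0 u v.
Proof.
move=> oU fw Uy0 oW CH W1 WU H1 Hw closed; have [Cw ll lr w0] := fw.
pose D y := 'd H ((1, y) : R * V) (1, 0).
have oW1 : open [set y : V | W (1, y)].
  apply: (open_comp (f := fun y : V => (1 : R, y)) _ oW) => y _.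
  exact: differentiable_continuous (differentiable_pair (differentiable_cst _ _) (differentiable_idE _)).
have oWs : open [set s : R | W (s, y0)].
  apply: (open_comp (f := fun s : R => (s, y0)) _ oW) => s _.
  exact: differentiable_continuous (differentiable_pair (differentiable_idE _) (differentiable_cst _ _)).
have C1 (t : R * V) : Ck 2 W (fun p => 'd H p t).
  by apply: (Ck_diff (V := W)) => //; [exact: Ck_id|exact: Ck_cst].
have dHt t := Ck_differentiable (C1 t) W1.
have dy1 : differentiable (fun y : V => (1 : R, y)) y0.
  exact: (differentiable_pair (differentiable_cst _ _) (differentiable_idE _)).
have ds1 : differentiable (fun s : R => (s, y0)) (1 : R).
  exact: (differentiable_pair (differentiable_idE _) (differentiable_cst _ _)).
have ey1 a : 'd (fun y : V => (1 : R, y)) y0 a = (0, a) by exact: diff_pairrE.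
have es1 : 'd (fun s : R => (s, y0)) (1 : R) (1 : R) = (1, 0) by exact: diff_pairlE.
have dD : differentiable D y0 by exact: (differentiable_comp dy1 (dHt (1, 0))).
pose X a := 'd D y0 a.
have XE a : X a = 'd (fun p : R * V => 'd H p (1, 0)) ((1, y0) : R * V) (0, a).
  by apply: etrans (diff_compE a dy1 (dHt (1, 0))) _; rewrite ey1.
have D1 a b : 'd (fun y => w y (D y) b) y0 a =
    'd (fun y => w y (D y0) b) y0 a + w y0 (X a) b.
  apply: etrans (diff_form2 (h := fun y => y) (b := fun=> b) a oU fw Uy0
    (differentiable_idE _) dD (differentiable_cst _ _)) _.
  apply: etrans (congr2 (fun p q : V => 'd (fun y => w y (D y0) b) y0 p +
    w y0 (X a) b + w y0 (D y0) q) (diff_idE y0 a) (diff_cstE b y0 a)) _.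
  by rewrite (functional0 (lr y0 (D y0) Uy0)) addr0.
have dwD b : differentiable (fun y => w y (D y) b) y0.
  have CT := form2_Ck 1 oU fw.
  apply: (differentiable_comp (f := fun y => ((y, D y), b))
    (g := fun p : (V * V) * V => w p.1.1 p.1.2 p.2)).
    exact: (differentiable_pair (differentiable_pair (differentiable_idE _) dD) (differentiable_cst _ _)).
  exact: (Ck_differentiable CT).
have dw a b : differentiable (fun y => w y a b) y0 by exact: (Ck_differentiable (Cw 1%N a b)).
have A1 a : 'd H ((1, y0) : R * V) (0, a) = a.
  have dH := Ck_differentiable CH W1.
  rewrite -ey1; apply: etrans (esym (diff_compE a dy1 dH)) _.
  apply: etrans (diff_openE (f := fun y => y) a oW1 W1 _ (differentiable_idE _)) _.
    by move=> y Wy; rewrite H1.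
  exact: diff_idE.
(* Schwarz's theorem for H: at s = 1 the s-derivative of the linearized flow is the derivative X of
   the generator D. *)
have A2 a : differentiable (fun s : R => 'd H ((s, y0) : R * V) (0, a)) (1 : R) /\
    'd (fun s : R => 'd H ((s, y0) : R * V) (0, a)) (1 : R) (1 : R) = X a.
  split; first exact: (differentiable_comp ds1 (dHt (0, a))).
  apply: etrans (diff_compE (1 : R) ds1 (dHt (0, a))) _; rewrite es1 XE.
  exact: (diff_diffC_row _ _ oW (Ck_le (isT : (2 <= 3)%N) CH) W1).
(* The s-derivative at 1 of the pullback of w, by the product rule; [phi'] computes the same number
   from homogeneity. *)
have phi : 'd (fun s : R => w (H (s, y0)) ('d H ((s, y0) : R * V) (0, u)) ('d H ((s, y0) : R * V) (0, v))) (1 : R) (1 : R)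
    = 'd (fun y => w y u v) y0 (D y0) + w y0 (X u) v + w y0 u (X v).
  have dH := Ck_differentiable CH W1.
  have dh := differentiable_comp ds1 dH.
  have UH : U (H (1, y0)) by exact: WU.
  have [du eu] := A2 u; have [dv ev] := A2 v.
  apply: etrans (diff_form2 (h := fun s : R => H (s, y0)) (1 : R) oU fw UH dh du dv) _.
  have eh : 'd (fun s : R => H (s, y0)) (1 : R) (1 : R) = D y0.
    apply: etrans (diff_compE (1 : R) ds1 dH) _.
    exact: (congr1 ('d H ((1, y0) : R * V)) es1).
  pose f (p a b a' b' t : V) := 'd (fun y => w y a b) p t + w p a' b + w p a b'.
  have fE p a b a' b' t q c d c' d' t' : p = q -> a = c -> b = d -> a' = c' ->
      b' = d' -> t = t' -> f p a b a' b' t = f q c d c' d' t'.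
    by move=> -> -> -> -> -> ->.
  exact: (fE _ _ _ _ _ _ _ _ _ _ _ _ (H1 y0 W1) (A1 u) (A1 v) eu ev eh).
have phi' : 'd (fun s : R => w (H (s, y0)) ('d H ((s, y0) : R * V) (0, u)) ('d H ((s, y0) : R * V) (0, v))) (1 : R) (1 : R)
    = w y0 u v.
  pose l (s : R) := s * w y0 u v.
  have ll' : linear (l : R -> R^o).
    by move=> t a b; rewrite /l mulrDl /GRing.scale /= mulrA.
  have cl : continuous l.
    move=> z; have oT := @openT R.
    exact: (Ck_mul oT (Ck_id 0 oT) (Ck_cst 0 (w y0 u v) oT)).
  apply: etrans (diff_openE (f := l) (1 : R) oWs W1 _ (differentiable_linear _ ll' cl)) _.
    by move=> s Ws; rewrite Hw.
  by apply: etrans (diff_linearE _ _ ll' cl) _; exact: mul1r.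
have cE : curl (fun y => w y (D y)) y0 u v =
    'd (fun y => w y (D y0) v) y0 u + w y0 (X u) v -
    ('d (fun y => w y (D y0) u) y0 v + w y0 (X v) u).
  exact: (congr2 (fun p q : R => p - q) (etrans (deriveE u (dwD v)) (D1 u v))
    (etrans (deriveE v (dwD u)) (D1 v u))).
(* Closedness on D, u, v trades the derivative of w along D for terms of the curl. *)
have cl : 'd (fun y => w y u v) y0 (D y0) - 'd (fun y => w y (D y0) v) y0 u +
    'd (fun y => w y (D y0) u) y0 v = 0.
  apply: etrans _ (closed (D y0) u v).
  exact: (congr2 (fun p q : R => p + q) (congr2 (fun p q : R => p - q)
    (esym (deriveE (D y0) (dw u v))) (esym (deriveE u (dw (D y0) v))))
    (esym (deriveE v (dw (D y0) u)))).
have alg (p q r s t t2 : R) : p - q + r = 0 -> t2 = - t ->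
    q + s - (r + t2) = p + s + t.
  by move=> e ->; rewrite -[LHS]addr0 -e; ring.
apply: etrans cE _.
apply: etrans (alg _ _ _ _ _ _ cl (form2N (X v) u fw Uy0)) _.
exact: etrans (esym phi) phi'.
Qed.

End TwoForms.

End CartanFormula.

(** * Contraction of the symplectic form with the generator *)

Section SymplecticBundles.
Context {R : realType} {m : nat} {M : manifold 'rV[R]_m}.
Local Notation RL := (@real_line R).

Section EulerForm.
Context (P : symplectic_bundle M).

Lemma sform_alternating p : alternating (sform P p).
Proof. by have [_ [aw _] _ _] := sform_symplectic P; exact: aw. Qed.

Definition euler_form : dform P 1 :=
  fun p v => sform P p (pair2 (euler p) (v ord0)).

Let w (c : chart 'rV[R]_m.+1 P) y u v := form_in (sform P) c y (pair2 u v).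

Let form2_sform c : atlas P c -> form2_on (cfun c @` cdom c) (w c).
Proof.
move=> ac; have [_ [_ sw] _ _] := sform_symplectic P; split.
- move=> k u v; have := sw c ac (pair2 u v) k; by rewrite setIT.
- move=> _ v [p cp <-] t a b; rewrite /w !form_inE// !pair2_map dchart_linear.
  by have [ll _ _] := alternating2P (sform_alternating p); exact: ll.
- move=> _ u [p cp <-] t a b; rewrite /w !form_inE// !pair2_map dchart_linear.
  by have [_ lr _] := alternating2P (sform_alternating p); exact: lr.
- move=> _ u [p cp <-]; rewrite /w !form_inE// !pair2_map.
  by have [_ _ ->] := alternating2P (sform_alternating p).
Qed.

(** H is the action read in the chart c near (1, p0). Its partial derivatives are identified with
    the tangent maps of the action and, at s = 1, with the generator, which thereby becomes a smooth
    vector field in a fixed chart. *)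
Let flow_chart c p0 : atlas P c -> cdom c p0 ->
  exists (W : set (R * 'rV[R]_m.+1)) (H : R * 'rV[R]_m.+1 -> 'rV[R]_m.+1),
  [/\ open W, W (1, cfun c p0), forall k, Ck k W H,
    forall s y, W (s, y) -> [/\ s != 0, (cfun c @` cdom c) y &
      (cfun c @` cdom c) (H (s, y))] &
    forall s q, cdom c q -> W (s, cfun c q) ->
      [/\ cdom c (bact s q), H (s, cfun c q) = cfun c (bact s q),
        forall a, 'd H ((s, cfun c q) : R * 'rV[R]_m.+1) (0, a) =
          dchart c c (@bact _ _ _ P s) q a &
        s = 1 -> 'd H ((s, cfun c q) : R * 'rV[R]_m.+1) (1, 0) =
          dchart (chart_at q) c id q (euler q)]].
Proof.
move=> ac cp; pose rl := chart_at (1 : RL).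
have [rd rf ri] := real_lineP (chart_at_atlasP (1 : RL)).
pose e : chart (R * 'rV[R]_m.+1)%type (prod_manifold RL P) := prod_chart rl c.
have ae : atlas (prod_manifold RL P) e.
  by apply: prod_chart_atlas => //; exact: chart_at_atlasP.
pose act (sp : prod_manifold RL P) := bact sp.1 sp.2.
pose A := [set sp : prod_manifold RL P | sp.1 != 0].
have Ap : A ((1 : R), p0) by exact: oner_neq0.
have ep : cdom e ((1 : R), p0) by split => //=; rewrite rd.
have fs : chart_smooth e c act ((1 : R), p0).
  have sa : smooth_map_on A act := bact_smooth P.
  have ca : cdom c (act ((1 : R), p0)) by rewrite /act /= bact1.
  exact (smooth_map_on_chart (@open_act _ _ _ P) sa Ap ae ac ep ca).
have [V [oV Vx Vc Vd sV]] := chart_smooth_shrink (@open_act _ _ _ P) Ap ep fs.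
pose H := cfun c \o act \o cinv e.
have HE s y : H (s, y) = cfun c (bact s (cinv c y)) by rewrite /H /= ri.
exists V, H; split => //.
- by have := Vx; rewrite /= rf.
- move=> s y Vsy; have [[t q] [[/= _ cq] t0] ety] := Vc _ Vsy.
  move: ety Vsy; rewrite /= rf => -[<- <-] Vsy; split => //; first by exists q.
  by have := Vd _ Vsy; rewrite HE /act /= ri cfunKE// => ?; exists (bact t q).
move=> s q cq Vsq; have := Vd _ Vsq; rewrite /act /= ri cfunKE// => cs.
have s0 : s != 0.
  by have [[t q'] [_ t0] ety] := Vc _ Vsq; move: ety; rewrite /= rf => -[<- _].
have dH : differentiable H (s, cfun c q) by exact: (Ck_differentiable (sV 1%N)).
split => //; first by rewrite HE cfunKE.
- move=> a; rewrite dchartE.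
  have dp : differentiable (fun y : 'rV[R]_m.+1 => (s, y)) (cfun c q).
    exact: (differentiable_pair (differentiable_cst _ _) (differentiable_idE _)).
  apply: esym; apply: etrans _ (etrans (diff_compE (f := fun y => (s, y)) a dp dH)
    (congr1 ('d H ((s, cfun c q) : R * 'rV[R]_m.+1)) (diff_pairrE s (cfun c q) a))).
  have eH : cfun c \o @bact _ _ _ P s \o cinv c = fun y => H (s, y).
    by apply/funext => y; rewrite HE.
  exact: (congr1 (fun f : 'rV[R]_m.+1 -> 'rV[R]_m.+1 => 'd f (cfun c q) a) eH).
- move=> s1; subst s; have ids := chart_smooth_id ac ac cq cq.
  have aq := chart_at_atlasP q; have qq := chart_at_domP q.
  have idq := chart_smooth_id aq ac qq cq.
  have e1 := euler_map ac cq ids; rewrite dchart_id// in e1.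
  apply: etrans _ (esym e1); rewrite dchartE rf ri.
  have dp : differentiable (fun t : R => (t, cfun c q)) (1 : R).
    exact: (differentiable_pair (differentiable_idE _) (differentiable_cst _ _)).
  apply: esym; apply: etrans _ (etrans (diff_compE (f := fun t => (t, cfun c q)) (1 : R) dp dH)
    (congr1 ('d H ((1, cfun c q) : R * 'rV[R]_m.+1)) (diff_pairlE (cfun c q) (1 : R) (1 : R)))).
  have eH : cfun c \o (id \o orbit_curve q) \o id = fun t => H (t, cfun c q).
    by apply/funext => t; rewrite HE cfunKE.
  exact: (congr1 (fun f : R -> 'rV[R]_m.+1 => 'd f (1 : R) (1 : R)) eH).
Qed.

Lemma euler_form_chart c p v : atlas P c -> cdom c p ->
  form1_in euler_form c (cfun c p) v =
  form_in (sform P) c (cfun c p) (pair2 (dchart (chart_at p) c id p (euler p)) v).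
Proof.
move=> ac cp; rewrite /form1_in !form_inE// /euler_form pair2_map dchart_idK//;
  by [exact: chart_at_atlasP|exact: chart_at_domP].
Qed.

(** [euler] is expressed at each point in the chart of that point, so nothing can be differentiated
    directly; replacing it by the s-derivative of the flow in one fixed chart gives both the
    smoothness of the contracted form and the hypotheses of Cartan's formula. *)
Let euler_form_local p0 : let c := chart_at p0 in
  exists (W : set (R * 'rV[R]_m.+1)) H (U : set 'rV[R]_m.+1),
  [/\ [/\ open U, U (cfun c p0) & U `<=` cfun c @` cdom c],
    forall k, form1_on k U (fun y => w c y ('d H ((1, y) : R * 'rV[R]_m.+1) (1, 0))),
    forall y v, U y -> w c y ('d H ((1, y) : R * 'rV[R]_m.+1) (1, 0)) v =
      form1_in euler_form c y v &
    forall u v, curl (fun y => w c y ('d H ((1, y) : R * 'rV[R]_m.+1) (1, 0)))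
      (cfun c p0) u v = w c (cfun c p0) u v].
Proof.
move=> c; have ac : atlas P c := chart_at_atlasP p0.
have cp : cdom c p0 := chart_at_domP p0.
have [W [H [oW W1 sW Wc WH]]] := flow_chart ac cp.
have fw := form2_sform ac; have oc := cimg_open c.
pose U := [set y : 'rV[R]_m.+1 | W (1, y)].
have oU : open U.
  apply: (open_comp (f := fun y : 'rV[R]_m.+1 => (1 : R, y)) _ oW) => y _.
  exact: differentiable_continuous (differentiable_pair (differentiable_cst _ _) (differentiable_idE _)).
have Uc : U `<=` cfun c @` cdom c by move=> y /Wc [].
exists W, H, U; split => //.
- move=> k.
  have Clin : Ck k (U `*` setT) (fun p : 'rV[R]_m.+1 * 'rV[R]_m.+1 =>
      w c p.1 ('d H ((1, p.1) : R * 'rV[R]_m.+1) (1, 0)) p.2).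
    apply: (Ck_row_linear (f := fun y v => w c y ('d H ((1, y) : R * 'rV[R]_m.+1) (1, 0)) v)) => //.
      by have [_ _ lr _] := fw => y Uy; apply: lr; exact: Uc.
    move=> v.
    have CD : Ck k U (fun y => 'd H ((1, y) : R * 'rV[R]_m.+1) (1, 0)).
      apply: (Ck_diff (V := W) (a := fun y => (1 : R, y)) (b := fun=> (1, 0))) => //.
      - exact: (Ck_pair oU (Ck_cst k (1 : R) oU) (Ck_id k oU)).
      - exact: Ck_cst.
    have C3 := Ck_pair oU (Ck_pair oU (Ck_id k oU) CD) (Ck_cst k v oU).
    have oT := open_setXT (T := 'rV[R]_m.+1) (open_setXT (T := 'rV[R]_m.+1) oc).
    have sub : U `<=` (fun y => ((y, 'd H ((1, y) : R * 'rV[R]_m.+1) (1, 0)), v)) @^-1`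
      (((cfun c @` cdom c) `*` setT) `*` setT).
      by move=> y Uy; split => //; split => //; exact: Uc.
    exact: (Ck_comp oU oT sub C3 (form2_Ck k oc fw)).
  split => //.
  by have [_ _ lr _] := fw => y Uy; apply: lr; exact: Uc.
- move=> y v Uy; have [q cq yq] := Uc _ Uy; move: Uy; rewrite -yq => Uy.
  have [_ _ _ /(_ erefl) ->] := WH _ _ cq Uy.
  by rewrite euler_form_chart.
- move=> u v; apply: (cartan_homogeneous u v oc fw _ oW (sW 3%N) W1).
  + by exists p0.
  + by move=> [s y] /Wc [].
  + move=> y Wy; have [_ [q cq yq] _] := Wc _ _ Wy; move: Wy; rewrite -yq => Wy.
    by have [_ -> _ _] := WH _ _ cq Wy; rewrite bact1.
  + move=> s a b Ws; have [s0 _ _] := Wc _ _ Ws; have [cs Hs dHs _] := WH _ _ cp Ws.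
    rewrite Hs !dHs /w.
    have fs := smooth_map_chart (@act_smooth_at _ _ _ P s s0) ac ac cp cs.
    have fp := form_in_pullback (sform P) (pair2 a b) ac ac cp cs fs.
    apply: etrans (congr1 (form_in (sform P) c _) (esym (pair2_map _ a b))) _.
    apply: etrans (esym fp) _.
    apply: etrans (form_inE _ _ cp) _.
    apply: etrans (sform_homogeneous _ _ s0) _.
    exact: (congr1 ( *%R s) (esym (form_inE _ _ cp))).
  + move=> a b d; have [_ _ closed _] := sform_symplectic P.
    pose v3 (i : 'I_3) := if i == ord0 then a else if i == ord_max then d else b.
    by have := closed p0 v3; rewrite ext_derivative2E.
Qed.

Lemma euler_form_smooth1 p : smooth1_at euler_form p.
Proof.
have [W [H [U [[oU Up Uc] fU eU _]]]] := euler_form_local p.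
exists (chart_at p); split; [exact: chart_at_atlasP|exact: chart_at_domP|].
exists U; split => // k; have [C1 C2] := fU k; split.
  apply: Ck_eq C1; first exact: open_setXT.
  by move=> [y v] /set_mem [/= Uy _]; exact: eU.
by move=> y Uy t u v; rewrite -!eU//; exact: C2.
Qed.

Lemma ext_derivative_euler_form : ext_derivative euler_form = sform P.
Proof.
apply/funext => p; apply/funext => v.
have [W [H [U [[oU Up Uc] fU eU cE]]]] := euler_form_local p.
rewrite ext_derivative1E -(curl_eq _ _ oU Up (fU 1%N) eU) cE.
by rewrite [RHS]form_chart_at /w -pair2E.
Qed.

Lemma euler_form_vertical p v : tangent_map (@bproj _ _ _ P) p v = 0 ->
  euler_form p (fun=> v) = 0.
Proof.
move=> /tangent_bproj_vertical [t ->]; rewrite /euler_form.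
have [_ lr w0] := alternating2P (sform_alternating p).
by rewrite (functionalZ (lr _)) w0 mulr0.
Qed.

Lemma euler_form_linear p : linear ((fun v => euler_form p (fun=> v)) : _ -> R^o).
Proof. by have [_ lr _] := alternating2P (sform_alternating p); exact: lr. Qed.

(** The action preserves its generator, so the contraction inherits the homogeneity of the
    symplectic form. *)
Lemma euler_form_act p (s : R) v : s != 0 ->
  euler_form (bact s p) (fun=> tangent_map (@bact _ _ _ P s) p v) =
  s * euler_form p (fun=> v).
Proof.
move=> s0; rewrite /euler_form -tangent_act_euler// -sform_homogeneous//.
by rewrite /pullback pair2_map.
Qed.

End EulerForm.

Definition equivariant_lift (P : principal_bundle M) (iota : P -> cotangent M) :=
  [/\ smooth_map iota, forall p, cbase (iota p) = bproj p &
      forall (s : R) p, s != 0 -> iota (bact s p) = cscale s (iota p)].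

Lemma equivariant_lift_liouville (P : principal_bundle M) (iota : P -> cotangent M) :
  equivariant_lift iota -> forall p v, pullback iota (@liouville_form _ _ M) p v =
    ceval (iota p) (tangent_map (@bproj _ _ _ P) p (v ord0)).
Proof.
move=> [si bi _] p v.
apply: etrans (pullback_liouville v (@openT _) si I) _.
have -> : @cbase _ _ M \o iota = @bproj _ _ _ P by apply/funext => q; exact: bi.
by [].
Qed.

(* The generator of the action on T*M is (0, q) in the coordinates (x, q), and
   contracting it with d(q dx) gives back q dx. *)
Lemma equivariant_lift_euler (P : principal_bundle M) (iota : P -> cotangent M) :
  equivariant_lift iota -> forall p v,
  pullback iota (canonical_symplectic_form M) p (pair2 (euler p) v) =
  ceval (iota p) (tangent_map (@bproj _ _ _ P) p v).
Proof.
move=> li p v; have [si bi ei] := li.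
pose c := chart_at (cbase (iota p)).
have ac : atlas M c := chart_at_atlasP _.
have cp : cdom c (cbase (iota p)) := chart_at_domP _.
have r1 := chart_at_domP (1 : RL).
have [rd1 rf1 ri1] := real_lineP (chart_at_atlasP (1 : RL)).
have [ap pp] := (chart_at_atlasP p, chart_at_domP p).
have acc := cochart_atlas ac.
have si' : chart_smooth (chart_at p) (cochart ac) iota p.
  exact: smooth_map_chart.
have [aip pip] := (chart_at_atlasP (iota p), chart_at_domP (iota p)).
rewrite /pullback pair2_map (canonical_chart ac)//.
have T u : dchart (chart_at (iota p)) (cochart ac) id (iota p) (tangent_map iota p u)
    = dchart (chart_at p) (cochart ac) iota p u.
  by rewrite (dchart_tangent u ap acc pp cp si') dchart_id.
rewrite !T.
have Te : dchart (chart_at p) (cochart ac) iota p (euler p) = (0, cocoord c (iota p)).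
  have e1 := euler_map ap pp si'; rewrite dchart_id// in e1; rewrite e1.
  rewrite dchartE rf1 ri1.
  pose l (s : R) : 'rV[R]_m * 'cV[R]_m := (cfun c (cbase (iota p)), s *: cocoord c (iota p)).
  have onz := open_nonzero (R := R).
  have dl : differentiable (fun s : R => s *: cocoord c (iota p)) (1 : R) by [].
  apply: etrans (diff_openE (f := l) (1 : R) onz (oner_neq0 R) _ _) _.
  - move=> s s0; change (l s = cfun (cochart ac) (iota (bact s p))).
    by rewrite ei// cochart_fun cocoord_scale.
  - exact: (differentiable_pair (differentiable_cst _ _) dl).
  apply: etrans (diff_pairE (1 : R) (differentiable_cst _ _) dl) _.
  congr (_, _); first exact: diff_cstE.
  by rewrite diff_val scale1r.
rewrite Te /= mul0mx [X in _ - X]mxE subr0.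
have [sb db] := cbase_chart_smooth ac cp.
rewrite -db ceval_cocoord; congr (ceval (iota p) _).
have e2 := dchart_comp pp si' sb v.
rewrite -e2.
have -> : @cbase _ _ M \o iota = @bproj _ _ _ P by apply/funext => q; exact: bi.
have cp' : cdom c (bproj p) by rewrite -bi.
have sP := smooth_map_chart (bproj_smooth P) ap ac pp cp'.
rewrite tangent_mapE /c bi dchart_id//.
exact: chart_at_domP.
Qed.

End SymplecticBundles.

(** * The contact structure of a symplectic bundle *)

Section FromBundleToContact.
Context {R : realType} {m : nat} {M : manifold 'rV[R]_m}.
Local Notation RL := (@real_line R).

Lemma ceval_linear (xi : cotangent M) : linear (ceval xi : _ -> R^o).
Proof. by move=> t u v; rewrite /ceval mulmxDl -scalemxAl !mxE. Qed.

Lemma ceval_scale s (xi : cotangent M) v : ceval (cscale s xi) v = s * ceval xi v.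
Proof. by rewrite /ceval /cscale /= -scalemxAr mxE. Qed.

Lemma cotangent_eq (xi xi' : cotangent M) : cbase xi = cbase xi' ->
  (forall u, ceval xi u = ceval xi' u) -> xi = xi'.
Proof.
case: xi => x q; case: xi' => x' q'; rewrite /cbase /= => <- e.
congr (_, _); apply/colP => i.
have := e (delta_mx 0 i); rewrite /ceval /cvec /= -!rowE !mxE.
by [].
Qed.

Lemma cvec_neq0 (xi : cotangent M) : (exists u, ceval xi u != 0) -> cvec xi != 0.
Proof.
by move=> [u]; apply: contra_neq => q0; rewrite /ceval q0 mulmx0 mxE.
Qed.

Lemma cvec_neq0P (xi : cotangent M) : cvec xi != 0 -> exists u, ceval xi u != 0.
Proof.
move=> q0; apply: contrapT => /forallNP H; case/eqP: q0; apply/colP => i.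
have /negP/negPn/eqP := H (delta_mx 0 i).
by rewrite /ceval -rowE !mxE.
Qed.

Lemma same_fibre (P : principal_bundle M) (p q : P) : bproj p = bproj q ->
  exists2 s : R, s != 0 & q = bact s p.
Proof.
move=> pq; have [U [Phi [g [Up tr]]]] := trivializationP P (bproj p).
have Uq : U (bproj q) by rewrite -pq.
have [_ Tp _ _] := tr; have [_ p2 _] := Tp p Up; have [_ q2 _] := Tp q Uq.
exists ((Phi q).2 / (Phi p).2); first by rewrite mulf_neq0// invr_eq0.
apply: etrans (trivialization_fibre tr Uq) _.
apply: etrans _ (congr1 (bact _) (esym (trivialization_fibre tr Up))).
by rewrite bactM ?mulf_neq0 ?invr_eq0// divfK// pq.
Qed.

Lemma fibre_nonempty (P : principal_bundle M) x : exists p : P, bproj p = x.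
Proof.
have [U [Phi [g [Ux tr]]]] := trivializationP P x.
have [_ _ Tg _] := tr; have [b1 _ _] := Tg x 1 Ux (oner_neq0 R).
by exists (g (x, 1 : R)).
Qed.

(** By [equivariant_lift_euler] the form on P prescribes the covector on all projected tangent
    vectors, and these exhaust the tangent space of M. *)
Lemma equivariant_lift_unique (P : symplectic_bundle M) (i1 i2 : P -> cotangent M) :
  equivariant_lift i1 -> equivariant_lift i2 ->
  pullback i1 (canonical_symplectic_form M) = sform P ->
  pullback i2 (canonical_symplectic_form M) = sform P -> i1 = i2.
Proof.
move=> l1 l2 s1 s2; apply/funext => p.
have [_ b1 _] := l1; have [_ b2 _] := l2.
apply: cotangent_eq; first by rewrite b1 b2.
move=> u; have [v <-] := tangent_bproj_surj p u.
by rewrite -(equivariant_lift_euler l1) -(equivariant_lift_euler l2) s1 s2.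
Qed.

Section Lift.
Context (P : symplectic_bundle M).

Lemma sform_nondegenerate (p : P) u :
  (forall v, sform P p (pair2 u v) = 0) -> u = 0.
Proof.
have [_ _ _ nd] := sform_symplectic P => u0; apply: (nd p) => v v0.
by rewrite (pair2E v) v0.
Qed.

(** The contracted form vanishes on vertical vectors, so its value depends only on the projection;
    the coordinates of the covector are read off on arbitrary lifts w of the basis vectors. *)
Lemma euler_covector (p : P) : exists q : 'cV[R]_m, forall v,
  (tangent_map (@bproj _ _ _ P) p v *m q) 0 0 = euler_form p (fun=> v).
Proof.
have /choice [w wE] := tangent_bproj_surj p.
exists (\col_i euler_form p (fun=> w (delta_mx 0 i))) => v.
have lt := euler_form_linear p.
pose T := tangent_map (@bproj _ _ _ P) p.
rewrite -/T; pose w' := \sum_i (T v) 0 i *: w (delta_mx 0 i).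
have Tw : T w' = T v.
  rewrite /w' linear_sum [RHS]row_sum_delta; apply: eq_bigr => i _.
  by rewrite linearZ /= wE.
have -> : euler_form p (fun=> v) = euler_form p (fun=> w').
  have := euler_form_vertical (p := p) (v := v - w').
  rewrite (functionalD lt) (functionalN lt) => /(_ _)/subr0_eq -> //.
  by rewrite linearB /= -/T Tw subrr.
rewrite mxE (functional_sum lt); apply: eq_bigr => i _.
by rewrite mxE (functionalZ lt).
Qed.

Lemma euler_lift_exists : exists iota : P -> cotangent M, equivariant_lift iota /\
  forall p v, ceval (iota p) (tangent_map (@bproj _ _ _ P) p v) = euler_form p (fun=> v).
Proof.
have /choice [q qE] := euler_covector.
pose iota (p : P) : cotangent M := (bproj p, q p); exists iota.
have iE p v : ceval (iota p) (tangent_map (@bproj _ _ _ P) p v) = euler_form p (fun=> v).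
  exact: qE.
split => //; split => //; last first.
  move=> s p s0; apply: cotangent_eq; first by rewrite /cbase /= bact_proj.
  move=> u; have [v <-] := tangent_bproj_surj p u.
  by rewrite ceval_scale iE -(tangent_bproj_act p v s0) iE euler_form_act.
apply: chart_smooth_map_on; first exact: openT.
move=> p0 _; pose c := chart_at p0; pose d := chart_at (bproj p0).
have [ac cp] := (chart_at_atlasP p0, chart_at_domP p0).
have [ad dp] := (chart_at_atlasP (bproj p0), chart_at_domP (bproj p0)).
exists c, (cochart ad); split => //; first exact: cochart_atlas.
have [V [L [[oV Vp Vc] CL VL]]] := local_lift ac ad cp dp.
have [W [oW Wp Wc fW]] := smooth1_in_at ac cp (euler_form_smooth1 p0).
have oVW := openI oV oW.
exists (V `&` W); split => //.
- by move=> y [/Vc].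
- move=> y [/[dup] /Vc [p cp' <-] Vy _]; rewrite cfunKE//.
  by have [] := VL _ cp' Vy.
have sb := smooth_map_chart (bproj_smooth P) ac ad cp dp.
move=> k.
(* The covectors were chosen pointwise; evaluating the smooth contracted form on the smooth lift L
   of a basis vector recovers their coordinates. *)
have coord i y : (V `&` W) y -> form1_in (@euler_form _ _ _ P) c y (L y (delta_mx 0 i)) =
    cocoord d (iota (cinv c y)) i 0.
  move=> [/[dup] /Vc [p cp' <-] Vy _]; rewrite cfunKE//.
  have [dp' lL TL] := VL _ cp' Vy.
  have := ceval_cocoord d (iota p) (delta_mx 0 i); rewrite -rowE mxE => ->.
  have sb' := smooth_map_chart (bproj_smooth P) ac ad cp' dp'.
  have -> : cbase (iota p) = bproj p by [].
  have eT := dchart_tangent (L (cfun c p) (delta_mx 0 i)) ac ad cp' dp' sb'.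
  rewrite TL in eT.
  have [ax xx] := (chart_at_atlasP (bproj p), chart_at_domP (bproj p)).
  have eK := dchart_idK (tangent_map (@bproj _ _ _ P) p
    (dchart c (chart_at p) id p (L (cfun c p) (delta_mx 0 i)))) ax ad xx dp'.
  rewrite -eT in eK; rewrite eK iE.
  exact: form_inE.
have C1 : Ck k (V `&` W) (fun y => cocoord d (iota (cinv c y))).
  apply: (Ck_mx oVW) => i j; rewrite [j]ord1.
  have sub : V `&` W `<=` (fun y => (y, L y (delta_mx 0 i))) @^-1` (W `*` setT).
    by move=> y [].
  have CL' : Ck k (V `&` W) (L^~ (delta_mx 0 i)) by apply: (CkW _ (CL k _)) => y [].
  apply: Ck_eq (Ck_comp oVW (open_setXT oW) sub (Ck_pair oVW (Ck_id k oVW) CL')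
    (fW k).1) => // y /set_mem; exact: coord.
have C2 : Ck k (V `&` W) (fun y => cfun d (bproj (cinv c y))).
  apply: Ck_local => _ [/[dup] /Vc [p cp' <-] Vy _].
  have [dp' _ _] := VL _ cp' Vy.
  have [V' [oV' V'p _ _ sV']] := smooth_map_chart (bproj_smooth P) ac ad cp' dp'.
  by exists V'.
exact: (Ck_pair oVW C2 C1).
Qed.

Lemma euler_lift_pullback (iota : P -> cotangent M) : equivariant_lift iota ->
  (forall p v, ceval (iota p) (tangent_map (@bproj _ _ _ P) p v) = euler_form p (fun=> v)) ->
  pullback iota (canonical_symplectic_form M) = sform P.
Proof.
move=> li iE; have [si _ _] := li.
rewrite -ext_derivative_euler_form.
have -> : @euler_form _ _ _ P = pullback iota (@liouville_form _ _ M).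
  apply/funext => p; apply/funext => v.
  by rewrite (equivariant_lift_liouville li) iE.
apply/funext => p; apply/funext => v.
apply: esym; apply: (ext_derivative_pullback_on v (@openT _) si I).
exact: liouville_smooth1.
Qed.

Section Contact.
Context (iota : P -> cotangent M) (li : equivariant_lift iota).
Hypothesis iE : forall p v,
  ceval (iota p) (tangent_map (@bproj _ _ _ P) p v) = euler_form p (fun=> v).

(** A zero covector would put the generator in the kernel of the symplectic form, hence make it
    zero. *)
Lemma lift_neq0 p : exists u, ceval (iota p) u != 0.
Proof.
apply: contrapT => /forallNP H; have := euler_neq0 p; rewrite (_ : euler p = 0) ?eqxx//.
apply: sform_nondegenerate => v.
have /negP/negPn/eqP := H (tangent_map (@bproj _ _ _ P) p v).
by rewrite iE => e; exact: e.
Qed.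

Let fibre_point : forall x, exists p : P, bproj p = x := fibre_nonempty P.

Definition lift_point x : P := sval (cid (fibre_point x)).

Lemma lift_pointE x : bproj (lift_point x) = x.
Proof. exact: svalP (cid (fibre_point x)). Qed.

Definition lift_hyperplane x : {vspace 'rV[R]_m} :=
  (fullv :&: lker (functional (ceval_linear (iota (lift_point x)))))%VS.

(** Points of one fibre differ by the action of a nonzero scalar, which rescales the covector; so
    the kernel does not depend on the choice made in [lift_point]. *)
Lemma mem_lift_hyperplane p v :
  (v \in lift_hyperplane (bproj p)) = (ceval (iota p) v == 0).
Proof.
have [s s0 ps] := same_fibre (lift_pointE (bproj p)).
have [_ _ ei] := li.
rewrite mem_kernel memvf /= [in RHS]ps ei// ceval_scale mulf_eq0.
by rewrite (negbTE s0).
Qed.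

Lemma base_odd : odd m.
Proof. by have [/= + _ _ _] := sform_symplectic P; rewrite negbK. Qed.

Lemma lift_hyperplane_dim x : (\dim (lift_hyperplane x)).+1 = m.
Proof.
have [u u0] := lift_neq0 (lift_point x).
exact: (dim_kernel_nonzero (ceval_linear _) u0).
Qed.

Section LocalContactForm.
Context U Phi g (tr : trivialization (P := P) U Phi g).

Let sigma : M -> P := fun x => g (x, 1 : R).

Let sigma_smooth : smooth_map_on U sigma.
Proof.
have [[oU sPhi sg oA oB] Tp Tg Te] := tr.
have s1 : smooth_map_on (N := prod_manifold M RL) U (fun x => (x, 1 : R)).
  apply: (smooth_map_on_pair oU); last exact: smooth_map_on_cst.
  exact: (smooth_map_onW oU (@openT _) _ (@smooth_map_id _ _ M)).
apply: (smooth_map_on_comp oU oB _ s1 sg) => x Ux.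
by split => //; exact: oner_neq0.
Qed.

Let sigmaK x : U x -> bproj (sigma x) = x.
Proof. by move=> Ux; have [_ _ Tg _] := tr; have [] := Tg x 1 Ux (oner_neq0 R). Qed.

Let tangent_sigma x v : U x ->
  tangent_map (@bproj _ _ _ P) (sigma x) (tangent_map sigma x v) = v.
Proof.
move=> Ux; have [[oU sPhi sg oA oB] _ _ _] := tr.
apply: etrans (esym (tangent_map_comp v oU (@openT _) sigma_smooth (bproj_smooth P) Ux I)) _.
have ids : chart_smooth (chart_at x) (chart_at (id x)) id x.
  by apply: chart_smooth_id; [exact: chart_at_atlasP|exact: chart_at_atlasP|
    exact: chart_at_domP|exact: chart_at_domP].
apply: etrans (tangent_map_eq (f := id) v oU Ux _ ids) _; last exact: tangent_map_id.
by move=> z Uz; rewrite /= sigmaK.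
Qed.

Let eta : dform M 1 := pullback sigma (@euler_form _ _ _ P).

Let etaE x v : U x -> eta x v = ceval (iota (sigma x)) (v ord0).
Proof.
move=> Ux; rewrite -[in RHS](tangent_sigma (v ord0) Ux) iE.
by [].
Qed.

Let eta_smooth1 x : U x -> smooth1_at eta x.
Proof.
move=> Ux; have [[oU _ _ _ _] _ _ _] := tr.
exact: (smooth1_at_pullback_on oU sigma_smooth Ux (euler_form_smooth1 _)).
Qed.

Let deta x v : U x ->
  ext_derivative eta x v = pullback sigma (sform P) x v.
Proof.
move=> Ux; have [[oU _ _ _ _] _ _ _] := tr.
rewrite -ext_derivative_euler_form.
exact: (ext_derivative_pullback_on v oU sigma_smooth Ux (euler_form_smooth1 _)).
Qed.

(** If u lies in the kernel of eta and is orthogonal to it for d eta, then the image u1 of u under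
    the section pairs with every vector of P as a multiple of the generator does. Nondegeneracy
    makes u1 that multiple, hence vertical, and so u = 0. *)
Let eta_contact : contact_form_on U eta.
Proof.
have sf : smooth_form_on U eta by exact: smooth_form_smooth1.
split => //; first exact: base_odd.
move=> x Ux.
have ab := alternating_ext_derivative (eta_smooth1 Ux).
have aa : alternating (eta x) by have [+ _] := sf; exact.
have mn : m = (m./2 * 2).+1 by have := odd_double_half m; rewrite base_odd muln2.
have [z z0] := lift_neq0 (sigma x).
apply: (contact_nonzero ab aa mn); first by exists z; rewrite etaE.
move=> u; rewrite etaE// => au bu.
set q := sigma x in z0 au bu *.
have aq := sform_alternating q; have [bl br b0] := alternating2P aq.
pose u1 := tangent_map sigma x u.
(* Pairing u1 = c D with the image of z forces this value, since the contraction with D is the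
   lifted covector at the projection. *)
pose c := sform P q (pair2 u1 (tangent_map sigma x z)) / ceval (iota q) z.
have bE v1 v2 : ext_derivative eta x (pair2 v1 v2) =
    sform P q (pair2 (tangent_map sigma x v1) (tangent_map sigma x v2)).
  by rewrite deta// /pullback pair2_map.
suff u1E : u1 = c *: euler q.
  by rewrite -(tangent_sigma u Ux) -/u1 u1E linearZ /= tangent_bproj_euler scaler0.
apply/subr0_eq; apply: (@sform_nondegenerate q) => v.
rewrite (functionalD (bl _)) (functionalN (bl _)) (functionalZ (bl _)).
pose y := tangent_map (@bproj _ _ _ P) q v.
have -> : sform P q (pair2 (euler q) v) = ceval (iota q) y by rewrite /y iE.
have [t vE] : exists t, v - tangent_map sigma x y = t *: euler q.
  apply: tangent_bproj_vertical.
  by rewrite linearB /= tangent_sigma// subrr.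
have -> : v = tangent_map sigma x y + t *: euler q by rewrite -vE addrC subrK.
rewrite (functionalD (br _)) (functionalZ (br _)).
have -> : sform P q (pair2 u1 (euler q)) = 0.
  rewrite (alternating2N _ _ aq) -[sform P q _]/(euler_form q (fun=> u1)) -iE.
  by rewrite tangent_sigma// au oppr0.
rewrite mulr0 addr0.
pose k := ceval (iota q) y / ceval (iota q) z.
have yE : y = k *: z + (y - k *: z) by rewrite addrC subrK.
have : ext_derivative eta x (pair2 u (y - k *: z)) = 0.
  apply: bu; rewrite etaE// -/q (functionalD (ceval_linear _)).
  by rewrite (functionalN (ceval_linear _)) (functionalZ (ceval_linear _)) divfK// subrr.
rewrite bE linearB linearZ (functionalD (br _)) (functionalN (br _)) (functionalZ (br _)).
move=> /subr0_eq ->.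
by apply/eqP; rewrite subr_eq0 /c /k; apply/eqP; field.
Qed.

Lemma lift_contact_local : exists2 w : dform M 1, contact_form_on U w &
  forall y, U y -> forall v, (v \in lift_hyperplane y) = (w y (fun=> v) == 0).
Proof.
exists eta; first exact: eta_contact.
move=> y Uy v; rewrite etaE//.
by rewrite -[in LHS](sigmaK Uy) mem_lift_hyperplane.
Qed.

End LocalContactForm.

Lemma lift_contact_structure : exists C : contact_structure M,
  forall p, annihilator_units C (iota p).
Proof.
have loc x : exists U eta, [/\ open U, U x, contact_form_on U eta &
    forall y, U y -> forall v, (v \in lift_hyperplane y) = (eta y (fun=> v) == 0)].
  have [U [Phi [g [Ux tr]]]] := trivializationP P x.
  have [eta ce he] := lift_contact_local tr.
  by exists U, eta; split => //; have [[]] := tr.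
exists (ContactStructure base_odd lift_hyperplane_dim loc) => p; split.
  by apply: cvec_neq0; exact: lift_neq0.
have [_ bi _] := li.
by move=> v; rewrite bi /= mem_lift_hyperplane => /eqP.
Qed.

End Contact.

Lemma symplectic_bundle_lift : exists (C : contact_structure M) (iota : P -> cotangent M),
  [/\ equivariant_lift iota, forall p, annihilator_units C (iota p) &
      pullback iota (canonical_symplectic_form M) = sform P].
Proof.
have [iota [li iE]] := euler_lift_exists.
have [C aC] := lift_contact_structure li iE.
by exists C, iota; split => //; exact: euler_lift_pullback.
Qed.

End Lift.

End FromBundleToContact.

(** * The symplectic bundle of a contact structure *)

Section AnnihilatorLine.
Context {R : realType} {m : nat} {M : manifold 'rV[R]_m} (C : contact_structure M).

(** The hyperplane is contained in the kernel of the nonzero covector xi and has the same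
    dimension. *)
Lemma annihilator_ker (xi : cotangent M) v : annihilator_units C xi ->
  (v \in C (cbase xi)) = (ceval xi v == 0).
Proof.
move=> [/cvec_neq0P [u u0] Cxi].
pose K := (fullv :&: lker (functional (ceval_linear xi)))%VS.
have KE w : (w \in K) = (ceval xi w == 0) by rewrite mem_kernel memvf.
have CK : (C (cbase xi) <= K)%VS.
  by apply/subvP => w Cw; rewrite KE Cxi.
have dK := dim_kernel_nonzero (ceval_linear xi) u0.
have dC := hyperplane_dim C (cbase xi).
have /eqP -> : C (cbase xi) == K by rewrite eqEdim CK -ltnS dC -/K dK leqnn.
exact: KE.
Qed.

Lemma annihilator_scale (s : R) (xi : cotangent M) : s != 0 ->
  annihilator_units C xi -> annihilator_units C (cscale s xi).
Proof.
move=> s0 [xi0 Cxi]; split; first by rewrite /cscale /cvec /= scaler_eq0 negb_or s0.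
by move=> v Cv; rewrite ceval_scale Cxi// mulr0.
Qed.

(** Two covectors with the same kernel are proportional, the factor being the ratio of their values
    at a vector z off the kernel. *)
Lemma annihilator_line (xi xi' : cotangent M) : annihilator_units C xi ->
  annihilator_units C xi' -> cbase xi = cbase xi' ->
  exists2 s : R, s != 0 & xi' = cscale s xi.
Proof.
move=> axi axi' bb; have [/cvec_neq0P [z z0] _] := axi.
have z0' : ceval xi' z != 0 by rewrite -annihilator_ker// -bb annihilator_ker.
exists (ceval xi' z / ceval xi z); first by rewrite mulf_neq0// invr_eq0.
apply: cotangent_eq => // u; rewrite ceval_scale.
pose k := ceval xi u / ceval xi z.
have : ceval xi' (u - k *: z) = 0.
  apply/eqP; rewrite -annihilator_ker// -bb annihilator_ker//.
  rewrite (functionalD (ceval_linear _)) (functionalN (ceval_linear _)).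
  by rewrite (functionalZ (ceval_linear _)) divfK// subrr.
rewrite (functionalD (ceval_linear _)) (functionalN (ceval_linear _)).
rewrite (functionalZ (ceval_linear _)) => /subr0_eq ->.
by rewrite /k; field.
Qed.

Definition form_covector (eta : dform M 1) (x : M) : cotangent M :=
  (x, \col_i eta x (fun=> delta_mx 0 i)).

Lemma ceval_form_covector (eta : dform M 1) x v : alternating (eta x) ->
  ceval (form_covector eta x) v = eta x (fun=> v).
Proof.
move=> /alternating1P le; rewrite /ceval /= mxE [in RHS](row_sum_delta v).
rewrite (functional_sum le); apply: eq_bigr => i _.
by rewrite mxE (functionalZ le).
Qed.

(** Where the form vanishes every term of the top-degree product does too, so a contact form gives
    nonzero covectors. *)
Lemma contact_form_covector (U : set M) (eta : dform M 1) :
  contact_form_on U eta -> (forall y, U y -> forall v, (v \in C y) = (eta y (fun=> v) == 0)) ->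
  forall y, U y -> annihilator_units C (form_covector eta y).
Proof.
move=> [om [ae se] ne] Ce y Uy; have ay := ae y Uy; split.
  apply: cvec_neq0; apply: contrapT => /forallNP H; have [v /eqP] := ne y Uy; apply.
  rewrite /ext_prod big1 ?mulr0// => s _.
  have /negP/negPn/eqP := H (v (s (lshift _ ord0))).
  rewrite ceval_form_covector// => e.
  by rewrite (cst1E (fun i => v (s (lshift _ i)))) e mul0r mulr0.
by move=> v; rewrite ceval_form_covector// Ce// => /eqP.
Qed.

Lemma cocoord_form_covector c (U : set M) (eta : dform M 1) x : cdom c x ->
  alternating (eta x) -> cocoord c (form_covector eta x) =
  \col_i form1_in eta c (cfun c x) (delta_mx 0 i).
Proof.
move=> cx ae; apply/colP => i; rewrite [RHS]mxE /form1_in form_inE//.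
have := ceval_cocoord c (form_covector eta x) (delta_mx 0 i).
by rewrite -rowE mxE => ->; rewrite ceval_form_covector.
Qed.

Lemma annihilator_exists x : exists xi : cotangent M, cbase xi = x /\ annihilator_units C xi.
Proof.
have [U [eta [oU Ux ce Ce]]] := contact_local C x.
by exists (form_covector eta x); split => //; exact: contact_form_covector Ce _ Ux.
Qed.

Definition annihilator_at x : cotangent M := sval (cid (annihilator_exists x)).

Lemma annihilator_at_base x : cbase (annihilator_at x) = x.
Proof. by rewrite /annihilator_at; case: cid => xi []. Qed.

Lemma annihilator_atP x : annihilator_units C (annihilator_at x).
Proof. by rewrite /annihilator_at; case: cid => xi []. Qed.

Lemma cocoord_scaleE (c : chart 'rV[R]_m M) s (xi : cotangent M) i :
  cocoord c (cscale s xi) i 0 = s * cocoord c xi i 0.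
Proof. by rewrite cocoord_scale [LHS]mxE. Qed.

Lemma cbase_scale s (xi : cotangent M) : cbase (cscale s xi) = cbase xi.
Proof. by []. Qed.

(* The domain of the i-th normalized frame of the annihilator in the chart c, and
   the coordinates of its element whose i-th coordinate is 1. *)
Definition frame_dom (c : chart 'rV[R]_m M) (i : 'I_m) : set M :=
  [set x | cdom c x /\ cocoord c (annihilator_at x) i 0 != 0].

Definition frame (c : chart 'rV[R]_m M) (i : 'I_m) (x : M) : 'cV[R]_m :=
  (cocoord c (annihilator_at x) i 0)^-1 *: cocoord c (annihilator_at x).

Lemma annihilator_frame c i (xi : cotangent M) : annihilator_units C xi ->
  frame_dom c i (cbase xi) <-> cdom c (cbase xi) /\ cocoord c xi i 0 != 0.
Proof.
move=> axi.
have [s s0 ->] := annihilator_line (annihilator_atP (cbase xi)) axi (annihilator_at_base _).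
by rewrite cocoord_scaleE mulf_eq0 (negbTE s0) cbase_scale annihilator_at_base.
Qed.

(** The normalization cancels the scalar by which xi differs from the pointwise choice
    [annihilator_at], so any annihilating covector computes the frame. *)
Lemma frameE c i (xi : cotangent M) : annihilator_units C xi ->
  cocoord c xi i 0 != 0 -> frame c i (cbase xi) = (cocoord c xi i 0)^-1 *: cocoord c xi.
Proof.
move=> axi.
have [s s0 ->] := annihilator_line (annihilator_atP (cbase xi)) axi (annihilator_at_base _).
rewrite cocoord_scaleE mulf_eq0 negb_or => /andP[_ x0].
rewrite cocoord_scale cbase_scale annihilator_at_base /frame scalerA invfM mulrAC.
by rewrite mulVf// mul1r.
Qed.

Lemma cocoord_frame c i (xi : cotangent M) : annihilator_units C xi ->
  frame_dom c i (cbase xi) -> cocoord c xi = cocoord c xi i 0 *: frame c i (cbase xi).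
Proof.
move=> axi /(annihilator_frame c i axi) [_ x0].
by rewrite frameE// scalerA divff// scale1r.
Qed.

Lemma frame_dom_exists c x : atlas M c -> cdom c x -> exists i, frame_dom c i x.
Proof.
move=> ac cx; apply: contrapT => /forallNP H.
have [q0 _] := annihilator_atP x; case/negP: q0; apply/eqP.
have c0 : cocoord c (annihilator_at x) = 0.
  apply/colP => i; rewrite [RHS]mxE; apply/eqP; apply: contrapT => /negP n.
  by apply: (H i).
have : forall u, ceval (annihilator_at x) u = 0.
  by move=> u; rewrite (ceval_chart _ ac) ?annihilator_at_base// c0 mulmx0 mxE.
move=> H0; apply/colP => i; have := H0 (delta_mx 0 i).
by rewrite /ceval -rowE !mxE.
Qed.

(** Although [annihilator_at] is chosen pointwise, near x the frame can be computed from the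
    coordinates of a local contact form, which are smooth. *)
Lemma frame_smooth c i x : atlas M c -> frame_dom c i x ->
  exists V, [/\ open V, V (cfun c x), V `<=` cfun c @` (cdom c `&` frame_dom c i) &
    forall k, Ck k V (fun y => frame c i (cinv c y))].
Proof.
move=> ac [cx x0]; have [U [eta [oU Ux ce Ce]]] := contact_local C x.
have [om se ne] := ce; have [ae _] := se.
have ann := contact_form_covector ce Ce.
have se1 := smooth_form_smooth1_at oU Ux se.
have [W [oW Wx Wc fW]] := smooth1_in_at ac cx se1.
pose W1 := W `&` cfun c @` (cdom c `&` U).
have oW1 : open W1 by apply: openI => //; exact: chart_imgI_open.
pose e j y := form1_in eta c y (delta_mx 0 j).
have Ce_ k j : Ck k W1 (e j).
  by apply: (CkW _ (Ck_partial1 (delta_mx 0 j) oW (fW k).1)) => y [].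
pose V := W1 `&` e i @^-1` [set t | t != 0].
have oV : open V := open_setI_preimage oW1 (Ce_ 0%N i) (open_nonzero (R := R)).
have eE z j : cdom c z -> U z -> e j (cfun c z) = cocoord c (form_covector eta z) j 0.
  by move=> cz Uz; rewrite (cocoord_form_covector U)// ?mxE//; exact: ae.
exists V; split => //.
- split; first by split => //; exists x.
  rewrite /= eE//.
  have fx : frame_dom c i (cbase (form_covector eta x)) by split.
  by have [_] := (annihilator_frame c i (ann x Ux)).1 fx.
- move=> y [[_ [z [cz Uz] <-]] /= ez]; exists z => //; split => //.
  by apply/(annihilator_frame c i (ann z Uz)); split => //; rewrite -eE.
move=> k.
have CV j : Ck k V (e j) by apply: (CkW _ (Ce_ k j)) => y [].
have Ci : Ck k V (fun y => (e i y)^-1) by apply: Ck_inv => // y [].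
apply: (Ck_mx oV) => j j'; rewrite [j']ord1.
apply: Ck_eq (Ck_mul oV Ci (CV j)) => // y /set_mem [[_ [z [cz Uz] <-]] /= ez].
rewrite cfunKE//; have -> : z = cbase (form_covector eta z) by [].
by rewrite (frameE (ann z Uz)) -?eE// [in RHS]mxE -eE.
Qed.

Lemma open_frame_dom c i : atlas M c -> open (frame_dom c i).
Proof.
move=> ac; rewrite openE => x fx; have [V [oV Vx Vc _]] := frame_smooth ac fx.
have cx := fx.1; have cc : {for x, continuous (cfun c)} by apply: cfun_continuous; rewrite inE.
have : nbhs x (cdom c `&` cfun c @^-1` V).
  apply: filterI; first by apply: open_nbhs_nbhs; split => //; exact: cdom_open.
  exact: (cc _ (open_nbhs_nbhs (conj oV Vx))).
apply: filterS => z [cz /= /Vc [z' [cz' fz'] e]].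
by rewrite -(cfunKE cz) -e cfunKE.
Qed.

End AnnihilatorLine.

(** * Splitting off a fibre coordinate *)

Section RowCoordinates.
Context {R : realType} {m : nat}.

(** Identifies pairs of a scalar and a row of length m with rows of length m + 1, the scalar at
    place 0, as the model space of a bundle requires. *)
Definition enc (s : R) (y : 'rV[R]_m) : 'rV[R]_m.+1 :=
  \row_i oapp (fun j => y 0 j) s (unlift ord0 i).
Definition dec0 (v : 'rV[R]_m.+1) : R := v 0 ord0.
Definition dec1 (v : 'rV[R]_m.+1) : 'rV[R]_m := \row_j v 0 (lift ord0 j).

Lemma encK0 s y : dec0 (enc s y) = s.
Proof. by rewrite /dec0 mxE unlift_none. Qed.

Lemma encK1 s y : dec1 (enc s y) = y.
Proof. by apply/rowP => j; rewrite !mxE liftK. Qed.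

Lemma decK v : enc (dec0 v) (dec1 v) = v.
Proof. by apply/rowP => i; rewrite mxE; case: unliftP => [j ->|->]; rewrite /= ?mxE. Qed.

Lemma Ck_enc k (E : normedModType R) (U : set E) f g : open U ->
  Ck k U f -> Ck k U g -> Ck k U (fun x => enc (f x) (g x)).
Proof.
move=> oU Cf Cg; apply: (Ck_mx oU) => i j.
case: (unliftP ord0 j) => [j' ->|->].
  by apply: Ck_eq (Ck_coord 0 j' oU Cg) => // x _; rewrite mxE liftK.
by apply: Ck_eq Cf => // x _; rewrite mxE unlift_none.
Qed.

Lemma Ck_dec0 k (U : set 'rV[R]_m.+1) : open U -> Ck k U dec0.
Proof. by move=> oU; exact: (Ck_coord 0 ord0 oU (Ck_id k oU)). Qed.

Lemma Ck_dec1 k (U : set 'rV[R]_m.+1) : open U -> Ck k U dec1.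
Proof.
move=> oU; apply: (Ck_mx oU) => i j.
by apply: Ck_eq (Ck_coord 0 (lift ord0 j) oU (Ck_id k oU)) => // x _; rewrite mxE.
Qed.

Definition prj (i : 'I_m) (z : 'rV[R]_m * 'cV[R]_m) : 'rV[R]_m.+1 :=
  enc (z.2 i 0) z.1.

Lemma Ck_prj k i (U : set ('rV[R]_m * 'cV[R]_m)) : open U -> Ck k U (prj i).
Proof.
move=> oU; apply: Ck_enc => //; last exact: Ck_fst.
exact: (Ck_coord i 0 oU (Ck_snd k oU)).
Qed.

End RowCoordinates.

(** * Gluing the nonzero annihilating covectors into a manifold *)

Section ContactGluing.
Context {R : realType} {m : nat} {M : manifold 'rV[R]_m} (C : contact_structure M).

Lemma Ck_frame k c i : atlas M c ->
  Ck k (cfun c @` (cdom c `&` frame_dom C c i)) (fun y => frame C c i (cinv c y)).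
Proof.
move=> ac; apply: Ck_local => _ [x [cx fx] <-].
by have [V [oV Vx _ CV]] := frame_smooth ac fx; exists V.
Qed.

(** Inverse of [prj i] on the annihilator: the covector over a base point is recovered from its i-th
    coordinate, by which the normalized frame is multiplied. *)
Definition frame_emb c i (v : 'rV[R]_m.+1) : 'rV[R]_m * 'cV[R]_m :=
  (dec1 v, dec0 v *: frame C c i (cinv c (dec1 v))).

Lemma Ck_frame_emb k c i (U : set 'rV[R]_m.+1) : atlas M c -> open U ->
  (forall v, U v -> (cfun c @` (cdom c `&` frame_dom C c i)) (dec1 v)) ->
  Ck k U (frame_emb c i).
Proof.
move=> ac oU UV.
have oF := chart_imgI_open c (open_frame_dom C i ac).
have Cf : Ck k U (fun v => frame C c i (cinv c (dec1 v))).
  exact: (Ck_comp oU oF UV (Ck_dec1 k oU) (Ck_frame k i ac)).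
apply: (Ck_pair oU (Ck_dec1 k oU)); apply: (Ck_mx oU) => a b.
apply: Ck_eq (Ck_mul oU (Ck_dec0 k oU) (Ck_coord a b oU Cf)) => // v _.
by rewrite [RHS]mxE.
Qed.

Let gset := {xi : cotangent M | annihilator_units C xi}.
Let gidx := ({c : chart 'rV[R]_m M | atlas M c} * 'I_m)%type.
Let gc (j : gidx) := cochart (svalP j.1).
Let gdom (j : gidx) : set gset := [set p | frame_dom C (sval j.1) j.2 (cbase (sval p))].
Let gfun (j : gidx) (p : gset) : 'rV[R]_m.+1 := prj j.2 (cfun (gc j) (sval p)).
(** The second branch is a default value, never taken on the image of the chart. *)
Let ginv (j : gidx) (v : 'rV[R]_m.+1) : gset :=
  let xi := cinv (gc j) (frame_emb (sval j.1) j.2 v) in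
  if pselect (annihilator_units C xi) is left h then exist _ xi h
  else exist _ (annihilator_at C (cbase xi)) (annihilator_atP C (cbase xi)).

Let gset_eq (p q : gset) : sval p = sval q -> p = q.
Proof. by case: p => x px; case: q => y qy /= e; exact: eq_exist. Qed.

Let frame_emb_fun j p : gdom j p ->
  frame_emb (sval j.1) j.2 (gfun j p) = cfun (gc j) (sval p).
Proof.
move: j p => [[c ac] i] [xi axi] fx; have [/= cx _] := fx.
rewrite /frame_emb /gfun /prj encK0 encK1 /= cfunKE//.
by rewrite -(cocoord_frame axi fx).
Qed.

Let sval_ginv j p : gdom j p ->
  cinv (gc j) (frame_emb (sval j.1) j.2 (gfun j p)) = sval p.
Proof. by move=> jp; rewrite frame_emb_fun// cfunKE//; have [] := jp. Qed.

Let gfunK j : {in gdom j, cancel (gfun j) (ginv j)}.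
Proof.
move=> p; rewrite inE => jp; apply: gset_eq; rewrite /ginv.
have e := sval_ginv jp; case: pselect => [h|h]; first exact: e.
by exfalso; apply: h; rewrite e; exact: (svalP p).
Qed.

Let gimg j (A : set M) : gfun j @` (gdom j `&` [set p | A (cbase (sval p))]) =
  [set v | dec0 v != 0] `&`
  dec1 @^-1` (cfun (sval j.1) @` (cdom (sval j.1) `&` (frame_dom C (sval j.1) j.2 `&` A))).
Proof.
move: j => [[c ac] i]; apply/seteqP; split.
  move=> _ [[xi axi] [fx Ax] <-]; rewrite /gfun /prj /= encK0 encK1; split.
    by have [] := (annihilator_frame c i axi).1 fx.
  by exists (cbase xi) => //; split => //; have [] := fx.
move=> v [/= v0 [x [cx [fx Ax]] xv]]; have [_ x0] := fx.
(* Rescaling by k gives the chosen annihilating covector the i-th coordinate [dec0 v]. *)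
pose k := dec0 v / cocoord c (annihilator_at C x) i 0.
have k0 : k != 0 by rewrite mulf_neq0// invr_eq0.
pose p : gset := exist _ (cscale k (annihilator_at C x))
  (annihilator_scale k0 (annihilator_atP C x)).
have px : cbase (sval p) = x by exact: annihilator_at_base.
have fp : frame_dom C c i (cbase (sval p)) by rewrite px.
exists p; first by split => //; rewrite /= -[cbase _]/(cbase (sval p)) px.
have e0 : cocoord c (sval p) i 0 = dec0 v by rewrite cocoord_scaleE /k divfK.
rewrite -[RHS]decK -xv -e0 -{1}px.
by [].
Qed.

Let dec_open (A : set 'rV[R]_m) : open A ->
  open ([set v : 'rV[R]_m.+1 | dec0 v != 0] `&` dec1 @^-1` A).
Proof.
move=> oA; apply: openI.
  apply: (open_comp (f := dec0) _ (open_nonzero (R := R))) => v _.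
  exact: (Ck_dec0 0 (@openT _) v I).
apply: (open_comp (f := dec1) _ oA) => v _.
exact: (Ck_dec1 0 (@openT _) v I).
Qed.

Let gimgA_open j (A : set M) : open A ->
  open (gfun j @` (gdom j `&` [set p | A (cbase (sval p))])).
Proof.
move=> oA; rewrite gimg; apply: dec_open; apply: chart_imgI_open.
by apply: openI => //; apply: open_frame_dom; exact: (svalP j.1).
Qed.

Let gimg_open i j : open (gfun i @` (gdom i `&` gdom j)).
Proof. by apply: gimgA_open; apply: open_frame_dom; exact: (svalP j.1). Qed.

Let emb_dom i j v : (gfun i @` (gdom i `&` gdom j)) v ->
  (cfun (gc i) @` (cdom (gc i) `&` cdom (gc j))) (frame_emb (sval i.1) i.2 v).
Proof.
move=> [p [ip jp] <-]; exists (sval p); last by rewrite frame_emb_fun.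
by split; [have [] := ip|have [] := jp].
Qed.

Let emb_smooth i j k : Ck k (gfun i @` (gdom i `&` gdom j)) (frame_emb (sval i.1) i.2).
Proof.
apply: Ck_frame_emb; [exact: (svalP i.1)|exact: gimg_open|].
move=> _ [p [ip jp] <-]; rewrite /gfun /prj encK1.
by exists (cbase (sval p)) => //; split => //; have [] := ip.
Qed.

(** A change of charts is [frame_emb], then a change of charts of the cotangent bundle, then [prj]:
    three smooth maps. *)
Let gcompat i j : smooth_on (gfun i @` (gdom i `&` gdom j)) (gfun j \o ginv i).
Proof.
move=> k; have oU := @gimg_open i j.
have oV : open (cfun (gc i) @` (cdom (gc i) `&` cdom (gc j))).
  by apply: chart_imgI_open; exact: cdom_open.
have CT : Ck k (cfun (gc i) @` (cdom (gc i) `&` cdom (gc j))) (cfun (gc j) \o cinv (gc i)).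
  by apply: atlas_compat; exact: cochart_atlas.
have C1 := Ck_comp oU oV (@emb_dom i j) (@emb_smooth i j k) CT.
have sub : gfun i @` (gdom i `&` gdom j) `<=`
  ((cfun (gc j) \o cinv (gc i)) \o frame_emb (sval i.1) i.2) @^-1` setT by [].
have C2 := Ck_comp oU (@openT _) sub C1 (Ck_prj k j.2 (@openT _)).
apply: Ck_eq C2 => // v /set_mem [p [ip jp] <-].
have e1 := gfunK (mem_set ip); have e2 := sval_ginv ip.
change (prj j.2 (cfun (gc j) (cinv (gc i) (frame_emb (sval i.1) i.2 (gfun i p)))) =
  gfun j (ginv i (gfun i p))).
by rewrite e1 e2.
Qed.

Let gcountable : exists2 J : set gidx,
  countable J & forall x, exists2 i, J i & gdom i x.
Proof.
have [J [cJ Ja] Jcov] := atlas_lindelof M.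
exists [set j | J (sval j.1)].
  apply/countable_injP; have /countable_injP [f fi] := cJ.
  have [h hi] : exists h : nat * 'I_m -> nat, injective h.
    by exists pickle; exact: (pcan_inj pickleK).
  exists (fun j => h (f (sval j.1), j.2)) => -[[a pa] i] [[b pb] i'].
  rewrite !inE /= => Ja' Jb' /hi [e ->]; congr (_, _).
  by apply: eq_exist; apply: fi; rewrite ?inE.
move=> p; have [c Jc cx] := Jcov (cbase (sval p)).
have [i fi] := frame_dom_exists C (Ja _ Jc) cx.
by exists (exist _ c (Ja _ Jc), i).
Qed.

Let gopen := fun A : set gset => forall i, open (gfun i @` (gdom i `&` A)).

(** Points over the same base point share a chart; others are separated by open sets of M. *)
Let gseparated x y : x <> y -> (exists i, gdom i x /\ gdom i y) \/
  (exists A B, [/\ gopen A, gopen B, A x, B y & A `&` B = set0]).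
Proof.
move=> _; have [exy|xy] := pselect (cbase (sval x) = cbase (sval y)).
  have [ax xx] := (chart_at_atlasP (cbase (sval x)), chart_at_domP (cbase (sval x))).
  have [i fi] := frame_dom_exists C ax xx.
  by left; exists (exist _ _ ax, i); split => //; rewrite /gdom /= -exy.
right; have := @manifold_hausdorff _ _ M; rewrite open_hausdorff.
move/eqP : xy => xy /(_ _ _ xy) [[A B] /= [xA yB] [oA oB /eqP AB]].
rewrite !inE in xA yB.
exists [set p | A (cbase (sval p))], [set p | B (cbase (sval p))].
split=> //; [by move=> i; exact: gimgA_open|by move=> i; exact: gimgA_open|].
apply/seteqP; split => // p pAB; have : (A `&` B) (cbase (sval p)) by [].
by rewrite AB.
Qed.

Definition contact_gluing : gluing 'rV[R]_m.+1 :=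
  Gluing gfunK gimg_open gcompat gcountable gseparated.

Definition contact_total : manifold 'rV[R]_m.+1 :=
  glued_manifold contact_gluing (@second_countable_mx R 1 m.+1).

Definition contact_incl (p : contact_total) : cotangent M := sval (p : gset).

Definition contact_chart c (ac : atlas M c) (i : 'I_m) :
    chart 'rV[R]_m.+1 contact_total :=
  gchart (G := contact_gluing) (exist _ c ac, i).

Lemma contact_chart_atlas c (ac : atlas M c) i : atlas contact_total (contact_chart ac i).
Proof. by exists (exist _ c ac, i). Qed.

Lemma contact_chart_fun c (ac : atlas M c) i p :
  cfun (contact_chart ac i) p = prj i (cfun (cochart (svalP (exist (atlas M) c ac))) (contact_incl p)).
Proof. by []. Qed.

Lemma contact_inclP p : annihilator_units C (contact_incl p).
Proof. exact: svalP (p : gset). Qed.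

Lemma contact_incl_inj : injective contact_incl.
Proof. by move=> p q; exact: gset_eq. Qed.

Definition contact_point xi (axi : annihilator_units C xi) : contact_total :=
  exist _ xi axi.

Lemma contact_incl_point xi (axi : annihilator_units C xi) :
  contact_incl (contact_point axi) = xi.
Proof. by []. Qed.

Lemma contact_emb c (ac : atlas M c) i p : cdom (contact_chart ac i) p ->
  frame_emb c i (cfun (contact_chart ac i) p) = cfun (cochart ac) (contact_incl p).
Proof. by move=> cp; exact: (@frame_emb_fun (exist _ c ac, i)). Qed.

End ContactGluing.

(** * The principal bundle structure *)

Section ContactBundle.
Context {R : realType} {m : nat} {M : manifold 'rV[R]_m} (C : contact_structure M).
Local Notation RL := (@real_line R).
Local Notation F := (contact_total C).
Local Notation incl := (@contact_incl _ _ _ C).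

Lemma incl_chart_smooth c (ac : atlas M c) i p : cdom (contact_chart C ac i) p ->
  chart_smooth (contact_chart C ac i) (cochart ac) incl p.
Proof.
move=> cp; have oV := cimg_open (contact_chart C ac i).
exists (cfun (contact_chart C ac i) @` cdom (contact_chart C ac i)); split => //.
- move=> _ [q cq <-]; rewrite cfunKE// cochart_dom.
  by have [] : frame_dom C c i (cbase (incl q)) := cq.
move=> k.
have C1 : Ck k (cfun (contact_chart C ac i) @` cdom (contact_chart C ac i))
    (frame_emb C c i).
  apply: Ck_frame_emb => // _ [q cq <-].
  rewrite contact_chart_fun /prj encK1.
  exists (cbase (incl q)) => //.
  by have [] : frame_dom C c i (cbase (incl q)) := cq; split.
apply: Ck_eq C1 => // _ /set_mem [q cq <-].
apply: etrans (contact_emb cq) _.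
change (cfun (cochart ac) (incl q) = cfun (cochart ac)
  (incl (cinv (contact_chart C ac i) (cfun (contact_chart C ac i) q)))).
by rewrite (cfunKE cq).
Qed.

Lemma incl_chart (p : F) : exists c (ac : atlas M c) i,
  cdom (contact_chart C ac i) p /\ cdom (cochart ac) (incl p).
Proof.
have [ax xx] := (chart_at_atlasP (cbase (incl p)), chart_at_domP (cbase (incl p))).
have [i fi] := frame_dom_exists C ax xx.
by exists (chart_at (cbase (incl p))), ax, i.
Qed.

Lemma incl_smooth : smooth_map incl.
Proof.
apply: chart_smooth_map_on; first exact: openT.
move=> p _; have [c [ac [i [cp cip]]]] := incl_chart p.
exists (contact_chart C ac i), (cochart ac); split => //.
- exact: contact_chart_atlas.
- exact: cochart_atlas.
- exact: incl_chart_smooth.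
Qed.

(** In charts, a map into the bundle is its composite with the inclusion followed by [prj].
    Smoothness of the action, of trivializations and of sections is thereby checked in the cotangent
    bundle. *)
Lemma smooth_map_on_incl (E : normedModType R) (N : manifold E) (A : set N)
    (f : N -> F) : open A -> smooth_map_on A (incl \o f) -> smooth_map_on A f.
Proof.
move=> oA sf; apply: chart_smooth_map_on => // x Ax.
have [c [ac [i [cp cip]]]] := incl_chart (f x).
have [ae ex] := (chart_at_atlasP x, chart_at_domP x).
exists (chart_at x), (contact_chart C ac i); split => //.
  exact: contact_chart_atlas.
have fs : chart_smooth (chart_at x) (cochart ac) (incl \o f) x.
  exact: (smooth_map_on_chart oA sf Ax ae (cochart_atlas ac) ex cip).
have sb : smooth_map_on A (@cbase _ _ M \o (incl \o f)).
  exact: (smooth_map_on_comp oA (@openT _) _ sf (@cbase_smooth _ _ M)).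
have oB := open_setI_preimage oA sb.1 (open_frame_dom C i ac).
have Bx : (A `&` (@cbase _ _ M \o (incl \o f)) @^-1` frame_dom C c i) x by split.
have [V [oV Vx Vc Vd sV]] := chart_smooth_shrink oB Bx ex fs.
exists V; split => //.
- by move=> y /Vc [z [cz _] <-]; exists z.
- by move=> y /Vc [z [cz [_ Bz]] <-]; rewrite cfunKE.
move=> k; have sub : V `<=` (cfun (cochart ac) \o (incl \o f) \o cinv (chart_at x)) @^-1` setT by [].
exact: (Ck_comp oV (@openT _) sub (sV k) (Ck_prj k i (@openT _))).
Qed.

Lemma cotangent_scale_smooth : smooth_map
  (M := prod_manifold RL (cotangent M)) (fun z => cscale z.1 z.2).
Proof.
apply: chart_smooth_map_on; first exact: openT.
move=> [s xi] _; pose c := chart_at (cbase xi); pose rl := chart_at (s : RL).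
have ac : atlas M c := chart_at_atlasP _.
have cx : cdom c (cbase xi) := chart_at_domP _.
have [rd rf ri] := real_lineP (chart_at_atlasP (s : RL)).
pose e : chart _ (prod_manifold RL (cotangent M)) := prod_chart rl (cochart ac).
have es : cdom e (s, xi) by split => //=; rewrite rd.
exists e, (cochart ac); split => //.
- by apply: prod_chart_atlas; [exact: chart_at_atlasP|exact: cochart_atlas].
- exact: cochart_atlas.
have oV := cimg_open e.
exists (cfun e @` cdom e); split => //.
- by move=> _ [z cz <-]; rewrite (cfunKE cz); case: cz.
move=> k.
have C1 : Ck k (cfun e @` cdom e) (fun v : R * ('rV[R]_m * 'cV[R]_m) => v.2.1).
  have sub : cfun e @` cdom e `<=` (snd : R * ('rV[R]_m * 'cV[R]_m) -> _) @^-1` setT by [].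
  exact: (Ck_comp oV (@openT _) sub (Ck_snd k oV) (Ck_fst k (@openT _))).
have C2 : Ck k (cfun e @` cdom e) (fun v : R * ('rV[R]_m * 'cV[R]_m) => v.2.2).
  have sub : cfun e @` cdom e `<=` (snd : R * ('rV[R]_m * 'cV[R]_m) -> _) @^-1` setT by [].
  exact: (Ck_comp oV (@openT _) sub (Ck_snd k oV) (Ck_snd k (@openT _))).
have C3 : Ck k (cfun e @` cdom e) (fun v : R * ('rV[R]_m * 'cV[R]_m) => v.1 *: v.2.2).
  apply: (Ck_mx oV) => i j.
  apply: Ck_eq (Ck_mul oV (Ck_fst k oV) (Ck_coord i j oV C2)) => // v _.
  by rewrite [RHS]mxE.
apply: Ck_eq (Ck_pair oV C1 C3) => // _ /set_mem [[t z] cz <-].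
change (((cfun e (t, z)).2.1, (cfun e (t, z)).1 *: (cfun e (t, z)).2.2) =
  cfun (cochart ac) (cscale (cinv e (cfun e (t, z))).1 (cinv e (cfun e (t, z))).2)).
rewrite (cfunKE cz) cochart_fun cocoord_scale.
by rewrite /e /= rf.
Qed.

(** The default value occurs only at s = 0, where scaling leaves the set of nonzero covectors. *)
Definition contact_act (s : R) (p : F) : F :=
  if pselect (annihilator_units C (cscale s (incl p))) is left h
  then contact_point h else p.

Lemma incl_act (s : R) p : s != 0 -> incl (contact_act s p) = cscale s (incl p).
Proof.
move=> s0; rewrite /contact_act; case: pselect => [h|[]]; first exact: contact_incl_point.
exact: (annihilator_scale s0 (contact_inclP p)).
Qed.

Definition contact_proj (p : F) : M := cbase (incl p).

Lemma contact_proj_smooth : smooth_map contact_proj.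
Proof.
exact: (smooth_map_on_comp (@openT _) (@openT _) _ incl_smooth (@cbase_smooth _ _ M)).
Qed.

Lemma contact_act_smooth : smooth_map_on (M := prod_manifold RL F)
  [set sp | sp.1 != 0] (fun sp => contact_act sp.1 sp.2).
Proof.
have oA : open [set sp : prod_manifold RL F | sp.1 != 0].
  have := open_setXT (T := F) (open_nonzero (R := R)); congr open.
  by apply/seteqP; split => -[s p] /=; [move=> []|move=> ?; split].
apply: smooth_map_on_incl => //.
have s1 : smooth_map_on (N := prod_manifold RL (cotangent M))
    [set sp : prod_manifold RL F | sp.1 != 0] (fun sp => (sp.1, incl sp.2)).
  apply: (smooth_map_on_pair oA).
    exact: (smooth_map_onW oA (@openT _) _ (@smooth_fst _ _ _ RL F)).
  apply: (smooth_map_onW oA (@openT _)) => //.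
  exact: (smooth_map_on_comp (@openT _) (@openT _) _ (@smooth_snd _ _ _ RL F) incl_smooth).
have s2 := smooth_map_on_comp oA (@openT _) (fun _ _ => I) s1 cotangent_scale_smooth.
apply: (smooth_map_on_eq oA s2) => -[s p] s0.
by rewrite /= incl_act.
Qed.

Lemma contact_act1 p : contact_act 1 p = p.
Proof.
apply: contact_incl_inj; rewrite incl_act ?oner_neq0//.
by rewrite /cscale scale1r; case: (incl p).
Qed.

Lemma contact_actM (s t : R) p : s != 0 -> t != 0 ->
  contact_act s (contact_act t p) = contact_act (s * t) p.
Proof.
move=> s0 t0; apply: contact_incl_inj; rewrite !incl_act ?mulf_neq0//.
by rewrite /cscale /= scalerA.
Qed.

Lemma contact_act_proj (s : R) p : s != 0 -> contact_proj (contact_act s p) = contact_proj p.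
Proof. by move=> s0; rewrite /contact_proj incl_act. Qed.

Section Trivialization.
Context c (ac : atlas M c) (i : 'I_m).
Let U := frame_dom C c i.

Let Phi (p : F) : prod_manifold M RL := (contact_proj p, cocoord c (incl p) i 0).

(** The factor that gives the chosen annihilating covector over z.1 the i-th coordinate z.2. *)
Let k (z : prod_manifold M RL) : R := z.2 / cocoord c (annihilator_at C z.1) i 0.

Let g (z : prod_manifold M RL) : F :=
  if pselect (annihilator_units C (cscale (k z) (annihilator_at C z.1))) is left h
  then contact_point h else contact_point (annihilator_atP C z.1).

Let B := [set z : prod_manifold M RL | U z.1 /\ z.2 != 0].

Let oU : open U.
Proof. exact: open_frame_dom. Qed.

Let oA : open (contact_proj @^-1` U).
Proof.
apply: open_comp => // p _; exact: smooth_map_continuous contact_proj_smooth p.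
Qed.

Let oB : open B.
Proof. exact: open_trivial_image. Qed.

Let incl_g z : B z -> incl (g z) = cscale (k z) (annihilator_at C z.1).
Proof.
move=> [[cx x0] z0]; rewrite /g; case: pselect => [h|[]]; first exact: contact_incl_point.
apply: annihilator_scale (annihilator_atP C z.1).
by rewrite /k mulf_neq0// invr_eq0.
Qed.

Let g_proj z : B z -> contact_proj (g z) = z.1.
Proof. by move=> Bz; rewrite /contact_proj incl_g// cbase_scale annihilator_at_base. Qed.

Let g_coord z : B z -> cocoord c (incl (g z)) = z.2 *: frame C c i z.1.
Proof. by move=> Bz; rewrite incl_g// cocoord_scale /frame scalerA. Qed.

Let g_coordi z : B z -> cocoord c (incl (g z)) i 0 = z.2.
Proof.
move=> Bz; rewrite incl_g// cocoord_scaleE /k divfK//.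
by have [[]] := Bz.
Qed.

Let Phi_smooth : smooth_map_on (contact_proj @^-1` U) Phi.
Proof.
apply: (smooth_map_on_pair oA).
  exact: (smooth_map_onW oA (@openT _) _ contact_proj_smooth).
apply: chart_smooth_map_on => // p Ap.
pose rl := chart_at (cocoord c (incl p) i 0 : RL).
have ar : atlas RL rl := chart_at_atlasP _.
exists (contact_chart C ac i), rl; split => //; [exact: contact_chart_atlas|exact: chart_at_domP|].
apply/(chart_smooth_real _ ar) => //.
have oV := cimg_open (contact_chart C ac i).
exists (cfun (contact_chart C ac i) @` cdom (contact_chart C ac i)); split => //.
move=> l; apply: Ck_eq (Ck_dec0 l oV) => // _ /set_mem [q cq <-].
change (dec0 (cfun (contact_chart C ac i) q) =
  (Phi (cinv (contact_chart C ac i) (cfun (contact_chart C ac i) q))).2).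
by rewrite (cfunKE cq) contact_chart_fun /prj encK0.
Qed.

Let g_smooth : smooth_map_on B g.
Proof.
apply: smooth_map_on_incl => //; apply: chart_smooth_map_on => // z Bz.
have [[cx x0] z0] := Bz.
pose rl := chart_at (z.2 : RL).
have [rd rf ri] := real_lineP (chart_at_atlasP (z.2 : RL)).
pose e : chart _ (prod_manifold M RL) := prod_chart c rl.
have ez : cdom e z by split => //=; rewrite rd.
exists e, (cochart ac); split => //.
- by apply: prod_chart_atlas => //; exact: chart_at_atlasP.
- exact: cochart_atlas.
- by rewrite cochart_dom -/(contact_proj _) g_proj.
have [oV Vz Vc VB] := chart_nbhs oB Bz ez.
exists (cfun e @` (cdom e `&` B)); split => //.
- move=> _ [z' [cz Bz'] <-]; rewrite (cfunKE cz) cochart_dom.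
  by rewrite -[cbase _]/(contact_proj (g z')) g_proj//; have [[]] := Bz'.
move=> l.
have oF := chart_imgI_open c (open_frame_dom C i ac).
have sub : cfun e @` (cdom e `&` B) `<=`
    (fst : 'rV[R]_m * R -> _) @^-1` (cfun c @` (cdom c `&` frame_dom C c i)).
  by move=> _ [z' [[cz' _] [Uz' _]] <-]; exists z'.1.
have C1 := Ck_comp oV oF sub (Ck_fst l oV) (Ck_frame C l i ac).
have C2 : Ck l (cfun e @` (cdom e `&` B))
    (fun v : 'rV[R]_m * R => v.2 *: frame C c i (cinv c v.1)).
  apply: (Ck_mx oV) => a b.
  apply: Ck_eq (Ck_mul oV (Ck_snd l oV) (Ck_coord a b oV C1)) => // v _.
  by rewrite [RHS]mxE.
apply: Ck_eq (Ck_pair oV (Ck_fst l oV) C2) => // _ /set_mem [z' [cz Bz'] <-].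
change (((cfun e z').1, (cfun e z').2 *: frame C c i (cinv c (cfun e z').1)) =
  cfun (cochart ac) (incl (g (cinv e (cfun e z'))))).
rewrite (cfunKE cz) cochart_fun g_coord// -[cbase _]/(contact_proj (g z')) g_proj//.
have [cz' _] := cz.
by rewrite /e /= rf cfunKE.
Qed.

Lemma contact_trivial : exists Phi' : F -> prod_manifold M RL,
  [/\ diffeo_on (contact_proj @^-1` U)
        [set z : prod_manifold M RL | U z.1 /\ z.2 != 0] Phi',
      forall p, U (contact_proj p) -> (Phi' p).1 = contact_proj p &
      forall (s : R) p, s != 0 -> U (contact_proj p) ->
        (Phi' (contact_act s p)).2 = s * (Phi' p).2].
Proof.
exists Phi; split => //; last first.
  by move=> s p s0 Up; rewrite /Phi /= incl_act// cocoord_scaleE.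
have PB p : U (contact_proj p) -> B (Phi p).
  move=> Up; split => //=.
  by have [] := (annihilator_frame c i (contact_inclP p)).1 Up.
exists g; split => //.
- by move=> z Bz; rewrite /= g_proj//; case: Bz.
split => [p|z]; rewrite inE => H.
  have Bp := PB p H; apply: contact_incl_inj.
  have bE : cbase (incl (g (Phi p))) = cbase (incl p) := g_proj Bp.
  apply: cotangent_eq => // u.
  have cx : cdom c (cbase (incl p)) by have [] := H.
  have cx' : cdom c (cbase (incl (g (Phi p)))) by rewrite bE.
  rewrite (ceval_chart _ ac cx') (ceval_chart _ ac cx) bE (g_coord Bp).
  by rewrite -(cocoord_frame (contact_inclP p) H).
rewrite /Phi g_proj// g_coordi//.
by case: z H.
Qed.

End Trivialization.

Lemma contact_btrivial x : exists U (Phi : F -> prod_manifold M RL),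
  [/\ open U, U x,
      diffeo_on (contact_proj @^-1` U)
        [set z : prod_manifold M RL | U z.1 /\ z.2 != 0] Phi,
      forall p, U (contact_proj p) -> (Phi p).1 = contact_proj p &
      forall (s : R) p, s != 0 -> U (contact_proj p) ->
        (Phi (contact_act s p)).2 = s * (Phi p).2].
Proof.
have [ax xx] := (chart_at_atlasP x, chart_at_domP x).
have [i fi] := frame_dom_exists C ax xx.
have [Phi [H1 H2 H3]] := contact_trivial ax i.
by exists (frame_dom C (chart_at x) i), Phi; split => //; exact: open_frame_dom.
Qed.

Definition contact_principal_bundle : principal_bundle M :=
  PrincipalBundle contact_proj_smooth contact_act_smooth contact_act1 contact_actM
    contact_act_proj contact_btrivial.

End ContactBundle.

(** * The symplectic form on the bundle of a contact structure *)

Section ContactSymplectic.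
Context {R : realType} {m : nat} {M : manifold 'rV[R]_m} (C : contact_structure M).
Local Notation RL := (@real_line R).
Local Notation F := (contact_principal_bundle C).
Local Notation incl := (@contact_incl _ _ _ C : F -> cotangent M).

Definition contact_sform : dform F 2 := pullback incl (canonical_symplectic_form M).

Let theta : dform F 1 := pullback incl (@liouville_form _ _ M).

Lemma incl_lift : equivariant_lift incl.
Proof. by split => //; [exact: incl_smooth|move=> s p s0; exact: incl_act]. Qed.

Let thetaE p v : theta p v = ceval (incl p) (tangent_map (@bproj _ _ _ F) p (v ord0)).
Proof. exact: (equivariant_lift_liouville incl_lift). Qed.

Let theta_smooth1 p : smooth1_at theta p.
Proof. by apply: smooth1_at_pullback; [exact: incl_smooth|exact: liouville_smooth1]. Qed.

Let dtheta : ext_derivative theta = contact_sform.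
Proof.
apply/funext => p; apply/funext => v.
apply: (ext_derivative_pullback_on v (@openT _) (@incl_smooth _ _ _ C) I).
exact: liouville_smooth1.
Qed.

Lemma contact_sform_euler p v :
  contact_sform p (pair2 (euler p) v) = ceval (incl p) (tangent_map (@bproj _ _ _ F) p v).
Proof. exact: (equivariant_lift_euler incl_lift). Qed.

Let sform_alt p : alternating (contact_sform p).
Proof. by rewrite -dtheta; exact: alternating_ext_derivative. Qed.

(** The tautological form is homogeneous on the bundle, since the inclusion is equivariant and the
    projection invariant; the exterior derivative commutes with pullback by the action. *)
Lemma contact_sform_homogeneous (s : R) p v : s != 0 ->
  pullback (@bact _ _ _ F s) contact_sform p v = s * contact_sform p v.
Proof.
move=> s0; have ss := @act_smooth_at _ _ _ F s s0.
have e (q : F) w : setT q -> pullback (@bact _ _ _ F s) theta q w = s * theta q w.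
  move=> _; rewrite {1}/pullback !thetaE incl_act// ceval_scale.
  exact: (congr1 (fun z => s * ceval (incl q) z)
    (@tangent_bproj_act _ _ _ F q s (w ord0) s0)).
have sp := smooth1_at_pullback ss (theta_smooth1 (bact s p)).
have [_ eq] := smooth1_at_eq (@openT F) I e sp.
rewrite -dtheta.
apply: etrans (esym (ext_derivative_pullback_on v (@openT _) ss I (theta_smooth1 _))) _.
rewrite eq !ext_derivative1E /curl.
have [ap pp] := (chart_at_atlasP p, chart_at_domP p).
have [V [oV Vp Vc fV]] := smooth1_in_at ap pp (theta_smooth1 p).
have D w t : 'D_t (form1_in (fun q w => s * theta q w) (chart_at p) ^~ w)
    (cfun (chart_at p) p) = s * 'D_t (form1_in theta (chart_at p) ^~ w) (cfun (chart_at p) p).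
  have d : derivable (form1_in theta (chart_at p) ^~ w) (cfun (chart_at p) p) t.
    apply: diff_derivable.
    exact: (Ck_differentiable (Ck_partial1 w oV (fV 1%N).1) Vp).
  exact: (deriveZ s d).
apply: etrans (congr2 (fun a b : R => a - b) (D _ _) (D _ _)) _.
by rewrite -mulrBr.
Qed.

Section LocalSection.
Context (U : set M) (eta : dform M 1) (oU : open U) (ce : contact_form_on U eta).
Hypothesis Ce : forall y, U y -> forall v, (v \in C y) = (eta y (fun=> v) == 0).

Let ann y : U y -> annihilator_units C (form_covector eta y).
Proof. exact: contact_form_covector ce Ce y. Qed.

(** The local contact form itself, seen as a section of the bundle over U; off U the value is
    immaterial. *)
Let sigma (y : M) : F :=
  if pselect (annihilator_units C (form_covector eta y)) is left h
  then contact_point h else contact_point (annihilator_atP C y).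

Let incl_sigma y : U y -> incl (sigma y) = form_covector eta y.
Proof. by move=> Uy; rewrite /sigma; case: pselect => // -[]; exact: ann. Qed.

Let eta_alt y : U y -> alternating (eta y).
Proof. by have [_ [ae _] _] := ce; exact: ae. Qed.

Let sigma_smooth : smooth_map_on U sigma.
Proof.
apply: smooth_map_on_incl => //; apply: chart_smooth_map_on => // x Ux.
have [ax xx] := (chart_at_atlasP x, chart_at_domP x).
exists (chart_at x), (cochart ax); split => //.
- exact: cochart_atlas.
- by rewrite cochart_dom /= incl_sigma.
have [_ se _] := ce.
have [W [oW Wx Wc fW]] := smooth1_in_at ax xx (smooth_form_smooth1_at oU Ux se).
pose V := W `&` cfun (chart_at x) @` (cdom (chart_at x) `&` U).
have oV : open V by apply: openI => //; exact: chart_imgI_open.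
exists V; split => //.
- by split => //; exists x.
- by move=> y [/Wc].
- by move=> _ [_ [z [cz Uz] <-]]; rewrite cochart_dom /= cfunKE// incl_sigma.
move=> k.
have C1 : Ck k V (fun y => \col_i form1_in eta (chart_at x) y (delta_mx 0 i)).
  apply: (Ck_mx oV) => i j.
  have Ci : Ck k V ((form1_in eta (chart_at x))^~ (delta_mx 0 i)).
    by apply: (CkW _ (Ck_partial1 _ oW (fW k).1)) => y [].
  by apply: Ck_eq Ci => // y _; rewrite mxE.
apply: Ck_eq (Ck_pair oV (Ck_id k oV) C1) => // _ /set_mem [_ [z [cz Uz] <-]].
change ((cfun (chart_at x) z,
    \col_i form1_in eta (chart_at x) (cfun (chart_at x) z) (delta_mx 0 i)) =
  cfun (cochart ax) (incl (sigma (cinv (chart_at x) (cfun (chart_at x) z))))).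
rewrite (cfunKE cz) incl_sigma// cochart_fun.
by rewrite (cocoord_form_covector U)//; exact: eta_alt.
Qed.

Let sigmaK y : U y -> bproj (sigma y) = y.
Proof. by move=> Uy; rewrite /= /contact_proj -[contact_incl _]/(incl (sigma y)) incl_sigma. Qed.

Let tangent_sigma x v : U x ->
  tangent_map (@bproj _ _ _ F) (sigma x) (tangent_map sigma x v) = v.
Proof.
move=> Ux.
apply: etrans (esym (tangent_map_comp v oU (@openT _) sigma_smooth (bproj_smooth F) Ux I)) _.
have ids : chart_smooth (chart_at x) (chart_at (id x)) id x.
  by apply: chart_smooth_id; [exact: chart_at_atlasP|exact: chart_at_atlasP|
    exact: chart_at_domP|exact: chart_at_domP].
apply: etrans (tangent_map_eq (f := id) v oU Ux _ ids) _; last exact: tangent_map_id.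
by move=> z Uz; exact: esym (sigmaK Uz).
Qed.

Let etaE x v : U x -> pullback sigma theta x v = eta x v.
Proof.
move=> Ux; rewrite /pullback thetaE (tangent_sigma (v ord0) Ux) incl_sigma//.
by rewrite ceval_form_covector -?cst1E//; exact: eta_alt.
Qed.

Let detaE x v : U x -> ext_derivative eta x v = pullback sigma contact_sform x v.
Proof.
move=> Ux; rewrite -dtheta.
apply: etrans _ (ext_derivative_pullback_on v oU sigma_smooth Ux (theta_smooth1 _)).
have sp := smooth1_at_pullback_on oU sigma_smooth Ux (theta_smooth1 (sigma x)).
have [_ e] := smooth1_at_eq oU Ux (fun z v Uz => etaE v Uz) sp.
exact: esym (e v).
Qed.

(** Let w be in the kernel of the form at the point given by eta. Pairing with the generator puts
    the projection u of w in the kernel of eta, and u is then orthogonal to that kernel for d eta,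
    so u = 0 by the contact condition. Thus w is a multiple of the generator, and pairing with a
    vector on which eta is nonzero shows that the multiple is 0. *)
Lemma contact_sform_section x : U x -> exists p : F, bproj p = x /\
  forall w, (forall v, contact_sform p (pair2 w v) = 0) -> w = 0.
Proof.
move=> Ux; exists (sigma x); split; first exact: sigmaK.
move=> w w0; set q := sigma x in w0 *.
have aq := sform_alt q; have [bl br b0] := alternating2P aq.
have iq : incl q = form_covector eta x by exact: incl_sigma.
have evE v : ceval (incl q) v = eta x (fun=> v).
  by rewrite iq ceval_form_covector//; exact: eta_alt.
pose u := tangent_map (@bproj _ _ _ F) q w.
have au : eta x (fun=> u) = 0.
  by rewrite -evE -contact_sform_euler (alternating2N _ _ aq) w0 oppr0.
have bE v1 v2 : ext_derivative eta x (pair2 v1 v2) =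
    contact_sform q (pair2 (tangent_map sigma x v1) (tangent_map sigma x v2)).
  by rewrite detaE// /pullback pair2_map.
have [t wE] : exists t, w - tangent_map sigma x u = t *: euler q.
  apply: tangent_bproj_vertical.
  by rewrite linearB /= tangent_sigma// subrr.
have sE : tangent_map sigma x u = w - t *: euler q by rewrite -wE subKr.
have u0 : u = 0.
  have [om se ne] := ce.
  have se1 := smooth_form_smooth1_at oU Ux se.
  have mn : m = (m./2 * 2).+1 by have := odd_double_half m; rewrite om muln2.
  apply: (contact_nondegenerate (eta_alt Ux) (alternating_ext_derivative se1) mn (ne x Ux) au).
  move=> v av; rewrite bE sE.
  rewrite (functionalD (bl _)) (functionalN (bl _)) (functionalZ (bl _)) w0.
  by rewrite contact_sform_euler tangent_sigma// evE av mulr0 subrr.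
have wt : w = t *: euler q by rewrite -wE u0 linear0 subr0.
have [z z0] : exists z, eta x (fun=> z) != 0.
  have [xi0 _] := ann Ux; have [z z0] := cvec_neq0P xi0.
  by exists z; rewrite -evE iq.
have [v vz] := tangent_bproj_surj q z.
have := w0 v; rewrite wt (functionalZ (bl _)) contact_sform_euler vz evE => /eqP.
by rewrite mulf_eq0 (negbTE z0) orbF => /eqP ->; rewrite scale0r.
Qed.

End LocalSection.

(** Every point is moved by the action to a point of a local section; the action is invertible on
    tangent vectors and only rescales the form. *)
Lemma contact_sform_nondegenerate (p : F) w :
  (forall v, contact_sform p (pair2 w v) = 0) -> w = 0.
Proof.
move=> w0; have [U [eta [oU Up ce Ce]]] := contact_local C (bproj p).
have [q [qp q0]] := contact_sform_section oU ce Ce Up.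
have [s s0 qE] := same_fibre (esym qp).
have s'0 : s^-1 != 0 by rewrite invr_eq0.
have pE : p = bact s^-1 q by rewrite qE bactM// mulVf// bact1.
have ss := @act_smooth_at _ _ _ F s s0; have ss' := @act_smooth_at _ _ _ F s^-1 s'0.
have inv t (t0 : t != 0) (r : F) v :
  tangent_map (@bact _ _ _ F t^-1) (bact t r) (tangent_map (@bact _ _ _ F t) r v) = v.
  have t'0 : t^-1 != 0 by rewrite invr_eq0.
  apply: etrans (esym (tangent_map_comp v (@openT _) (@openT _)
    (@act_smooth_at _ _ _ F t t0) (@act_smooth_at _ _ _ F t^-1 t'0) I I)) _.
  have -> : @bact _ _ _ F t^-1 \o @bact _ _ _ F t = id.
    by apply/funext => z; rewrite /comp bactM// mulVf// bact1.
  exact: tangent_map_id.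
have wq : tangent_map (@bact _ _ _ F s) p w = 0.
  rewrite qE in q0; apply: q0 => v.
  have e1 : bact s^-1 (bact s p) = p by rewrite bactM// mulVf// bact1.
  have vE := inv _ s'0 (bact s p) v; rewrite invrK e1 in vE.
  pose v' := tangent_map (@bact _ _ _ F s^-1) (bact s p) v.
  apply: etrans (congr1 (fun z => contact_sform (bact s p)
    (pair2 (tangent_map (@bact _ _ _ F s) p w) z)) (esym vE)) _.
  apply: etrans (congr1 (contact_sform (bact s p))
    (esym (pair2_map (tangent_map (@bact _ _ _ F s) p) w v'))) _.
  apply: etrans (contact_sform_homogeneous p (pair2 w v') s0) _.
  by rewrite w0 mulr0.
apply: etrans (esym (inv s s0 p w)) _.
exact: etrans (congr1 (tangent_map (@bact _ _ _ F s^-1) (bact s p)) wq) (linear0 _).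
Qed.

Lemma contact_sform_symplectic : symplectic_form contact_sform.
Proof.
split.
- by rewrite /= (contact_odd C).
- by rewrite -dtheta; exact: smooth_form_ext_derivative.
- by move=> p v; rewrite -dtheta; exact: ext_derivative_closed.
- by move=> p u u0; apply: (@contact_sform_nondegenerate p) => v; exact: u0.
Qed.

Definition contact_bundle : symplectic_bundle M :=
  SymplecticBundle contact_sform_symplectic contact_sform_homogeneous.

(** A vector killed by the differential of the inclusion lies in the kernel of the pulled-back form,
    which is trivial. *)
Lemma incl_embedding : smooth_embedding incl.
Proof.
split; [exact: incl_smooth|exact: contact_incl_inj| |].
  move=> p u v e; apply/subr0_eq; apply: (@contact_sform_nondegenerate p) => w.
  have T0 : tangent_map incl p (u - v) = 0 by rewrite linearB /= e subrr.
  have om : alternating (canonical_symplectic_form M (incl p)).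
    by apply: alternating_ext_derivative; exact: liouville_smooth1.
  have [ll _ _] := alternating2P om.
  by rewrite /contact_sform /pullback pair2_map T0 (functional0 (ll _)).
move=> A oA.
pose T := {ci : chart 'rV[R]_m M * 'I_m | atlas M ci.1}.
pose D (t : T) := contact_chart C (svalP t) (sval t).2.
(* [Bt t] pulls the chart image of A back along [prj], which is defined on all covectors over the
   chart; [Ft t] keeps the base points where the frame exists. There [prj] restricts on the
   annihilator to the chart itself, so the range meets this set in points of A only. *)
pose Bt (t : T) : set (cotangent M) := cdom (cochart (svalP t)) `&`
  cfun (cochart (svalP t)) @^-1` (prj (sval t).2 @^-1` (cfun (D t) @` (cdom (D t) `&` A))).
pose Ft (t : T) : set (cotangent M) := @cbase _ _ M @^-1` frame_dom C (sval t).1 (sval t).2.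
exists (\bigcup_t (Bt t `&` Ft t)).
  apply: bigcup_open => t _; apply: openI; last first.
    apply: open_comp; last exact: (open_frame_dom C (sval t).2 (svalP t)).
    by move=> x _; exact: smooth_map_continuous (@cbase_smooth _ _ M) x.
  apply: (open_setI_preimage (cdom_open _)).
    by move=> x cx; apply: cfun_continuous; rewrite inE.
  apply: (open_comp (f := prj (sval t).2)); last exact: (chart_imgI_open (D t) oA).
  by move=> z _; exact: (Ck_prj 0 (sval t).2 (@openT _) z I).
apply/seteqP; split.
  move=> _ [p Ap <-]; split; first by exists p.
  have [c [ac [i [cp cip]]]] := incl_chart p.
  exists (exist _ (c, i) ac : T) => //; split; last exact: cp.
  by split => //; exists p.
move=> _ [[p _ <-] [t _ [[ct [q [Dq Aq] qp]] Fp]]].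
suff -> : p = q by exists q.
rewrite -(cfunKE (c := D t) (x := p))//.
by rewrite -[RHS](cfunKE Dq) qp.
Qed.

Lemma incl_range : range incl = annihilator_units C.
Proof.
apply/seteqP; split; first by move=> _ [p _ <-]; exact: contact_inclP.
by move=> xi axi; exists (contact_point axi).
Qed.

Lemma contact_bundle_identified : identified_with_annihilator contact_bundle C.
Proof.
exists incl; split => //.
- exact: incl_embedding.
- exact: incl_range.
- by move=> s p s0; exact: incl_act.
Qed.

(** The lift takes its values in the annihilator, and corestricting it gives an equivariant map over
    M between principal bundles, which is automatically a diffeomorphism. *)
Lemma lift_bundle_iso (P : symplectic_bundle M) (iota : P -> cotangent M) :
  equivariant_lift iota -> (forall p, annihilator_units C (iota p)) ->
  pullback iota (canonical_symplectic_form M) = sform P ->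
  bundle_iso P contact_bundle.
Proof.
move=> [si bi ei] ai pi.
pose phi (p : P) : contact_bundle := contact_point (ai p).
have sphi : smooth_map phi by apply: smooth_map_on_incl; [exact: openT|exact: si].
have bphi p : bproj (phi p) = bproj p by exact: bi.
have ephi (s : R) p : s != 0 -> phi (bact s p) = bact s (phi p).
  move=> s0; apply: contact_incl_inj.
  by apply: etrans (ei s p s0) _; apply: esym; exact: incl_act.
exists phi; split => //; first exact: equivariant_diffeo.
rewrite -pi; apply/funext => p; apply/funext => v.
rewrite /= /contact_sform /pullback; congr (canonical_symplectic_form M _ _).
apply/funext => i; apply: esym.
exact: (tangent_map_comp (v i) (@openT _) (@openT _) sphi (@incl_smooth _ _ _ C) I I).
Qed.

End ContactSymplectic.

(** * Injectivity and the resulting correspondence *)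

Lemma contact_structure_eq (R : realType) (m : nat) (M : manifold 'rV[R]_m)
  (C C' : contact_structure M) : (forall x, C x = C' x) -> C = C'.
Proof.
case: C => h o d l; case: C' => h' o' d' l' /= e.
have eh : h = h' by apply/funext.
subst h'; congr ContactStructure; exact: Prop_irrelevance.
Qed.

(** The isomorphism followed by the inclusion of the second annihilator is another equivariant lift
    of the first bundle; by uniqueness it is the first inclusion, so one covector over each point
    annihilates both hyperplanes. *)
Lemma contact_bundle_inj (R : realType) (m : nat) (M : manifold 'rV[R]_m)
  (C C' : contact_structure M) :
  bundle_iso (contact_bundle C) (contact_bundle C') -> C = C'.
Proof.
move=> [phi [[psi [sphi _ _ _ _]] bphi ephi pphi]].
have l1 := incl_lift C; have l2 := incl_lift C'.
pose j (p : contact_bundle C) := contact_incl (phi p : contact_total C').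
have lj : equivariant_lift j.
  split.
  - exact: (smooth_map_on_comp (@openT _) (@openT _) _ sphi (@incl_smooth _ _ _ C')).
  - by move=> p; exact: bphi.
  - by move=> s p s0; rewrite /j ephi//; exact: incl_act.
have pj : pullback j (canonical_symplectic_form M) = sform (contact_bundle C).
  rewrite -pphi; apply/funext => p; apply/funext => v.
  rewrite /= /contact_sform /pullback; congr (canonical_symplectic_form M _ _).
  apply/funext => i.
  exact: (tangent_map_comp (v i) (@openT _) (@openT _) sphi (@incl_smooth _ _ _ C') I I).
have ij := equivariant_lift_unique (P := contact_bundle C) l1 lj (erefl _) pj.
apply: contact_structure_eq => x.
have [p px] := fibre_nonempty (contact_bundle C) x.
have a1 : annihilator_units C (j p) by rewrite -ij; exact: contact_inclP.
have a2 : annihilator_units C' (j p) by exact: contact_inclP.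
have jx : cbase (j p) = x by have [_ -> _] := lj.
by apply/vspaceP => v; rewrite -jx (annihilator_ker v a1) (annihilator_ker v a2).
Qed.

Theorem theorem1p1 (R : realType) (m : nat) (M : manifold 'rV[R]_m) :
  exists F : contact_structure M -> symplectic_bundle M,
    [/\ forall C, identified_with_annihilator (F C) C,
        forall C C', bundle_iso (F C) (F C') -> C = C',
        forall P, exists C, bundle_iso P (F C) &
        forall P C, identified_with_annihilator P C -> bundle_iso P (F C)].
Proof.
exists (@contact_bundle R m M); split.
- exact: contact_bundle_identified.
- exact: contact_bundle_inj.
- move=> P; have [C [iota [li ai pi]]] := symplectic_bundle_lift P.
  by exists C; exact: lift_bundle_iso ai pi.
- move=> P C [iota [[si _ _ _] ri bi ei pi]].
  apply: (lift_bundle_iso (iota := iota)) => //.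
  by move=> p; rewrite -ri; exists p.
Qed.
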